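(* Let $b\in C^1_\sharp(Y_d)^d$ be a vector field in $\mathbb{R}^d$ and let $X$ be the flow associated with $b$. (i) Let $A$ be a non-empty subset of $\mathbb{R}^d$. Assume that there exist $T_A,k_A\in(0,\infty)$ such that for every $x\in A$ there exist $T(x)\in(0,T_A]$ and $k(x)\in\mathbb{Z}^d$ with $|k(x)|\le k_A$ such that $$\forall\,t\ge 0,\quad X\big(t+T(x),x\big)=X(t,x)+k(x).$$ Then $X$ satisfies the fine asymptotic expansion in $A$ with $\zeta(x):=k(x)/T(x)$ for $x\in A$, i.e. there exists a constant $C_A>0$, only depending on $A$, such that $|X(t,x)-x-t\,\zeta(x)|\le C_A$ for all $t\ge 0$ and all $x\in A$. (ii) Let $d=2$. Assume that $b$ is a non vanishing vector field in $C^2_\sharp(Y_2)^2$ admitting an invariant probability measure $\sigma(x)\,dx$, where $\sigma$ is a positive function in $C^5_\sharp(Y_2)$ with mean value $1$, such that $\overline{\sigma b}$ is commensurable in $\mathbb{R}^2$. Then there exist a $C^2$-diffeomorphism $\Psi$ on $Y_2$, of the form $\Psi(x)=Mx+\Psi_\sharp(x)$ for $x\in\mathbb{R}^2$, with $M$ a $2\times 2$ integer matrix of determinant $\pm1$ and $\Psi_\sharp\in C^2_\sharp(Y_2)^2$, a non vanishing function $a\in C^1_\sharp(Y_2)$, a non null vector $\xi\in\mathbb{R}^2$ and $T>0$ with $T\,\xi\in\mathbb{Z}^2$, such that $\Psi$ maps $X$ to the flow $\widehat X(t,y):=\Psi\big(X(t,\Psi^{-1}(y))\big)$ associated with the vector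 field $$\hat b(y):=\big((\nabla\Psi\,b)\circ\Psi^{-1}\big)(y)=a(y)\,\xi,$$ and such that $X$ satisfies the fine asymptotic expansion $$\forall\,t\ge 0,\ \forall\,x\in\mathbb{R}^2,\quad X(t,x)=x+t\,\zeta\big(\Psi(x)\big)+O(1),\qquad \zeta\big(\Psi(x)\big):=\left(\frac1T\int_0^T\frac{dt}{a\big(t\,\xi+\Psi(x)\big)}\right)^{-1}\xi,$$ where $O(1)$ is bounded uniformly with respect to $t$ and $x$. (iii) Let $d>2$. Assume that there exists $U=(u_1,\dots,u_d)$ with $\nabla U\in C^1_\sharp(Y_d)^{d\times d}$ and $$b\cdot\nabla u_1>0,\qquad b\cdot\nabla u_2=\cdots=b\cdot\nabla u_d=0,\qquad \det(\nabla U)\ne0\qquad\text{in }Y_d.$$ Set $M:=\big(\overline{\nabla U}\big)^{-1}$, $\xi:=M e_1$, and let $\Psi:=MU$, a $C^2$-diffeomorphism on $Y_d$, which maps $X$ to the flow associated with the vector field $\hat b:=a\,\xi$, where $a(y):=\big((b\cdot\nabla u_1)\circ\Psi^{-1}\big)(y)>0$. Assume that $\xi$ is commensurable in the sense that there exists $T>0$ such that $T\,\xi\in\mathbb{Z}^d$. Then $X$ satisfies the fine asymptotic expansion $$\forall\,t\ge 0,\ \forall\,x\in\mathbb{R}^d,\quad X(t,x)=x+t\,\zeta\big(\Psi(x)\big)+O(1),\qquad \zeta\big(\Psi(x)\big):=\left(\frac1T\int_0^T\frac{dt}{a\big(t\,\xi+\Psi(x)\big)}\right)^{-1}\xi,$$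 where $O(1)$ is bounded uniformly with respect to $t$ and $x$.
   Context: $Y_d=\mathbb{R}^d/\mathbb{Z}^d$. $C^k_\sharp(Y_d)$ denotes the space of $\mathbb{Z}^d$-periodic real functions in $C^k(\mathbb{R}^d)$. For $b\in C^1_\sharp(Y_d)^d$, the flow $X$ associated with $b$ is the solution of $\frac{\partial X}{\partial t}(t,x)=b(X(t,x))$, $X(0,x)=x$, for $x\in\mathbb{R}^d$; it induces a flow on $Y_d$, and a probability measure $\mu$ on $Y_d$ is invariant for $X$ if $\mu\circ X(t,\cdot)=\mu$ for any $t\ge 0$. $\overline{f}:=\int_{Y_d}f(x)\,dx$ is the mean value of a $\mathbb{Z}^d$-periodic scalar-, vector- or matrix-valued function $f$. A vector $v\in\mathbb{R}^2$ is commensurable in $\mathbb{R}^2$ if there exists $k\in\mathbb{Z}^2\setminus\{0\}$ with $v\cdot k=0$. For $F:\mathbb{R}^d\to\mathbb{R}^d$, $\nabla F$ is the Jacobian matrix with entries $\partial F_i/\partial x_j$; $\nabla U\in C^1_\sharp(Y_d)^{d\times d}$ means that $U$ is a $C^2$ map on $\mathbb{R}^d$ whose Jacobian matrix is $\mathbb{Z}^d$-periodic ($U$ need not be periodic); under the hypotheses of (iii) the matrix $\overline{\nabla U}$ is invertible. A $C^2$-diffeomorphism on $Y_d$ is regarded as its lift to a $C^2$-diffeomorphism of $\mathbb{R}^d$, equal to a unimodular integer matrix plus a $\mathbb{Z}^d$-periodic map. $e_1$ is the first canonical basis vector of $\mathbb{R}^d$. *)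

(* Defs.v *)
From mathcomp Require Import all_boot all_order all_algebra.
From mathcomp Require Import all_classical all_reals all_analysis.

Set Implicit Arguments.
Unset Strict Implicit.
Unset Printing Implicit Defensive.

Import Order.TTheory GRing.Theory Num.Theory.
Import numFieldNormedType.Exports.

Local Open Scope classical_set_scope.
Local Open Scope ring_scope.

(* Points of R^d are column vectors, so that matrices act on the left.
   Z^d is [mxOver Num.int]; functions and sets on the torus Y_d are the
   Z^d-periodic functions and sets on R^d. *)

Section Definitions.
Context {R : realType}.

(* The norm that the library puts on 'cV[R]_d is the sup norm. *)
Definition enorm d (x : 'cV[R]_d) : R := Num.sqrt (\sum_i x i 0 ^+ 2).

Definition dotv d (x y : 'cV[R]_d) : R := \sum_i x i 0 * y i 0.

Definition Zperiodic d (V : Type) (f : 'cV[R]_d -> V) : Prop :=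
  forall x k : 'cV[R]_d, k \is a mxOver Num.int -> f (x + k) = f x.

Definition partial d (j : 'I_d) (f : 'cV[R]_d -> R) (x : 'cV[R]_d) : R :=
  'D_(delta_mx j 0) f x.

Fixpoint Ck d (k : nat) (f : 'cV[R]_d -> R) : Prop :=
  match k with
  | 0 => continuous f
  | k'.+1 => (forall x, differentiable f x) /\
             (forall j, Ck k' (partial j f))
  end.

Definition Ck_mx d m n (k : nat) (F : 'cV[R]_d -> 'M[R]_(m, n)) : Prop :=
  forall i j, Ck k (fun x => F x i j).

Definition Ck_sharp d (k : nat) (f : 'cV[R]_d -> R) : Prop :=
  Ck k f /\ Zperiodic f.

Definition Ck_sharp_mx d m n (k : nat) (F : 'cV[R]_d -> 'M[R]_(m, n)) : Prop :=
  Ck_mx k F /\ Zperiodic F.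

(* Entries dF_i/dx_j; this is the transpose of the library's [jacobian],
   which acts on row vectors. *)
Definition nabla d m (F : 'cV[R]_d -> 'cV[R]_m) (x : 'cV[R]_d) : 'M[R]_(m, d) :=
  \matrix_(i, j) partial j (fun y => F y i 0) x.

(* Integral over the unit cell [0,1]^d, written as an iterated Lebesgue
   integral (Fubini), one coordinate at a time. It is only applied to Borel
   functions that are bounded on the cell. *)
Fixpoint mean d : ('cV[R]_d -> R) -> R :=
  match d with
  | 0 => fun f => f 0
  | d'.+1 => fun f =>
      \int[lebesgue_measure]_(t in `[0, 1])
        mean (fun y : 'cV[R]_d' => f (col_mx (t%:M : 'cV[R]_1) y))
  end.

Definition mean_mx d m n (F : 'cV[R]_d -> 'M[R]_(m, n)) : 'M[R]_(m, n) :=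
  \matrix_(i, j) mean (fun x => F x i j).

Definition is_flow d (b : 'cV[R]_d -> 'cV[R]_d)
    (X : R -> 'cV[R]_d -> 'cV[R]_d) : Prop :=
  forall x, X 0 x = x /\
    forall t, is_derive t (1 : R) (fun s => X s x) (b (X t x)).

Definition torus_borel d (E : set 'cV[R]_d) : Prop :=
  <<s (@open 'cV[R]_d) >> E /\ Zperiodic E.

(* The measure sigma(x) dx on Y_d. *)
Definition density_measure d (sigma : 'cV[R]_d -> R) (E : set 'cV[R]_d) : R :=
  mean (fun x => sigma x * \1_E x).

Definition invariant_measure d (X : R -> 'cV[R]_d -> 'cV[R]_d)
    (mu : set 'cV[R]_d -> R) : Prop :=
  forall t, 0 <= t -> forall E, torus_borel E -> mu (X t @` E) = mu E.

Definition commensurable d (v : 'cV[R]_d) : Prop :=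
  exists k : 'cV[R]_d, [/\ k \is a mxOver Num.int, k != 0 & dotv v k = 0].

(* [Psi] is the lift of a C^2-diffeomorphism of Y_d with inverse [Phi]. *)
Definition torus_C2_diffeo d (M : 'M[R]_d) (Psi_sharp : 'cV[R]_d -> 'cV[R]_d)
    (Psi Phi : 'cV[R]_d -> 'cV[R]_d) : Prop :=
  [/\ M \is a mxOver Num.int, \det M = 1 \/ \det M = -1,
      Ck_sharp_mx 2 Psi_sharp &
      forall x, Psi x = M *m x + Psi_sharp x] /\
  [/\ cancel Psi Phi, cancel Phi Psi, Ck_mx 2 Psi & Ck_mx 2 Phi].

Definition expansion_bound d (X : R -> 'cV[R]_d -> 'cV[R]_d)
    (A : set 'cV[R]_d) (zeta : 'cV[R]_d -> 'cV[R]_d) (C : R) : Prop :=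
  forall t x, 0 <= t -> A x -> enorm (X t x - x - t *: zeta x) <= C.

Definition fine_expansion d (X : R -> 'cV[R]_d -> 'cV[R]_d)
    (A : set 'cV[R]_d) (zeta : 'cV[R]_d -> 'cV[R]_d) : Prop :=
  exists2 C : R, 0 < C & expansion_bound X A zeta C.

Definition zeta_mean d (a : 'cV[R]_d -> R) (xi : 'cV[R]_d) (T : R)
    (y : 'cV[R]_d) : 'cV[R]_d :=
  (T^-1 * \int[lebesgue_measure]_(t in `[0, T]) (a (t *: xi + y))^-1)^-1 *: xi.

End Definitions.

(* Main.v *)
From HB Require Import structures.
Require Import Defs.
From mathcomp Require Import all_boot all_order all_algebra.
From mathcomp Require Import all_classical all_reals all_analysis.
From mathcomp Require Import ring lra.

Set Implicit Arguments.
Unset Strict Implicit.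
Unset Printing Implicit Defensive.

Import Order.TTheory GRing.Theory Num.Theory.
Import numFieldNormedType.Exports.

Local Open Scope classical_set_scope.
Local Open Scope ring_scope.

(** The trajectories that satisfy the hypothesis of (i) repeat themselves up to
    a translation, so they follow their mean velocity with an error produced by
    a single period ([period_expansion]). The velocity does not depend on the
    period used to compute it ([rotation_unique]), so one constant serves for
    all the choices of the periods ([periodic_expansion]).

    For (iii), the coordinates [U] straighten the field ([rectification]). Over
    an integer vector [U] increases by the mean [L] of its Jacobian matrix
    applied to this vector ([quasi_periodic]), so [Psi], which is [U] multiplied
    by the inverse of [L], is the identity plus a periodic map. The matrix [L] is
    invertible because otherwise some combination of the coordinates would be
    periodic, and critical at its maximum ([mean_nabla_unit]). That [Psi] is a
    diffeomorphism is Hadamard's theorem ([hadamard], [inverse_C2]). In the new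
    coordinates a point moves on a line of direction [xi] with a scalar speed
    [a], and the elapsed time is the integral of [1 / a] along the line. When
    [T *: xi] is an integer vector, [1 / a] is periodic along the line, so that
    time is proportional to the distance up to a bounded error
    ([straight_expansion]).

    For (ii), coordinates of this kind are constructed. The second one is the
    stream function [u] of [sigma b]. It exists because an invariant density makes
    [sigma b] divergence free ([divergence_free], [stream_function]), and the
    commensurability gives an integer vector [q] along which [u] is periodic
    ([commensurable_stream]). As [u] has no critical point, each of its level sets
    in the plane is a single trajectory ([flow_box], [level_orbit]). Since [x] and
    [x + q] are at the same level, the trajectory of [x] passes through [x + q], either for
    all [x] in the future or for all [x] in the past, and within a bounded time
    ([transit_bounded]). Hence, up to the sign of [q], there is a time after which every point has
    progressed in the direction of [q] ([uniform_progress]). Averaging the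
    component along [q] over this time gives the first coordinate, which
    increases along the trajectories; the average is taken along an Euler scheme,
    whose iterates are as regular as [b] ([increasing_coordinate]). The vector
    [xi] obtained from these coordinates is proportional to [q], hence rational
    ([planar_expansion]). *)

(** * Sup norm and continuity *)

Section Norms.
Context {R : realType}.

Lemma norm_coord_le m n (x : 'M[R]_(m, n)) i j : `|x i j| <= `|x|.
Proof.
rewrite [leRHS]/Num.Def.normr/= mx_normrE.
exact: (le_bigmax _ (fun i : 'I_m * 'I_n => `|x i.1 i.2|) (i, j)).
Qed.

Lemma norm_le_coord m n (x : 'M[R]_(m, n)) c :
  0 <= c -> (forall i j, `|x i j| <= c) -> `|x| <= c.
Proof.
move=> c0 xc; rewrite [leLHS]/Num.Def.normr/= mx_normrE.
by apply: bigmax_le => // -[i j] _; exact: xc.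
Qed.

Lemma normv_le_coord n (x : 'cV[R]_n) c :
  0 <= c -> (forall i, `|x i 0| <= c) -> `|x| <= c.
Proof. by move=> c0 xc; apply: norm_le_coord => // i j; rewrite ord1. Qed.

Lemma enorm_le d (x : 'cV[R]_d) : enorm x <= d%:R * `|x|.
Proof.
rewrite /enorm -[leRHS]ger0_norm ?mulr_ge0// -sqrtr_sqr ler_wsqrtr//.
apply: (@le_trans _ _ (\sum_(i < d) `|x| ^+ 2)).
  apply: ler_sum => i _; rewrite -real_normK ?num_real//.
  by rewrite lerXn2r ?nnegrE// norm_coord_le.
rewrite sumr_const card_ord -[leLHS]mulr_natl exprMn ler_wpM2r ?sqr_ge0//.
by rewrite -natrX ler_nat; case: (d) => // k; rewrite -{1}[k.+1]expn1 leq_pexp2l.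
Qed.

Lemma norm_le_enorm d (x : 'cV[R]_d) : `|x| <= enorm x.
Proof.
apply: normv_le_coord => [|i]; first exact: sqrtr_ge0.
rewrite -sqrtr_sqr ler_wsqrtr// (bigD1 i)//= lerDl.
by apply: sumr_ge0 => j _; exact: sqr_ge0.
Qed.

Lemma mulmx_norm_le m n p (A : 'M[R]_(m, n)) (B : 'M[R]_(n, p)) :
  `|A *m B| <= n%:R * `|A| * `|B|.
Proof.
apply: norm_le_coord => [|i j]; first by rewrite !mulr_ge0.
rewrite mxE (le_trans (ler_norm_sum _ _ _))//.
apply: (@le_trans _ _ (\sum_(k < n) `|A| * `|B|)).
  by apply: ler_sum => k _; rewrite normrM ler_pM// norm_coord_le.
by rewrite sumr_const card_ord -[leLHS]mulr_natl mulrA.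
Qed.

Lemma cvg_mx (T : Type) (F : set_system T) (FF : Filter F) m n
    (f : T -> 'M[R]_(m, n)) (l : 'M[R]_(m, n)) :
  (forall i j, (fun t => f t i j) @ F --> l i j) -> f @ F --> l.
Proof.
move=> fl; apply/cvgrPdist_le => /= e e0; near=> t.
apply: norm_le_coord => [|i j]; first exact: ltW.
rewrite !mxE; move: i j; near: t; apply: filter_forall => i.
by apply: filter_forall => j; move/cvgrPdist_le : (fl i j); exact.
Unshelve. all: by end_near. Qed.

Lemma continuous_mx (T : topologicalType) m n (f : T -> 'M[R]_(m, n)) :
  (forall i j, continuous (fun t => f t i j)) -> continuous f.
Proof. by move=> fc t; apply: cvg_mx => i j; exact: fc. Qed.

Lemma continuous_coord (T : topologicalType) m n (f : T -> 'M[R]_(m, n)) i j :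
  continuous f -> continuous (fun t => f t i j).
Proof.
move=> fc t; exact: (cvg_comp _ _ (fc t) (@coord_continuous R m n i j (f t))).
Qed.

Lemma contD (T : topologicalType) (f g : T -> R) :
  continuous f -> continuous g -> continuous (fun x => f x + g x).
Proof. by move=> fc gc x; exact: (cvgD (fc x) (gc x)). Qed.

Lemma contN (T : topologicalType) (f : T -> R) :
  continuous f -> continuous (fun x => - f x).
Proof. by move=> fc x; exact: (cvgN (fc x)). Qed.

Lemma contB (T : topologicalType) (f g : T -> R) :
  continuous f -> continuous g -> continuous (fun x => f x - g x).
Proof. by move=> fc gc; apply: contD => //; exact: contN. Qed.

Lemma contM (T : topologicalType) (f g : T -> R) :
  continuous f -> continuous g -> continuous (fun x => f x * g x).
Proof. by move=> fc gc x; exact: (cvgM (fc x) (gc x)). Qed.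

Lemma cont_cst (T : topologicalType) (c : R) : continuous (fun _ : T => c).
Proof. exact: cst_continuous. Qed.

Lemma contV (T : topologicalType) (f : T -> R) :
  continuous f -> (forall x, f x != 0) -> continuous (fun x => (f x)^-1).
Proof.
by move=> fc f0 x; apply: (cvg_comp _ _ (fc x)); exact: inv_continuous.
Qed.

Lemma cont_sum (T : topologicalType) (I : Type) (r : seq I) (P : pred I)
    (f : I -> T -> R) : (forall i, continuous (f i)) ->
  continuous (fun x => \sum_(i <- r | P i) f i x).
Proof.
move=> fc; elim: r => [|i r IH].
  by under eq_fun do rewrite big_nil; exact: cont_cst.
under eq_fun do rewrite big_cons; case: (P i) => //.
exact: contD.
Qed.

Lemma cont_comp_cV n m (V : normedModType R) (g : 'cV[R]_n -> 'cV[R]_m)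
    (f : 'cV[R]_m -> V) :
  continuous f -> continuous g -> continuous (fun x => f (g x)).
Proof.
by move=> fc gc x; exact: (@cvg_comp 'cV[R]_n 'cV[R]_m V g f _ _ _ (gc x) (fc (g x))).
Qed.

Lemma cont_comp_curve d (V : normedModType R) (f : 'cV[R]_d -> V)
    (c : R -> 'cV[R]_d) :
  continuous f -> continuous c -> continuous (fun s => f (c s)).
Proof.
by move=> fc cc s; exact: (@cvg_comp R 'cV[R]_d V c f _ _ _ (cc s) (fc (c s))).
Qed.

Lemma cont_comp_real d (f : 'cV[R]_d -> R) (g : R -> R) :
  continuous f -> continuous g -> continuous (fun x => g (f x)).
Proof.
by move=> fc gc x; exact: (@cvg_comp 'cV[R]_d R R f g _ _ _ (fc x) (gc (f x))).
Qed.

Lemma near_dist_lt (V : normedModType R) (x : V) (e : R) :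
  0 < e -> \forall y \near x, `|x - y| < e.
Proof. by move=> e0; apply/nbhs_normP; exists e. Qed.

Lemma lipschitz_cont (V W : normedModType R) (f : V -> W) (L : R) :
  (forall x y, `|f x - f y| <= L * `|x - y|) -> continuous f.
Proof.
move=> fL x; apply/cvgrPdist_le => /= e e0.
have L1 : 0 < `|L| + 1 by rewrite ltr_wpDl.
near=> y; rewrite (le_trans (fL _ _))//.
apply: (@le_trans _ _ ((`|L| + 1) * `|x - y|)).
  by rewrite ler_wpM2r// (le_trans (ler_norm L))// lerDl.
rewrite mulrC -ler_pdivlMr// ltW//; near: y.
by apply: near_dist_lt; exact: divr_gt0.
Unshelve. all: by end_near. Qed.

Lemma cont_translate d (V : normedModType R) (f : 'cV[R]_d -> V) (h : 'cV[R]_d) :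
  continuous f -> continuous (fun x : 'cV[R]_d => f (x + h)).
Proof.
move=> fc; apply: (@cont_comp_cV d d V (fun x : 'cV[R]_d => x + h) f fc).
apply: (@lipschitz_cont 'cV[R]_d 'cV[R]_d _ 1) => y z.
by rewrite opprD addrACA subrr addr0 mul1r.
Qed.

End Norms.

(** * Periodic functions *)

Section Periodic.
Context {R : realType}.

Definition cell d : set 'cV[R]_d := [set x | forall i, 0 <= x i 0 <= 1].

Lemma cell_compact d : compact (@cell d).
Proof.
rewrite (_ : @cell d =
    trmx @` [set v : 'rV[R]_d | forall i, `[0, 1]%classic (v ord0 i)]).
  apply: continuous_compact.
    apply/continuous_subspaceT/continuous_mx => i j.
    under eq_fun do rewrite mxE.
    exact: coord_continuous.
  have := @rV_compact R d (fun=> `[0, 1]%classic).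
  by apply => _; exact: segment_compact.
rewrite eqEsubset; split => [x xc|_ [v vc <-] i].
  exists x^T; last by rewrite trmxK.
  by move=> i /=; rewrite mxE in_itv /=; exact: xc.
by have /= := vc i; rewrite in_itv /= mxE.
Qed.

Lemma cell_repr d (x : 'cV[R]_d) :
  exists k, k \is a mxOver Num.int /\ cell (x - k).
Proof.
exists (\matrix_(i, j) (Num.floor (x i j))%:~R); split.
  by apply/mxOverP => i j; rewrite mxE; exact: intr_int.
move=> i; rewrite !mxE subr_ge0 floor_le_tmp /= lerBlDl.
by have /andP[_ /ltW] := floor_itv (x i 0); rewrite intrD1.
Qed.

Lemma mxOver_intN m n (k : 'M[R]_(m, n)) :
  k \is a mxOver Num.int -> - k \is a mxOver Num.int.
Proof. by move/mxOverP=> h; apply/mxOverP => i j; rewrite mxE rpredN. Qed.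

Lemma delta_mx_int m n (i : 'I_m) (j : 'I_n) :
  (delta_mx i j : 'M[R]_(m, n)) \is a mxOver Num.int.
Proof.
by apply/mxOverP => i' j'; rewrite mxE; exact: natr_int.
Qed.

Lemma ZperiodicN d (V : Type) (f : 'cV[R]_d -> V) x k :
  Zperiodic f -> k \is a mxOver Num.int -> f (x - k) = f x.
Proof. by move=> fp kint; apply: fp; exact: mxOver_intN. Qed.

Lemma Zperiodic_cell d (V : Type) (f : 'cV[R]_d -> V) (P : V -> Prop) :
  Zperiodic f -> (forall x, cell x -> P (f x)) -> forall x, P (f x).
Proof.
move=> fp fP x; have [k [kint xk]] := cell_repr x.
by rewrite -(ZperiodicN x fp kint); exact: fP.
Qed.

Lemma periodic_bounded d (V : normedModType R) (f : 'cV[R]_d -> V) :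
  continuous f -> Zperiodic f -> exists2 B : R, 0 < B & forall x, `|f x| <= B.
Proof.
move=> fc fp.
have : compact (f @` @cell d).
  apply: continuous_compact; last exact: cell_compact.
  exact: continuous_subspaceT.
move=> /compact_bounded[M [Mr fM]].
exists (`|M| + 1) => [|x]; first by rewrite ltr_wpDl.
apply: (Zperiodic_cell (P := fun v => `|v| <= _) fp) => y yc.
apply: fM; last by exists y.
by rewrite (le_lt_trans (ler_norm M))// ltrDl.
Qed.

(** Compactness provides a uniform radius on the cell, and integer
    translations carry it to the whole space. *)
Lemma periodic_unif_cont d (V : normedModType R) (f : 'cV[R]_d -> V) :
  continuous f -> Zperiodic f -> forall e : R, 0 < e ->
  exists2 r : R, 0 < r & forall x y, `|x - y| <= r -> `|f x - f y| <= e.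
Proof.
move=> fc fp e e0.
have := @cell_compact d; rewrite compact_near_coveringP => /(_ R 0^'+
  (fun r x => forall y, `|x - y| <= r -> `|f x - f y| <= e)) H.
have {}H : \forall r \near (0 : R)^'+, (@cell d `<=`
    fun x => forall y, `|x - y| <= r -> `|f x - f y| <= e).
  apply: H => x xc.
  have e2 : 0 < e / 2 by rewrite divr_gt0.
  have /cvgrPdist_le/(_ _ e2)/nbhs_normP[r r0 fr] := fc x.
  near=> x' s => y /= x'y.
  have x'r : `|x - x'| < r / 2.
    near: x'; apply: (@near_dist_lt _ ('cV[R]_d : normedModType R) x); exact: divr_gt0.
  rewrite (splitr e) -(subrKA (f x)) (le_trans (ler_normD _ _))// lerD//.
    by rewrite distrC; apply: fr => /=; rewrite (lt_trans x'r)// ltr_pdivrMr// ltr_pMr ?ltr1n.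
  apply: fr => /=; rewrite -(subrKA x') (le_lt_trans (ler_normD _ _))//.
  rewrite (splitr r) ltr_leD// (le_trans x'y)//.
  by near: s; apply: nbhs_right_le; exact: divr_gt0.
have [r [r0 rH]] : exists r : R, 0 < r /\ (@cell d `<=`
    fun x => forall y, `|x - y| <= r -> `|f x - f y| <= e).
  near (0 : R)^'+ => r; exists r; split; last by near: r; exact: H.
  by near: r; exact: nbhs_right_gt.
exists r => // x y xy; have [k [kint xk]] := cell_repr x.
rewrite -(ZperiodicN x fp kint) -(ZperiodicN y fp kint); apply: rH => //.
by rewrite opprB addrA subrK.
Unshelve. all: by end_near. Qed.

(** Boundedness is applied to the inverse of [f]. *)
Lemma periodic_pos_lb d (f : 'cV[R]_d -> R) :
  continuous f -> Zperiodic f -> (forall x, 0 < f x) ->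
  exists2 m : R, 0 < m & forall x, m <= f x.
Proof.
move=> fc fp f0.
have gc : continuous (fun x => (f x)^-1).
  by apply: contV => // x; rewrite gt_eqF.
have gp : Zperiodic (fun x => (f x)^-1) by move=> x k /fp ->.
have [B B0 fB] := periodic_bounded gc gp.
exists B^-1 => [|x]; first by rewrite invr_gt0.
rewrite -[leRHS]invrK lef_pV2 ?posrE ?invr_gt0//.
by rewrite (le_trans (ler_norm _)).
Qed.

End Periodic.

(** * Differentiation along curves and segments *)

Section Calculus.
Context {R : realType}.

Lemma diff_partial d (f : 'cV[R]_d -> R) (x h : 'cV[R]_d) :
  differentiable f x -> 'd f x h = \sum_j partial j f x * h j 0.
Proof.
move=> df; have hE : h = \sum_j h j 0 *: delta_mx j 0.
  by rewrite {1}(matrix_sum_delta h); apply: eq_bigr => i _; rewrite big_ord1.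
rewrite {1}hE linear_sum; apply: eq_bigr => j _.
by rewrite linearZ /= /partial deriveE// mulrC.
Qed.

Lemma is_derive_coord m n (c : R -> 'M[R]_(m, n)) (t : R) (v : 'M[R]_(m, n)) i j :
  is_derive t (1 : R) c v -> is_derive t (1 : R) (fun s => c s i j) (v i j).
Proof.
move=> [dc cv].
have dci := (derivable_mxP _ _ _).1 dc i j.
apply: DeriveDef => //.
by rewrite -cv derive_mx// mxE.
Qed.

Lemma is_derive_mx m n (c : R -> 'M[R]_(m, n)) (t : R) (v : 'M[R]_(m, n)) :
  (forall i j, is_derive t (1 : R) (fun s => c s i j) (v i j)) ->
  is_derive t (1 : R) c v.
Proof.
move=> dc; have cd : derivable c t 1.
  by apply/derivable_mxP => i j; have [] := dc i j.
apply: DeriveDef => //; rewrite derive_mx//; apply/matrixP => i j; rewrite mxE.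
by have [] := dc i j.
Qed.

Lemma is_derive_comp_curve d (f : 'cV[R]_d -> R) (c : R -> 'cV[R]_d) (t : R) v :
  differentiable f (c t) -> is_derive t (1 : R) c v ->
  is_derive t (1 : R) (fun s => f (c s)) (\sum_j partial j f (c t) * v j 0).
Proof.
move=> df [dc cv].
have dc' : differentiable c t by apply/derivable1_diffP.
have dfc : differentiable (f \o c) t by exact: differentiable_comp.
apply: DeriveDef; first by apply/derivable1_diffP.
rewrite deriveE// diff_comp//= diff_partial//.
by apply: eq_bigr => j _; rewrite -deriveE// cv.
Qed.

Lemma is_derive_addf (f g : R -> R) (t df dg : R) :
  is_derive t (1 : R) f df -> is_derive t (1 : R) g dg ->
  is_derive t (1 : R) (fun s => f s + g s) (df + dg).
Proof. by move=> fd gd; exact: (@is_deriveD _ _ _ f g t 1 df dg fd gd). Qed.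

Lemma is_derive_subf (f g : R -> R) (t df dg : R) :
  is_derive t (1 : R) f df -> is_derive t (1 : R) g dg ->
  is_derive t (1 : R) (fun s => f s - g s) (df - dg).
Proof. by move=> fd gd; exact: (@is_deriveB _ _ _ f g t 1 df dg fd gd). Qed.

Lemma is_derive_mulf (f g : R -> R) (t df dg : R) :
  is_derive t (1 : R) f df -> is_derive t (1 : R) g dg ->
  is_derive t (1 : R) (fun s => f s * g s) (df * g t + f t * dg).
Proof.
move=> fd gd; have := @is_deriveM _ _ f g t 1 df dg fd gd.
by move/is_derive_eq; apply; rewrite /GRing.scale/= addrC [g t * _]mulrC.
Qed.

Lemma is_derive_cstf (c t : R) : is_derive t (1 : R) (fun=> c) 0.
Proof. exact: is_derive_cst. Qed.

Lemma is_derive_scalef (c : R) (f : R -> R) (t df : R) :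
  is_derive t (1 : R) f df -> is_derive t (1 : R) (fun s => c * f s) (c * df).
Proof. by move=> fd; exact: (@is_deriveZ _ _ _ f c t 1 df fd). Qed.

Lemma is_derive_mulid (c t : R) : is_derive t (1 : R) (fun s => c * s) c.
Proof.
by have := is_derive_scalef c (is_derive_id t (1 : R)); rewrite mulr1.
Qed.

Lemma is_derive_sumf (I : Type) (r : seq I) (f df : I -> R -> R) (t : R) :
  (forall i, is_derive t (1 : R) (f i) (df i t)) ->
  is_derive t (1 : R) (fun s => \sum_(i <- r) f i s) (\sum_(i <- r) df i t).
Proof.
move=> fd; elim: r => [|i r IH].
  by rewrite big_nil; under eq_fun do rewrite big_nil; exact: is_derive_cstf.
rewrite big_cons; under eq_fun do rewrite big_cons.
exact: is_derive_addf.
Qed.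

Lemma is_derive_line d (x h : 'cV[R]_d) (t : R) :
  is_derive t (1 : R) (fun s : R => x + s *: h) h.
Proof.
apply: is_derive_mx => i j; rewrite ord1.
under eq_fun do rewrite !mxE.
under eq_fun do rewrite mulrC.
have := is_derive_addf (is_derive_cstf (x i 0) t) (is_derive_mulid (h i 0) t).
by rewrite add0r.
Qed.

Lemma norm_dirderiv d (f : 'cV[R]_d -> R) (B : R) (x h : 'cV[R]_d) :
  (forall j, `|partial j f x| <= B) ->
  `|\sum_j partial j f x * h j 0| <= d%:R * B * `|h|.
Proof.
move=> fB; rewrite (le_trans (ler_norm_sum _ _ _))//.
apply: (@le_trans _ _ (\sum_(j < d) B * `|h|)).
  by apply: ler_sum => j _; rewrite normrM ler_pM// norm_coord_le.
by rewrite sumr_const card_ord -[leLHS]mulr_natl mulrA.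
Qed.

Lemma differentiable_cont d (f : 'cV[R]_d -> R) :
  (forall x, differentiable f x) -> continuous f.
Proof. by move=> df x; exact: differentiable_continuous. Qed.

Lemma real_MVT (f df : R -> R) (a b : R) :
  (forall t, is_derive t (1 : R) f (df t)) -> a <= b ->
  exists2 c, a <= c <= b & f b - f a = df c * (b - a).
Proof.
move=> fd ab.
have fc : {within `[a, b], continuous f}.
  apply: continuous_subspaceT => x; apply: differentiable_continuous.
  by apply/derivable1_diffP; have [] := fd x.
by have [c cab fab] := MVT_segment ab (fun x _ => fd x) fc; exists c.
Qed.

Lemma segment_MVT d (f : 'cV[R]_d -> R) (x h : 'cV[R]_d) :
  (forall y, differentiable f y) ->
  exists2 c : R, 0 <= c <= 1 &
    f (x + h) - f x = \sum_j partial j f (x + c *: h) * h j 0.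
Proof.
move=> df.
have [|c c01] := @real_MVT (fun s => f (x + s *: h))
    (fun s => \sum_j partial j f (x + s *: h) * h j 0) 0 1 _ ler01.
  by move=> t; apply: is_derive_comp_curve => //; exact: is_derive_line.
by rewrite scale1r scale0r addr0 subr0 mulr1 => fE; exists c.
Qed.

Lemma lipschitz_partial d (f : 'cV[R]_d -> R) (B : R) :
  (forall y, differentiable f y) -> (forall j x, `|partial j f x| <= B) ->
  forall x y, `|f x - f y| <= d%:R * B * `|x - y|.
Proof.
move=> df fB x y; have [c _] := segment_MVT y (x - y) df.
rewrite [y + _]addrC subrK => ->; exact: norm_dirderiv.
Qed.

Lemma is_derive_const (f : R -> R) :
  (forall t, is_derive t (1 : R) f 0) -> forall t, f t = f 0.
Proof.
move=> fd t; have [t0|t0] := leP 0 t.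
  by have [c _] := real_MVT fd t0; rewrite mul0r => /eqP; rewrite subr_eq0 => /eqP.
have [c _] := real_MVT fd (ltW t0); rewrite mul0r => /eqP.
by rewrite subr_eq0 => /eqP.
Qed.

Lemma is_derive_homo (f df : R -> R) :
  (forall t, is_derive t (1 : R) f (df t)) -> (forall t, 0 <= df t) ->
  {homo f : s t / s <= t}.
Proof.
move=> fd f0 s t st; rewrite -subr_ge0.
by have [c _ ->] := real_MVT fd st; rewrite mulr_ge0 ?subr_ge0.
Qed.

End Calculus.

(** * Integrals of continuous functions on the line *)

Section Primitive.
Context {R : realType}.
Notation mu := (@lebesgue_measure R).

Lemma continuous_integrable (f : R -> R) (a b : R) :
  continuous f -> mu.-integrable `[a, b] (EFin \o f).
Proof.
move=> fc; apply: continuous_compact_integrable; first exact: segment_compact.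
exact: continuous_subspaceT.
Qed.

Lemma Rintegral_chasles (f : R -> R) (a b c : R) :
  continuous f -> a <= b -> b <= c ->
  \int[mu]_(t in `[a, c]) f t =
  \int[mu]_(t in `[a, b]) f t + \int[mu]_(t in `[b, c]) f t.
Proof.
move=> fc ab bc; apply/eqP; rewrite addrC -subr_eq; apply/eqP.
rewrite (@Rintegral_itvB _ f (BLeft a) (BRight c) b) ?bnd_simp//.
  rewrite Rintegral_itv_obnd_cbnd//.
  apply: (integrableS _ _ _ (continuous_integrable b c fc)) => //.
  by apply: subset_itvr; rewrite bnd_simp.
exact: continuous_integrable.
Qed.

(** The integral from [0] to [x], for either sign of [x]: the common base
    point lies to the left of both bounds. *)
Definition primitive (f : R -> R) (x : R) : R :=
  \int[mu]_(t in `[- (`|x| + 1), x]) f t -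
  \int[mu]_(t in `[- (`|x| + 1), 0]) f t.

Lemma primitive_base (f : R -> R) (a x : R) : continuous f -> a <= x -> a <= 0 ->
  primitive f x = \int[mu]_(t in `[a, x]) f t - \int[mu]_(t in `[a, 0]) f t.
Proof.
move=> fc ax a0; rewrite /primitive; set b := - _.
have bx : b <= x.
  by rewrite /b lerNl (le_trans (ler_norm (- x)))// normrN lerDl.
have b0 : b <= 0 by rewrite /b oppr_le0 addr_ge0.
have [ab|/ltW ba] := leP a b.
  rewrite [X in _ = X - _](@Rintegral_chasles f a b x)//.
  rewrite [X in _ = _ - X](@Rintegral_chasles f a b 0)//; ring.
rewrite [X in X - _](@Rintegral_chasles f b a x)//.
rewrite [X in _ - X = _](@Rintegral_chasles f b a 0)//; ring.
Qed.

Lemma is_derive_primitive (f : R -> R) (x : R) :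
  continuous f -> is_derive x (1 : R) (primitive f) (f x).
Proof.
move=> fc; pose a := - (`|x| + 2).
have ax : a + 1 < x.
  by rewrite /a; have := ler_norm (- x); rewrite normrN; lra.
have a0 : a < 0 by rewrite /a oppr_lt0 ltr_wpDl.
have x1 : x < x + 1 by rewrite ltrDl.
have [||dF F'] := @continuous_FTC1_closed R f a x (x + 1) x1
  (continuous_integrable a (x + 1) fc); first by lra.
  exact: fc.
apply: (@near_eq_is_derive _ _ _ (fun y => \int[mu]_(t in `[a, y]) f t - \int[mu]_(t in `[a, 0]) f t)).
- near=> y; have : `|x - y| < 1.
    by near: y; exact: (@near_dist_lt R R x 1 ltr01).
  rewrite ltr_norml => /andP[_ xy].
  by rewrite (@primitive_base f a)//; [lra | exact: ltW].
- rewrite -[f x]subr0 -F' derive1E; apply: is_deriveB.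
Unshelve. all: by end_near. Qed.

Lemma FTC (f F : R -> R) (a b : R) :
  continuous f -> (forall x, is_derive x (1 : R) F (f x)) -> a <= b ->
  \int[mu]_(t in `[a, b]) f t = F b - F a.
Proof.
move=> fc Fd ab.
have H t : is_derive t (1 : R) (primitive f - F) 0.
  rewrite -(subrr (f t)); apply: is_deriveB; exact: is_derive_primitive.
have E t : primitive f t = F t + (primitive f 0 - F 0).
  have := is_derive_const H t; rewrite !fctE => <-; ring.
have P t : a <= t -> a <= 0 -> primitive f t =
    \int[mu]_(t in `[a, t]) f t - \int[mu]_(t in `[a, 0]) f t.
  exact: primitive_base.
have -> : F b - F a = primitive f b - primitive f a.
  by rewrite (E b) (E a); ring.
have [a0|/ltW a0] := leP a 0.
  rewrite (P b)// (P a)// set_itv1 Rintegral_set1; ring.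
rewrite (@primitive_base f 0 b)// ?(le_trans a0)//.
rewrite (@primitive_base f 0 a)// (@Rintegral_chasles f 0 a b)//; ring.
Qed.

Lemma is_derive_translate (F : R -> R) (c t d : R) :
  is_derive (t + c) (1 : R) F d -> is_derive t (1 : R) (fun t => F (t + c)) d.
Proof.
move=> Fd; have H : is_derive t (1 : R) (shift c) 1 by exact: is_derive_shift.
by have := @is_derive1_comp R F (shift c) t d 1 Fd H; rewrite mulr1.
Qed.

Lemma Rintegral_period (f : R -> R) (T s : R) : continuous f -> 0 <= T ->
  (forall t, f (t + T) = f t) ->
  \int[mu]_(t in `[0, T]) f (t + s) = \int[mu]_(t in `[0, T]) f t.
Proof.
move=> fc T0 fT.
pose F := primitive f.
have Fd x : is_derive x (1 : R) F (f x) by exact: is_derive_primitive.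
have Fsd t : is_derive t (1 : R) (fun t => F (t + s)) (f (t + s)).
  exact: is_derive_translate.
have fsc : continuous (fun t => f (t + s)).
  move=> t; apply: (cvg_comp (fun t => t + s) f); last exact: fc.
  by apply: cvgD; [exact: cvg_id | exact: cvg_cst].
have E1 := FTC fc Fd T0; have E2 := FTC fsc Fsd T0.
rewrite E1 E2.
have H t : is_derive t (1 : R) ((fun t => F (t + T)) - F) 0.
  rewrite -(subrr (f t)) -{1}(fT t); apply: is_deriveB.
  exact: is_derive_translate.
have := is_derive_const H s; rewrite !fctE add0r => <-.
by rewrite add0r [s + T]addrC.
Qed.

(** Dominated convergence with a constant bound. The limit need not be
    continuous, so that indicators of superlevel sets can arise as limits. *)
Lemma Rintegral_bounded_cvg (a b : R) (f_ : nat -> R -> R) (f : R -> R) (B : R) :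
  a <= b -> (forall n, continuous (f_ n)) ->
  (forall n t, a <= t <= b -> `|f_ n t| <= B) ->
  (forall t, a <= t <= b -> f_ n t @[n --> \oo] --> f t) ->
  \int[mu]_(t in `[a, b]) f_ n t @[n --> \oo] --> \int[mu]_(t in `[a, b]) f t.
Proof.
move=> ab f_c fB ff.
have intf n := continuous_integrable a b (f_c n).
have cvgE t : t \in `[a, b] -> (f_ n t)%:E @[n --> \oo] --> (f t)%:E.
  by rewrite in_itv /= => tab; apply: cvg_EFin; [exact: nearW | exact: ff].
have intB := continuous_integrable a b (@cst_continuous _ _ B).
have fint : mu.-integrable `[a, b] (EFin \o f).
  apply: (@le_integrable _ _ R mu _ (measurable_itv _) _ (EFin \o cst `|B|)).
  - apply: (@measurable_realfun.emeasurable_fun_cvg _ _ _ _ (fun n => EFin \o f_ n)) => [n|t tab].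
      exact: (measurable_int mu (intf n)).
    exact: cvgE.
  - move=> t tab /=; rewrite lee_fin normr_id.
    have ftB : `|f_ n t| @[n --> \oo] --> `|f t| by apply: cvg_norm; exact: ff.
    by apply: (cvgr_to_le ftB); apply: nearW => n; rewrite (le_trans _ (ler_norm B))// fB.
  - exact: (continuous_integrable a b (@cst_continuous _ _ `|B|)).
rewrite /Rintegral; apply: fine_cvg; rewrite fineK; last exact: integrable_fin_num.
apply: (@dominated_cvg _ _ R mu `[a, b] _ (fun n => EFin \o f_ n) (EFin \o f)
  (EFin \o cst B)) => //.
- by move=> n; exact: (measurable_int mu (intf n)).
Qed.

End Primitive.

(** * Mean values over the unit cell *)

Section Mean.
Context {R : realType}.
Notation mu := (@lebesgue_measure R).

(** The form of the points at which [mean] evaluates its argument. *)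
Definition ccons d (t : R) (y : 'cV[R]_d) : 'cV[R]_d.+1 := col_mx t%:M y.

Lemma cconsD d (s t : R) (x y : 'cV[R]_d) :
  ccons s x + ccons t y = ccons (s + t) (x + y).
Proof.
apply: (etrans (@add_col_mx R 1 d 1 s%:M x t%:M y)).
by rewrite /ccons -raddfD.
Qed.

Variant ccons_spec d (t : R) (y : 'cV[R]_d) : 'I_d.+1 -> R -> Prop :=
  | CconsHead : ccons_spec t y ord0 t
  | CconsTail i : ccons_spec t y (lift ord0 i) (y i 0).

Lemma cconsP d (t : R) (y : 'cV[R]_d) i : ccons_spec t y i (ccons t y i 0).
Proof.
rewrite /ccons; have [j E|j E] := @split_ordP 1 d i.
  rewrite [X in ccons_spec _ _ _ X](_ : _ = t); last first.
    by rewrite E (@col_mxEu _ 1 d 1) mxE ord1 eqxx mulr1n.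
  have -> : i = ord0 by apply: (@ord_inj d.+1); rewrite E /= ord1.
  exact: CconsHead.
rewrite [X in ccons_spec _ _ _ X](_ : _ = y j 0); last first.
  by rewrite E (@col_mxEd _ 1 d 1).
have -> : i = lift ord0 j by apply: (@ord_inj d.+1); rewrite E.
exact: CconsTail.
Qed.

Lemma ccons_int d (t : R) (y : 'cV[R]_d) : t \is a Num.int ->
  y \is a mxOver Num.int -> ccons t y \is a mxOver Num.int.
Proof.
move=> tint /mxOverP yint; apply/mxOverP => i j; rewrite ord1.
by case: (cconsP t y i).
Qed.

Definition slice d (f : 'cV[R]_d.+1 -> R) (t : R) (y : 'cV[R]_d) : R :=
  f (ccons t y).

Lemma meanS d (f : 'cV[R]_d.+1 -> R) :
  mean f = \int[mu]_(t in `[0, 1]) mean (slice f t).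
Proof. by []. Qed.

Lemma mean0 (f : 'cV[R]_0 -> R) : mean f = f 0.
Proof. by []. Qed.

Lemma ccons_norm d (t s : R) (x y : 'cV[R]_d) (c : R) : 0 <= c ->
  `|t - s| <= c -> `|x - y| <= c -> `|ccons t x - ccons s y| <= c.
Proof.
move=> c0 ts xy; apply: normv_le_coord => // i.
have -> : ccons t x - ccons s y = ccons (t - s) (x - y).
  by apply/eqP; rewrite subr_eq cconsD !subrK.
case: cconsP => // j; exact: le_trans (norm_coord_le _ _ _) xy.
Qed.

Lemma cell_ccons d (t : R) (y : 'cV[R]_d) :
  0 <= t <= 1 -> cell y -> cell (ccons t y).
Proof. by move=> t01 yc i; case: cconsP. Qed.

Lemma slice_continuous d (f : 'cV[R]_d.+1 -> R) t :
  continuous f -> continuous (slice f t).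
Proof.
move=> fc; apply: (@cont_comp_cV R d d.+1 R (fun y => ccons t y) f fc).
apply: (@lipschitz_cont R 'cV[R]_d 'cV[R]_d.+1 _ 1) => x z; rewrite mul1r.
by apply: ccons_norm => //; rewrite subrr normr0.
Qed.

Lemma slice_near d (f : 'cV[R]_d.+1 -> R) t (e : R) : continuous f -> 0 < e ->
  \forall s \near t, forall y, cell y -> `|slice f t y - slice f s y| <= e.
Proof.
move=> fc e0.
have := @cell_compact R d; rewrite compact_near_coveringP => /(_ R (nbhs t)
  (fun s y => `|slice f t y - slice f s y| <= e)) H.
apply: H => y yc.
have e2 : 0 < e / 2 by rewrite divr_gt0.
have /cvgrPdist_le/(_ _ e2)/nbhs_normP[r r0 fr] := fc (ccons t y).
have r2 : 0 < r / 2 by rewrite divr_gt0.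
have rr : r / 2 < r by rewrite ltr_pdivrMr// ltr_pMr ?ltr1n.
near=> y' s.
have yy' : `|y - y'| < r / 2.
  by near: y'; apply: (@near_dist_lt _ ('cV[R]_d : normedModType R) y).
have ts : `|t - s| < r / 2 by near: s; exact: (@near_dist_lt R R t _ r2).
rewrite (splitr e) -(subrKA (f (ccons t y))) (le_trans (ler_normD _ _))// lerD//.
  rewrite distrC; apply: fr => /=; apply: le_lt_trans rr.
  by apply: ccons_norm; rewrite ?subrr ?normr0// ltW.
by apply: fr => /=; apply: le_lt_trans rr; apply: ccons_norm; exact: ltW.
Unshelve. all: by end_near. Qed.

(** The basic properties of [mean] on continuous functions. They are proved
    together because the induction on the dimension needs all of them: that the
    mean of a slice depends continuously on the slice follows from linearity,
    monotonicity and normalization in the smaller dimension. *)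
Record mean_spec d : Prop := MeanSpec {
  mean_lin : forall (f g : 'cV[R]_d -> R) c, continuous f -> continuous g ->
    mean (fun x => f x + c * g x) = mean f + c * mean g ;
  mean_le : forall f g : 'cV[R]_d -> R, continuous f -> continuous g ->
    (forall x, cell x -> f x <= g x) -> mean f <= mean g ;
  mean_cst : forall c : R, mean (fun _ : 'cV[R]_d => c) = c }.

Lemma mean_dist d (f g : 'cV[R]_d -> R) (e : R) : mean_spec d ->
  continuous f -> continuous g -> (forall x, cell x -> `|f x - g x| <= e) ->
  `|mean f - mean g| <= e.
Proof.
move=> [lin le cst] fc gc fge.
have ec (h : 'cV[R]_d -> R) (c : R) : continuous h ->
    mean (fun x => h x + c * 1) = mean h + c.
  by move=> hc; rewrite lin ?cst ?mulr1//; exact: cont_cst.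
have hce (h : 'cV[R]_d -> R) (c : R) : continuous h ->
    continuous (fun x => h x + c * 1).
  by move=> hc; apply: contD => //; exact: cont_cst.
have H (h k : 'cV[R]_d -> R) : continuous h -> continuous k ->
    (forall x, cell x -> `|h x - k x| <= e) -> mean h <= mean k + e.
  move=> hc kc hk; rewrite -ec//; apply: le => //; first exact: hce.
  by move=> x /hk; rewrite mulr1 -lerBlDl; apply: le_trans; exact: ler_norm.
have := H f g fc gc fge.
have gfe x : cell x -> `|g x - f x| <= e by rewrite distrC; exact: fge.
by have := H g f gc fc gfe; rewrite ler_norml; lra.
Qed.

Lemma mean_slice_continuous d (f : 'cV[R]_d.+1 -> R) : mean_spec d ->
  continuous f -> continuous (fun t => mean (slice f t)).
Proof.
move=> S fc t; apply/cvgrPdist_le => /= e e0.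
have := slice_near t fc e0; apply: filterS => s fts.
by apply: mean_dist => //; exact: slice_continuous.
Qed.

Lemma mean_specP d : mean_spec d.
Proof.
elim: d => [|d IH].
  split => //; move=> f g fc gc; rewrite !mean0; apply.
  by case.
have sint (f : 'cV[R]_d.+1 -> R) : continuous f ->
    mu.-integrable `[0, 1] (EFin \o (fun t => mean (slice f t))).
  by move=> fc; apply: continuous_integrable; exact: mean_slice_continuous.
have m01 : measurable (`[0, 1]%classic : set R) by exact: measurable_itv.
split.
- move=> f g c fc gc; rewrite !meanS.
  under eq_Rintegral => t _ do
    rewrite (mean_lin IH c (slice_continuous (t := t) fc) (slice_continuous (t := t) gc)).
  have ig : mu.-integrable `[0, 1] (EFin \o (fun t => c * mean (slice g t))).
    apply: continuous_integrable; apply: contM; first exact: cont_cst.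
    exact: mean_slice_continuous.
  by rewrite RintegralD ?RintegralZl//; exact: sint.
- move=> f g fc gc fg; rewrite !meanS; apply: le_Rintegral => //; try exact: sint.
  move=> t /=; rewrite in_itv /= => t01.
  apply: (mean_le IH); try exact: slice_continuous.
  by move=> y yc; apply: fg; exact: cell_ccons.
- move=> c; rewrite meanS.
  under eq_Rintegral do rewrite (mean_cst IH).
  by rewrite Rintegral_cst//= lebesgue_measure_itv /= lte01 oppr0 adde0 mulr1.
Qed.

Lemma mean_bounded_cvg d (f_ : nat -> 'cV[R]_d -> R) (f : 'cV[R]_d -> R) (B : R) :
  (forall n, continuous (f_ n)) -> (forall n x, `|f_ n x| <= B) ->
  (forall x, f_ n x @[n --> \oo] --> f x) ->
  mean (f_ n) @[n --> \oo] --> mean f.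
Proof.
elim: d f_ f => [|d IH] f_ f fc fB ff; first exact: ff.
apply: (@Rintegral_bounded_cvg _ 0 1 (fun n t => mean (slice (f_ n) t)) _ B) => //.
- by move=> n; apply: mean_slice_continuous => //; exact: mean_specP.
- move=> n t _; rewrite -[X in `|X|]subr0 -(mean_cst (mean_specP d) 0).
  apply: mean_dist; [exact: mean_specP | exact: slice_continuous |
    exact: cont_cst | by move=> y _; rewrite subr0; exact: fB].
- move=> t _; apply: IH => [n|n y|y]; [exact: slice_continuous | exact: fB |].
  exact: ff.
Qed.

Lemma meanD d (f g : 'cV[R]_d -> R) : continuous f -> continuous g ->
  mean (fun x => f x + g x) = mean f + mean g.
Proof.
move=> fc gc; have := mean_lin (mean_specP d) 1 fc gc; rewrite mul1r => <-.
by congr mean; apply/funext => x; rewrite mul1r.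
Qed.

Lemma meanZ d (f : 'cV[R]_d -> R) (c : R) : continuous f ->
  mean (fun x => c * f x) = c * mean f.
Proof.
move=> fc; have := mean_lin (mean_specP d) c (@cont_cst R _ 0) fc.
rewrite (mean_cst (mean_specP d)) add0r => <-.
by congr mean; apply/funext => x; rewrite add0r.
Qed.

Lemma meanB d (f g : 'cV[R]_d -> R) : continuous f -> continuous g ->
  mean (fun x => f x - g x) = mean f - mean g.
Proof.
move=> fc gc; have := mean_lin (mean_specP d) (-1) fc gc.
by rewrite mulN1r => <-; congr mean; apply/funext => x; rewrite mulN1r.
Qed.

Lemma slice_period d (f : 'cV[R]_d.+1 -> R) (t : R) (y : 'cV[R]_d) :
  Zperiodic f -> slice f (t + 1) y = slice f t y.
Proof.
move=> fp; rewrite /slice.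
rewrite -(fp (ccons t y) (ccons 1 0)) ?cconsD ?addr0//.
by apply: ccons_int => //; exact: mxOver0.
Qed.

Lemma slice_Zperiodic d (f : 'cV[R]_d.+1 -> R) (t : R) :
  Zperiodic f -> Zperiodic (slice f t).
Proof.
move=> fp y k kint; rewrite /slice.
rewrite -(fp (ccons t y) (ccons 0 k)) ?cconsD ?addr0//.
exact: ccons_int.
Qed.

(** Periodicity in each coordinate separately makes each of the iterated
    integrals invariant. *)
Lemma mean_translate d (f : 'cV[R]_d -> R) (h : 'cV[R]_d) :
  continuous f -> Zperiodic f -> mean (fun x => f (x + h)) = mean f.
Proof.
elim: d f h => [|d IH] f h fc fp.
  by rewrite !mean0; congr f; apply/matrixP; case.
pose h0 := h 0 0; pose h' : 'cV[R]_d := @dsubmx R 1 d 1 h.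
have hE : h = ccons h0 h'.
  have hu : @usubmx R 1 d 1 h = h0%:M.
    apply/matrixP => i j; rewrite !ord1 !mxE eqxx mulr1n.
    by congr (h _ _); apply: val_inj.
  by rewrite /ccons -[in RHS]hu; exact/esym/(@vsubmxK R 1 d 1).
rewrite !meanS -[RHS](@Rintegral_period _ (fun t => mean (slice f t)) 1 h0).
- apply: eq_Rintegral => t _; rewrite -(IH (slice f (t + h0)) h').
  + congr mean; apply/funext => y.
    by rewrite /slice hE cconsD.
  + exact: slice_continuous.
  + exact: slice_Zperiodic.
- by apply: mean_slice_continuous => //; exact: mean_specP.
- exact: ler01.
- by move=> t; congr mean; apply/funext => y; exact: slice_period.
Qed.

(** The primitive is monotone and takes equal values at both ends, so it is
    constant, and [f] is its derivative. *)
Lemma Rintegral_eq0 (f : R -> R) (a b : R) : continuous f -> a < b ->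
  (forall t, a <= t <= b -> 0 <= f t) -> \int[mu]_(t in `[a, b]) f t = 0 ->
  forall t, a < t < b -> f t = 0.
Proof.
move=> fc ab f0 If t /andP[at_ tb].
have Fd x : is_derive x (1 : R) (primitive f) (f x) by exact: is_derive_primitive.
have incr x y : a <= x -> x <= y -> y <= b -> primitive f x <= primitive f y.
  move=> ax xy yb; rewrite -subr_ge0 -(FTC fc Fd xy).
  apply: Rintegral_ge0 => s /=; rewrite in_itv /= => /andP[xs sy].
  by apply: f0; rewrite (le_trans ax)//= (le_trans sy).
have Fconst x : a <= x -> x <= b -> primitive f x = primitive f a.
  move=> ax xb; apply/eqP; rewrite eq_le; apply/andP; split; last exact: incr.
  have := FTC fc Fd (ltW ab); rewrite If => /esym/eqP; rewrite subr_eq0 => /eqP <-.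
  exact: incr.
have : is_derive t (1 : R) (primitive f) 0.
  apply: (@near_eq_is_derive _ _ _ (fun=> primitive f a)).
  near=> s; apply/esym/Fconst.
  - by near: s; apply: filterS (lt_nbhsr at_) => y; exact: ltW.
  - by near: s; apply: filterS (lt_nbhsl tb) => y; exact: ltW.
by move=> [_ <-]; have [_ ->] := Fd t.
Unshelve. all: by end_near. Qed.

(** By induction on the dimension: the mean over a slice is a continuous
    non-negative function of the first coordinate with zero integral. *)
Lemma mean_eq0 d (f : 'cV[R]_d -> R) : continuous f -> Zperiodic f ->
  (forall x, 0 <= f x) -> mean f = 0 -> forall x, f x = 0.
Proof.
elim: d f => [|d IH] f fc fp f0 mf x.
  by rewrite -mf mean0; congr f; apply/matrixP; case.
(* Translating brings [x] to a point whose first coordinate is 1/2, so that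
   only interior slices have to vanish. *)
pose h := x - ccons 2^-1 0; pose g y := f (y + h).
have gc : continuous g by exact: cont_translate.
have gp : Zperiodic g by move=> y k kint; rewrite /g -(fp (y + h) k kint) addrAC.
have mg : mean g = 0 by rewrite -mf; exact: mean_translate.
have s0 t : 0 <= mean (slice g t).
  rewrite -(mean_cst (mean_specP d) 0); apply: (mean_le (mean_specP d)).
  - exact: cont_cst.
  - exact: slice_continuous.
  - by move=> y _; exact: f0.
have half01 : 0 < (2^-1 : R) < 1 by apply/andP; split; lra.
have mhalf := Rintegral_eq0 (mean_slice_continuous (mean_specP d) gc) ltr01
  (fun t _ => s0 t) mg half01.
have <- : slice g 2^-1 0 = f x by rewrite /slice /g /h addrC subrK.
apply: IH mhalf 0; first exact: slice_continuous.
- exact: slice_Zperiodic.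
- by move=> y; exact: f0.
Qed.

Lemma partial_quasiperiodic d (f : 'cV[R]_d -> R) (k : 'cV[R]_d) j (c : R) :
  (forall x, f (x + k) = f x + c) ->
  forall x, partial j f (x + k) = partial j f x.
Proof.
move=> fk x; rewrite /partial /derive.
have E h : (f \o shift (x + k)) h - f (x + k) = (f \o shift x) h - f x.
  by rewrite /= addrA !fk; ring.
by under eq_fun do rewrite E.
Qed.

Lemma mean_sum d (I : Type) (r : seq I) (f : I -> 'cV[R]_d -> R) :
  (forall i, continuous (f i)) ->
  mean (fun x => \sum_(i <- r) f i x) = \sum_(i <- r) mean (f i).
Proof.
move=> fc; elim: r => [|i r IH].
  under eq_fun do rewrite big_nil.
  by rewrite big_nil (mean_cst (mean_specP d)).
rewrite big_cons -IH -meanD//; last exact: cont_sum.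
by congr mean; apply/funext => x; rewrite big_cons.
Qed.

Lemma vanishing_partials d (f : 'cV[R]_d -> R) :
  (forall x, differentiable f x) -> (forall j x, partial j f x = 0) ->
  forall x y, f x = f y.
Proof.
move=> df pf x y; apply/eqP; rewrite -subr_eq0 -normr_le0.
have := lipschitz_partial df (B := 0); rewrite mulr0 => /(_ _ x y).
by rewrite mul0r; apply => j z; rewrite pf normr0.
Qed.

(** The increment of [f] over an integer vector [k] is a constant. It is the sum
    of [N] increments over [k / N], each a translate of the same periodic
    function [D], so it is the mean of [N D]; and [N D] converges boundedly to
    the derivative of [f] along [k]. *)
Lemma increment_mean d (f : 'cV[R]_d -> R) (k : 'cV[R]_d) :
  Ck 1 f -> (forall j, Zperiodic (partial j f)) -> k \is a mxOver Num.int ->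
  forall x, f (x + k) = f x + \sum_j mean (partial j f) * k j 0.
Proof.
move=> [df pc] pp kint x; have fc := differentiable_cont df.
have transdiff l y : differentiable (fun z => f (z + l)) y.
  exact: (@differentiable_comp R 'cV[R]_d 'cV[R]_d R (fun z => z + l) f).
have transpart l j y : partial j (fun z => f (z + l)) y = partial j f (y + l).
  rewrite /partial /derive.
  have E h : ((fun z => f (z + l)) \o shift y) h - f (y + l) =
      (f \o shift (y + l)) h - f (y + l) by rewrite /= addrA.
  by under eq_fun do rewrite E.
have incr l y z : l \is a mxOver Num.int -> f (y + l) - f y = f (z + l) - f z.
  move=> lint; apply: (@vanishing_partials d (fun y => f (y + l) - f y)) => [u|j u].
    exact: differentiableB.
  rewrite /partial deriveB; [|exact: diff_derivable|exact: diff_derivable].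
  by rewrite -!/(partial j _ _) transpart pp// subrr.
pose D (y : 'cV[R]_d) := \sum_j partial j f y * k j 0.
have Dc : continuous D.
  by apply: cont_sum => j; apply: contM; [exact: pc | exact: cont_cst].
have Dp : Zperiodic D by move=> y l lint; apply: eq_bigr => j _; rewrite pp.
have [B B0 DB] := periodic_bounded Dc Dp.
pose f_ (n : nat) (y : 'cV[R]_d) := f (y + n.+1%:R^-1 *: k) - f y.
have f_c n : continuous (f_ n) by apply: contB => //; exact: cont_translate.
have f_p n : Zperiodic (f_ n).
  move=> y l lint; rewrite /f_ addrAC.
  by have := incr l (y + n.+1%:R^-1 *: k) y lint; lra.
have fE n y : exists2 c : R, 0 <= c <= 1 &
    n.+1%:R * f_ n y = D (y + (c * n.+1%:R^-1) *: k).
  have [c c01 cE] := segment_MVT y (n.+1%:R^-1 *: k) df.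
  exists c => //; rewrite /f_ cE mulr_sumr; apply: eq_bigr => j _.
  by rewrite !mxE scalerA mulrCA mulVKf.
have meanE n : mean (fun y => n.+1%:R * f_ n y) = f (x + k) - f x.
  rewrite meanZ//.
  pose g (i : nat) (y : 'cV[R]_d) := f_ n (y + (i%:R * n.+1%:R^-1) *: k).
  have tele (m : nat) y :
      \sum_(i < m) g i y = f (y + (m%:R * n.+1%:R^-1) *: k) - f y.
    elim: m => [|m IH]; first by rewrite big_ord0 mul0r scale0r addr0 subrr.
    rewrite big_ord_recr /= IH /g /f_ -[m.+1%:R]natr1 mulrDl mul1r scalerDl.
    rewrite (addrA y); ring.
  have H : mean (fun y => \sum_(i < n.+1) g i y) = n.+1%:R * mean (f_ n).
    rewrite (mean_sum _ (f := fun (i : 'I_n.+1) => g i)); last first.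
      by move=> i; exact: cont_translate.
    rewrite (eq_bigr (fun=> mean (f_ n))).
      by rewrite sumr_const card_ord mulr_natl.
    by move=> i _; exact: mean_translate.
  rewrite -H -[RHS](mean_cst (mean_specP d)); congr mean; apply/funext => y.
  by rewrite tele divff// scale1r; exact: incr.
have lim : mean (fun y => n.+1%:R * f_ n y) @[n --> \oo] --> mean D.
  apply: (@mean_bounded_cvg _ _ _ B).
  - by move=> n; apply: contM => //; exact: cont_cst.
  - by move=> n y; have [c _ ->] := fE n y; exact: DB.
  - move=> y; apply/cvgrPdist_le => /= eps eps0.
    have /cvgrPdist_le/(_ _ eps0)/nbhs_normP[r r0 Dr] := Dc y.
    have k1 : 0 < `|k| + 1 by rewrite ltr_wpDl.
    have rk : 0 < r / (`|k| + 1) by rewrite divr_gt0.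
    near=> n; have [c /andP[c0 c1] ->] := fE n y; apply: Dr => /=.
    rewrite opprD addNKr normrN normrZ ger0_norm ?mulr_ge0//.
    apply: (@le_lt_trans _ _ (n.+1%:R^-1 * (`|k| + 1))).
      by rewrite ler_pM ?mulr_ge0// ?lerDl// ler_piMl.
    rewrite -ltr_pdivlMr//.
    by near: n; exact: near_infty_natSinv_lt (PosNum rk).
move: lim; under eq_fun do rewrite meanE.
move=> lim; have -> : f (x + k) = f x + (f (x + k) - f x) by ring.
rewrite (cvg_unique _ (cvg_cst (f (x + k) - f x)) lim)//; congr (_ + _).
rewrite mean_sum; last by move=> j; apply: contM; [exact: pc | exact: cont_cst].
apply: eq_bigr => j _; rewrite mulrC -meanZ ?pc//.
by congr mean; apply/funext => y; rewrite mulrC.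
Unshelve. all: by end_near. Qed.

(** The mean of a partial derivative is the increment of [f] over a unit
    vector, which is zero by periodicity. *)
Lemma mean_partial0 d (f : 'cV[R]_d -> R) j :
  Ck 1 f -> Zperiodic f -> mean (partial j f) = 0.
Proof.
move=> fc fp.
have pp i : Zperiodic (partial i f).
  by move=> x k kint; apply: (@partial_quasiperiodic _ _ _ _ 0) => y; rewrite addr0 fp.
have := increment_mean fc pp (delta_mx_int j 0) 0.
rewrite fp ?delta_mx_int// => /eqP; rewrite -subr_eq0 opprD addrA subrr sub0r.
rewrite oppr_eq0 (bigD1 j)//= big1 => [|i ij].
  by rewrite !mxE !eqxx mulr1 addr0 => /eqP.
by rewrite !mxE (negbTE ij) mulr0.
Qed.

End Mean.

(** * Maps with periodic Jacobian matrix *)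

Section C1periodic.
Context {R : realType}.

(** The regularity of a coordinate system on the torus: the map itself need
    not be periodic. *)
Definition C1_pnabla d m (F : 'cV[R]_d -> 'cV[R]_m) : Prop :=
  [/\ forall i x, differentiable (fun y => F y i 0) x,
      continuous (nabla F) & Zperiodic (nabla F)].

Lemma nabla_periodic d m (F : 'cV[R]_d -> 'cV[R]_m) :
  Zperiodic F -> Zperiodic (nabla F).
Proof.
move=> Fp x k kint; apply/matrixP => i j; rewrite !mxE.
by apply: (@partial_quasiperiodic _ _ _ _ _ 0) => y; rewrite addr0 Fp.
Qed.

Lemma Ck1_C1_pnabla d m (F : 'cV[R]_d -> 'cV[R]_m) :
  Ck_mx 1 F -> Zperiodic (nabla F) -> C1_pnabla F.
Proof.
move=> Fc Fp; split => //; first by move=> i; have [] := Fc i 0.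
apply: continuous_mx => i j; rewrite (_ : (fun _ => _) = partial j (fun y => F y i 0)); last first.
  by apply/funext => x; rewrite mxE.
have [_ H] := Fc i 0; exact: H.
Qed.

Lemma C1_sharp_pnabla d m (F : 'cV[R]_d -> 'cV[R]_m) :
  Ck_sharp_mx 1 F -> C1_pnabla F.
Proof.
by move=> [Fc Fp]; apply: Ck1_C1_pnabla => //; exact: nabla_periodic.
Qed.

Lemma nabla_mulE d m (F : 'cV[R]_d -> 'cV[R]_m) x (h : 'cV[R]_d) i :
  (nabla F x *m h) i 0 = \sum_j partial j (fun y => F y i 0) x * h j 0.
Proof. by rewrite mxE; apply: eq_bigr => j _; rewrite mxE. Qed.

Lemma pnabla_lipschitz d m (F : 'cV[R]_d -> 'cV[R]_m) : C1_pnabla F ->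
  exists2 L : R, 0 < L & forall x y, `|F x - F y| <= L * `|x - y|.
Proof.
move=> [dF cF pF]; have [B B0 FB] := periodic_bounded cF pF.
exists (d%:R * B + 1) => [|x y]; first by rewrite ltr_wpDl// mulr_ge0// ltW.
apply: (@le_trans _ _ (d%:R * B * `|x - y|)); last first.
  by rewrite ler_wpM2r// lerDl.
apply: normv_le_coord => [|i]; first by rewrite !mulr_ge0// ltW.
rewrite !mxE; apply: (lipschitz_partial (f := fun y => F y i 0)) => // j z.
by have := FB z; apply: le_trans; rewrite (le_trans _ (norm_coord_le _ i j))// mxE.
Qed.

Lemma pnabla_cont d m (F : 'cV[R]_d -> 'cV[R]_m) : C1_pnabla F -> continuous F.
Proof.
move=> [dF _ _]; apply: continuous_mx => i j; rewrite ord1.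
exact: differentiable_cont.
Qed.

(** The mean value theorem bounds the error by the oscillation of the Jacobian
    matrix on a ball, which is small uniformly in [x] by periodicity. *)
Lemma pnabla_unif_diff d m (F : 'cV[R]_d -> 'cV[R]_m) (e : R) :
  C1_pnabla F -> 0 < e ->
  exists2 r : R, 0 < r & forall x h h', `|h| <= r -> `|h'| <= r ->
    `|F (x + h) - F (x + h') - nabla F x *m (h - h')| <= e * `|h - h'|.
Proof.
move=> [dF cF pF] e0; pose e' := e / (d%:R + 1).
have d1 : 0 < d%:R + 1 :> R by rewrite ltr_wpDl.
have e'0 : 0 < e' by rewrite divr_gt0.
have [r r0 Fr] := periodic_unif_cont cF pF e'0.
exists r => // x h h' hr h'r.
apply: normv_le_coord => [|i]; first by rewrite mulr_ge0// ltW.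
have [c /andP[c0 c1] cE] := segment_MVT (x + h') (h - h') (dF i).
rewrite 3!mxE [X in _ + X]mxE nabla_mulE.
have -> : x + h = x + h' + (h - h') by apply/matrixP => k l; rewrite !mxE; ring.
rewrite cE -sumrB (le_trans (ler_norm_sum _ _ _))//.
apply: (@le_trans _ _ (\sum_(j < d) e' * `|h - h'|)); last first.
  rewrite sumr_const card_ord -[leLHS]mulr_natl mulrA ler_wpM2r//.
  by rewrite /e' mulrA ler_pdivrMr// mulrC ler_wpM2l ?lerDl// ltW.
apply: ler_sum => j _; rewrite -mulrBl normrM ler_pM//; last exact: norm_coord_le.
have := Fr (x + h' + c *: (h - h')) x.
have -> : x + h' + c *: (h - h') - x = (1 - c) *: h' + c *: h.
  by apply/matrixP => k l; rewrite !mxE; ring.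
move=> /(_ _)/(le_trans _)-> //.
  by rewrite (le_trans _ (norm_coord_le _ i j))// !mxE.
rewrite (le_trans (ler_normD _ _))// !normrZ !ger0_norm ?subr_ge0//.
have -> : r = (1 - c) * r + c * r by ring.
by rewrite lerD// ler_wpM2l// subr_ge0.
Qed.

End C1periodic.

(** * Flows of periodic fields *)

Section Flow.
Context {R : realType}.

Lemma gronwall (E dE : R -> R) (k : R) :
  (forall t, is_derive t (1 : R) E (dE t)) ->
  (forall t, `|dE t| <= k * E t) ->
  forall t, E t <= E 0 * expR (k * `|t|).
Proof.
move=> Ed Ek t.
have der (c s : R) : is_derive s (1 : R) (fun s => E s * expR (c * s))
    ((dE s + c * E s) * expR (c * s)).
  have H := @is_derive1_comp R expR (fun s => c * s) s _ _
    (is_derive_expR _) (is_derive_mulid c s).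
  have := is_derive_mulf (Ed s) H.
  by move/is_derive_eq; apply => /=; ring.
have bnd s : - (k * E s) <= dE s <= k * E s by rewrite -ler_norml.
have mono (A B c : R) : A * expR c <= B -> A <= B * expR (- c).
  move=> le; rewrite -[A]mulr1 -(expR0 R) -(subrr c) expRD mulrA.
  by rewrite ler_wpM2r// expR_ge0.
have [t0|t0] := leP 0 t.
  have H : {homo (fun s => - (E s * expR (- k * s))) : x y / x <= y}.
    apply: (@is_derive_homo R _ (fun s => - ((dE s + - k * E s) * expR (- k * s)))).
    move=> s; rewrite oppr_ge0 mulr_le0_ge0 ?expR_ge0//.
    by have /andP[_] := bnd s; lra.
  have := H 0 t t0; rewrite lerN2 mulr0 expR0 mulr1 => /mono.
  by rewrite mulNr opprK ger0_norm.
have H : {homo (fun s => E s * expR (k * s)) : x y / x <= y}.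
  apply: (@is_derive_homo R _ (fun s => (dE s + k * E s) * expR (k * s))) => // s.
  by rewrite mulr_ge0 ?expR_ge0//; have /andP[+ _] := bnd s; lra.
have := H t 0 (ltW t0); rewrite mulr0 expR0 mulr1 => /mono.
by rewrite ltr0_norm// mulrN.
Qed.

(** A squared distance that is differentiable, equivalent to the square of the
    sup norm. *)
Definition sqdist d (x y : 'cV[R]_d) : R := \sum_i (x i 0 - y i 0) ^+ 2.

Lemma norm_le_sqdist d (x y : 'cV[R]_d) : `|x - y| ^+ 2 <= sqdist x y.
Proof.
have S0 : 0 <= sqdist x y by apply: sumr_ge0 => i _; exact: sqr_ge0.
rewrite -(sqr_sqrtr S0) lerXn2r ?nnegrE ?sqrtr_ge0//.
apply: normv_le_coord => [|i]; first exact: sqrtr_ge0.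
rewrite !mxE -sqrtr_sqr ler_wsqrtr// /sqdist (bigD1 i)//= lerDl.
by apply: sumr_ge0 => j _; exact: sqr_ge0.
Qed.

Lemma sqdist_le_norm d (x y : 'cV[R]_d) : sqdist x y <= d%:R * `|x - y| ^+ 2.
Proof.
apply: (@le_trans _ _ (\sum_(i < d) `|x - y| ^+ 2)).
  apply: ler_sum => i _; rewrite -real_normK ?num_real//.
  rewrite lerXn2r ?nnegrE// -[leLHS](_ : `|(x - y) i 0| = _) ?norm_coord_le//.
  by rewrite !mxE.
by rewrite sumr_const card_ord mulr_natl.
Qed.

(** Gronwall's inequality is applied to the squared Euclidean distance, which
    is differentiable in time, unlike the sup norm; this is where the factor
    [d + 1] comes from. *)
Lemma trajectories_dist d (b : 'cV[R]_d -> 'cV[R]_d) (L : R)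
    (y z : R -> 'cV[R]_d) : 0 <= L ->
  (forall u v, `|b u - b v| <= L * `|u - v|) ->
  (forall t, is_derive t (1 : R) y (b (y t))) ->
  (forall t, is_derive t (1 : R) z (b (z t))) ->
  forall t, `|y t - z t| <=
    (d%:R + 1) * expR (2 * d%:R * L * `|t|) * `|y 0 - z 0|.
Proof.
move=> L0 bL yd zd t; pose k := 2 * d%:R * L.
pose dE s := \sum_i ((y s i 0 - z s i 0) * (b (y s) i 0 - b (z s) i 0)) *+ 2.
have Ed s : is_derive s (1 : R) (fun s => sqdist (y s) (z s)) (dE s).
  apply: (@is_derive_sumf R _ _ (fun i s => (y s i 0 - z s i 0) ^+ 2)
    (fun i s => ((y s i 0 - z s i 0) * (b (y s) i 0 - b (z s) i 0)) *+ 2)).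
  move=> i; have H := is_derive_subf (is_derive_coord i 0 (yd s))
    (is_derive_coord i 0 (zd s)).
  have := is_derive_mulf H H; move/is_derive_eq; apply.
  by rewrite [X in X + _]mulrC -mulr2n.
have Ek s : `|dE s| <= k * sqdist (y s) (z s).
  apply: (@le_trans _ _ (k * `|y s - z s| ^+ 2)); last first.
    by rewrite ler_wpM2l ?norm_le_sqdist// /k !mulr_ge0.
  rewrite (le_trans (ler_norm_sum _ _ _))//.
  apply: (@le_trans _ _ (\sum_(i < d) (`|y s - z s| * (L * `|y s - z s|)) *+ 2)).
    apply: ler_sum => i _; rewrite normrMn lerMn2r /= normrM.
    apply: ler_pM => //.
      by have := norm_coord_le (y s - z s) i 0; rewrite !mxE.
    apply: le_trans (bL _ _).
    by have := norm_coord_le (b (y s) - b (z s)) i 0; rewrite !mxE.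
  rewrite sumr_const card_ord -[leLHS]mulr_natl -[X in _ * X]mulr_natl /k.
  by rewrite le_eqVlt; apply/orP; left; apply/eqP; ring.
have := gronwall Ed Ek t => G.
have e1 : 1 <= expR (k * `|t|) by rewrite -(expR0 R) ler_expR !mulr_ge0.
rewrite -/k -(@ler_pXn2r _ 2)// ?nnegrE ?mulr_ge0 ?expR_ge0 ?addr_ge0//.
rewrite (le_trans (norm_le_sqdist _ _))// (le_trans G)//.
rewrite exprMn; set N := `|y 0 - z 0| ^+ 2; set e := expR _ in e1 *.
apply: (@le_trans _ _ (d%:R * N * e)).
  by rewrite ler_wpM2r ?expR_ge0// sqdist_le_norm.
rewrite mulrAC ler_wpM2r ?sqr_ge0// exprMn ler_pM ?expR_ge0//.
  have d0 : 0 <= d%:R :> R by []. nra.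
by rewrite expr2 ler_peMl// expR_ge0.
Qed.

End Flow.

Section FlowTheory.
Context {R : realType} (d : nat) (b : 'cV[R]_d -> 'cV[R]_d)
  (X : R -> 'cV[R]_d -> 'cV[R]_d).
Hypotheses (hb : Ck_sharp_mx 1 b) (hX : is_flow b X).

Lemma field_cont : continuous b.
Proof. exact/pnabla_cont/C1_sharp_pnabla. Qed.

Lemma field_bounded : exists2 B : R, 0 < B & forall x, `|b x| <= B.
Proof. by apply: periodic_bounded; [exact: field_cont | have [] := hb]. Qed.

Lemma field_lipschitz :
  exists2 L : R, 0 < L & forall x y, `|b x - b y| <= L * `|x - y|.
Proof. exact/pnabla_lipschitz/C1_sharp_pnabla. Qed.

Lemma flow0 x : X 0 x = x.
Proof. by have [] := hX x. Qed.

Lemma flow_derive x t : is_derive t (1 : R) (fun s => X s x) (b (X t x)).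
Proof. by have [_] := hX x; exact. Qed.

(** Uniqueness for the Cauchy problem; the group law and the commutation of
    the flow with integer translations follow from it. *)
Lemma flow_unique (y : R -> 'cV[R]_d) :
  (forall t, is_derive t (1 : R) y (b (y t))) -> forall t, y t = X t (y 0).
Proof.
move=> yd t; have [L L0 bL] := field_lipschitz.
have := trajectories_dist (ltW L0) bL yd (flow_derive (y 0)) t.
by rewrite flow0 subrr normr0 mulr0 normr_le0 subr_eq0 => /eqP.
Qed.

Lemma flow_add s t x : X s (X t x) = X (s + t) x.
Proof.
suff H u : is_derive u (1 : R) (fun s => X (s + t) x) (b (X (u + t) x)).
  by have := flow_unique H s; rewrite add0r => ->.
apply: is_derive_mx => i j.
apply: (@is_derive_translate R (fun s => X s x i j)).
exact: is_derive_coord (flow_derive x (u + t)).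
Qed.

Lemma flowK t : cancel (X t) (X (- t)).
Proof. by move=> x; rewrite flow_add addNr flow0. Qed.

Lemma flowNK t : cancel (X (- t)) (X t).
Proof. by move=> x; rewrite flow_add addrN flow0. Qed.

Lemma flow_int t x k : k \is a mxOver Num.int -> X t (x + k) = X t x + k.
Proof.
move=> kint; have [_ bp] := hb.
suff H u : is_derive u (1 : R) (fun s => X s x + k) (b (X u x + k)).
  by have := flow_unique H t; rewrite flow0 => ->.
rewrite bp//; apply: is_derive_mx => i j; under eq_fun do rewrite mxE.
have := is_derive_addf (is_derive_coord i j (flow_derive x u))
  (is_derive_cstf (k i j) u).
by rewrite addr0.
Qed.

Lemma flow_lipschitz (tau : R) : exists2 C : R, 0 < C &
  forall t x y, `|t| <= tau -> `|X t x - X t y| <= C * `|x - y|.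
Proof.
have [L L0 bL] := field_lipschitz.
exists ((d%:R + 1) * expR (2 * d%:R * L * tau)) => [|t x y ttau].
  by rewrite mulr_gt0 ?expR_gt0 ?ltr_wpDl.
have := trajectories_dist (ltW L0) bL (flow_derive x) (flow_derive y) t.
rewrite !flow0 => /le_trans; apply; rewrite ler_wpM2r// ler_wpM2l ?addr_ge0//.
by rewrite ler_expR ler_wpM2l// !mulr_ge0// ltW.
Qed.

Lemma flow_cont t : continuous (X t).
Proof.
have [C C0 XC] := flow_lipschitz `|t|.
apply: (@lipschitz_cont R 'cV[R]_d 'cV[R]_d _ C) => x y; exact: XC.
Qed.

Lemma flow_speed (B : R) s t x : (forall x, `|b x| <= B) ->
  `|X t x - X s x| <= B * `|t - s|.
Proof.
move=> bB; have B0 : 0 <= B by exact: le_trans (bB 0).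
wlog st : s t / s <= t => [H|].
  have [st|/ltW ts] := leP s t; first exact: H.
  by rewrite distrC [`|t - s|]distrC; exact: H.
apply: normv_le_coord => [|i]; first exact: mulr_ge0.
have [c _ cE] := real_MVT (fun u => is_derive_coord i 0 (flow_derive x u)) st.
rewrite !mxE cE normrM ler_wpM2r// (le_trans (norm_coord_le _ _ _))//.
Qed.

(** By the mean value theorem, each coordinate of the error is [h] times the
    variation of [b] along an arc of duration at most [h]. *)
Lemma flow_euler : exists2 C : R, 0 < C & forall h x, 0 <= h ->
  `|X h x - (x + h *: b x)| <= C * h ^+ 2.
Proof.
have [B B0 bB] := field_bounded; have [L L0 bL] := field_lipschitz.
exists (L * B) => [|h x h0]; first exact: mulr_gt0.
apply: normv_le_coord => [|i]; first by rewrite mulr_ge0 ?sqr_ge0// mulr_ge0 ?ltW.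
have [c /andP[c0 ch] cE] :=
  real_MVT (fun u => is_derive_coord i 0 (flow_derive x u)) h0.
have -> : (X h x - (x + h *: b x)) i 0 = (b (X c x) - b x) i 0 * h.
  by move: cE; rewrite flow0 !mxE => cE; rewrite opprD addrA cE; ring.
rewrite normrM (ger0_norm h0) expr2 mulrA ler_wpM2r//.
rewrite (le_trans (norm_coord_le _ _ _))// (le_trans (bL _ _))// -mulrA.
apply: ler_wpM2l; first exact: ltW.
have := flow_speed 0 c x bB.
rewrite flow0 subr0 (ger0_norm c0) => H; apply: (le_trans H).
by apply: ler_wpM2l => //; exact: ltW.
Qed.

End FlowTheory.

(** * Functions of class C^k *)

Section CkCalculus.
Context {R : realType}.

Lemma differentiable_mx (V : normedModType R) m (G : V -> 'cV[R]_m) x :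
  (forall i, differentiable (fun y => G y i 0) x) -> differentiable G x.
Proof.
move=> dG.
have -> : G = (fun y => \sum_(i < m) G y i 0 *: (delta_mx i 0 : 'cV[R]_m)).
  apply/funext => y; rewrite {1}(matrix_sum_delta (G y)).
  by apply: eq_bigr => i _; rewrite big_ord1.
have -> : (fun y => \sum_(i < m) G y i 0 *: (delta_mx i 0 : 'cV[R]_m)) =
    \sum_(i < m) (fun y => G y i 0 *: (delta_mx i 0 : 'cV[R]_m)).
  by apply/funext => y; rewrite fct_sumE.
apply: differentiable_sum => i.
exact: (@differentiableZl R V 'cV[R]_m (fun y => G y i 0) (delta_mx i 0)).
Qed.

Lemma differentiable_comp_cV d m (f : 'cV[R]_m -> R) (G : 'cV[R]_d -> 'cV[R]_m) x :
  differentiable f (G x) -> (forall i, differentiable (fun y => G y i 0) x) ->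
  differentiable (fun y => f (G y)) x.
Proof.
move=> df dG; apply: (@differentiable_comp R 'cV[R]_d 'cV[R]_m R G f) => //.
exact: differentiable_mx.
Qed.

Lemma partial_comp d m (f : 'cV[R]_m -> R) (G : 'cV[R]_d -> 'cV[R]_m) x j :
  differentiable f (G x) -> (forall i, differentiable (fun y => G y i 0) x) ->
  partial j (fun y => f (G y)) x =
  \sum_i partial i f (G x) * partial j (fun y => G y i 0) x.
Proof.
move=> df dG; have dG' := differentiable_mx dG.
have dfG : differentiable (f \o G) x by exact: differentiable_comp.
rewrite {1}/partial deriveE// (@diff_comp R 'cV[R]_d 'cV[R]_m R G f)//=.
rewrite diff_partial//; apply: eq_bigr => i _; congr (_ * _).
rewrite -deriveE// derive_mx ?mxE//.
exact: diff_derivable.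
Qed.

Lemma partialD d (f g : 'cV[R]_d -> R) j x :
  differentiable f x -> differentiable g x ->
  partial j (fun y => f y + g y) x = partial j f x + partial j g x.
Proof. by move=> df dg; apply: deriveD; exact: diff_derivable. Qed.

Lemma partialM d (f g : 'cV[R]_d -> R) j x :
  differentiable f x -> differentiable g x ->
  partial j (fun y => f y * g y) x = partial j f x * g x + f x * partial j g x.
Proof.
move=> df dg; rewrite addrC [partial j f x * _]mulrC.
by apply: deriveM; exact: diff_derivable.
Qed.

Lemma partial_cst d (c : R) j (x : 'cV[R]_d) : partial j (fun=> c) x = 0.
Proof. exact: derive_cst. Qed.

Lemma partial_coord d i j (x : 'cV[R]_d) :
  partial j (fun y => y i 0) x = (i == j)%:R.
Proof.
have H := @derive_mx R 'cV[R]_d d 1 id x (delta_mx j 0)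
  (@derivable_id R 'cV[R]_d x (delta_mx j 0)).
have := congr1 (fun M : 'cV[R]_d => M i 0) H.
by rewrite derive_id !mxE eqxx andbT; exact: esym.
Qed.

Lemma partialV d (f : 'cV[R]_d -> R) j x :
  differentiable f x -> f x != 0 ->
  partial j (fun y => (f y)^-1) x = - partial j f x * ((f x)^-1 * (f x)^-1).
Proof.
move=> df f0; rewrite /partial deriveV//; last exact: diff_derivable.
by rewrite /GRing.scale/= expr2 invfM; ring.
Qed.

Lemma CkS d k (f : 'cV[R]_d -> R) : Ck k.+1 f <->
  (forall x, differentiable f x) /\ (forall j, Ck k (partial j f)).
Proof. by []. Qed.

Lemma Ck_cst d k (c : R) : Ck k (fun _ : 'cV[R]_d => c).
Proof.
elim: k c => [|k IH] c /=; first exact: cont_cst.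
split=> [x|j]; first exact: differentiable_cst.
by rewrite (_ : partial j _ = fun=> 0)//; apply/funext => x; exact: partial_cst.
Qed.

Lemma CkW d k (f : 'cV[R]_d -> R) : Ck k.+1 f -> Ck k f.
Proof.
elim: k f => [|k IH] f /CkS[df pf]; first exact: differentiable_cont.
by split=> // j; apply: IH; exact: pf.
Qed.

Lemma Ck_leq d k l (f : 'cV[R]_d -> R) : (k <= l)%N -> Ck l f -> Ck k f.
Proof. elim: l => [|l IH]; first by rewrite leqn0 => /eqP ->.
by rewrite leq_eqVlt => /predU1P[->//|]; rewrite ltnS => /IH H /CkW /H. Qed.

Lemma Ck_cont d k (f : 'cV[R]_d -> R) : Ck k f -> continuous f.
Proof. exact: (@Ck_leq _ 0). Qed.

Lemma CkD d k (f g : 'cV[R]_d -> R) : Ck k f -> Ck k g -> Ck k (fun x => f x + g x).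
Proof.
elim: k f g => [|k IH] f g; first exact: contD.
move=> /CkS[df pf] /CkS[dg pg]; split=> [x|j]; first exact: differentiableD.
rewrite (_ : partial j _ = fun x => partial j f x + partial j g x).
  exact: IH.
by apply/funext => x; exact: partialD.
Qed.

Lemma CkM d k (f g : 'cV[R]_d -> R) : Ck k f -> Ck k g -> Ck k (fun x => f x * g x).
Proof.
elim: k f g => [|k IH] f g; first exact: contM.
move=> fc gc; have /CkS[df pf] := fc; have /CkS[dg pg] := gc.
split=> [x|j]; first exact: differentiableM.
rewrite (_ : partial j _ = fun x => partial j f x * g x + f x * partial j g x).
  by apply: CkD; apply: IH => //; exact: CkW.
by apply/funext => x; exact: partialM.
Qed.

Lemma CkZ d k c (f : 'cV[R]_d -> R) : Ck k f -> Ck k (fun x => c * f x).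
Proof. by move=> fc; apply: CkM => //; exact: Ck_cst. Qed.

Lemma CkN d k (f : 'cV[R]_d -> R) : Ck k f -> Ck k (fun x => - f x).
Proof. by move=> /(CkZ (-1)); under eq_fun do rewrite mulN1r. Qed.

Lemma CkB d k (f g : 'cV[R]_d -> R) : Ck k f -> Ck k g -> Ck k (fun x => f x - g x).
Proof. by move=> fc /CkN; exact: CkD. Qed.

Lemma Ck_sum d k (I : Type) (r : seq I) (f : I -> 'cV[R]_d -> R) :
  (forall i, Ck k (f i)) -> Ck k (fun x => \sum_(i <- r) f i x).
Proof.
move=> fc; elim: r => [|i r IH].
  by under eq_fun do rewrite big_nil; exact: Ck_cst.
by under eq_fun do rewrite big_cons; exact: CkD.
Qed.

Lemma Ck_prod d k (I : Type) (r : seq I) (f : I -> 'cV[R]_d -> R) :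
  (forall i, Ck k (f i)) -> Ck k (fun x => \prod_(i <- r) f i x).
Proof.
move=> fc; elim: r => [|i r IH].
  by under eq_fun do rewrite big_nil; exact: Ck_cst.
by under eq_fun do rewrite big_cons; exact: CkM.
Qed.

Lemma CkV d k (f : 'cV[R]_d -> R) : Ck k f -> (forall x, f x != 0) ->
  Ck k (fun x => (f x)^-1).
Proof.
elim: k f => [|k IH] f fc f0; first exact: contV.
have /CkS[df pf] := fc; split=> [x|j].
  by apply: differentiableV.
rewrite (_ : partial j _ = fun x => - partial j f x * ((f x)^-1 * (f x)^-1)).
  have fV : Ck k (fun x => (f x)^-1) by apply: IH => //; exact: CkW.
  by apply: CkM; [exact: CkN | exact: CkM].
by apply/funext => x; exact: partialV.
Qed.

Lemma Ck_coord d k i : Ck k (fun x : 'cV[R]_d => x i 0).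
Proof.
case: k => [|k]; first exact: coord_continuous.
split=> [x|j]; first exact: differentiable_coord.
rewrite (_ : partial j _ = fun=> (i == j)%:R); first exact: Ck_cst.
by apply/funext => x; exact: partial_coord.
Qed.

Lemma Ck_mx_cont d m n k (G : 'cV[R]_d -> 'M[R]_(m, n)) :
  Ck_mx k G -> continuous G.
Proof. by move=> Gc; apply: continuous_mx => i j; exact: Ck_cont (Gc i j). Qed.

Lemma Ck_comp d m k (f : 'cV[R]_m -> R) (G : 'cV[R]_d -> 'cV[R]_m) :
  Ck k f -> Ck_mx k G -> Ck k (fun x => f (G x)).
Proof.
elim: k f G => [|k IH] f G.
  by move=> fc Gc; apply: cont_comp_cV => //; exact: (@Ck_mx_cont _ _ _ 0).
move=> /CkS[df pf] Gc; split=> [x|j].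
  by apply: differentiable_comp_cV => // i; have [] := Gc i 0.
rewrite (_ : partial j _ = fun x => \sum_i
    partial i f (G x) * partial j (fun y => G y i 0) x).
  apply: Ck_sum => i; apply: CkM; last by have /CkS[_] := Gc i 0; exact.
  by apply: IH => // i' j'; exact: CkW.
by apply/funext => x; apply: partial_comp => // i; have [] := Gc i 0.
Qed.

Lemma Ck_det d k n (A : 'cV[R]_d -> 'M[R]_n) :
  Ck_mx k A -> Ck k (fun x => \det (A x)).
Proof.
move=> Ac; rewrite /determinant; apply: Ck_sum => s.
by apply: CkZ; apply: Ck_prod => i; exact: Ac.
Qed.

Lemma Ck_adj d k n (A : 'cV[R]_d -> 'M[R]_n) :
  Ck_mx k A -> Ck_mx k (fun x => \adj (A x)).
Proof.
move=> Ac i j; under eq_fun do rewrite mxE /cofactor.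
apply: CkZ; apply: Ck_det => i' j'; under eq_fun do rewrite !mxE.
exact: Ac.
Qed.

Lemma Ck_invmx d k n (A : 'cV[R]_d -> 'M[R]_n) :
  Ck_mx k A -> (forall x, \det (A x) != 0) -> Ck_mx k (fun x => invmx (A x)).
Proof.
move=> Ac A0 i j.
have -> : (fun x => invmx (A x) i j) = fun x => (\det (A x))^-1 * \adj (A x) i j.
  by apply/funext => x; rewrite /invmx unitmxE unitfE A0 mxE.
by apply: CkM; [apply: CkV => //; exact: Ck_det | exact: Ck_adj].
Qed.

Lemma Ck_mulmx d k m n p (A : 'cV[R]_d -> 'M[R]_(m, n)) (B : 'cV[R]_d -> 'M[R]_(n, p)) :
  Ck_mx k A -> Ck_mx k B -> Ck_mx k (fun x => A x *m B x).
Proof.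
move=> Ac Bc i j; under eq_fun do rewrite mxE.
by apply: Ck_sum => l; exact: CkM.
Qed.

Lemma Ck_mx_cst d k m n (A : 'M[R]_(m, n)) : Ck_mx k (fun _ : 'cV[R]_d => A).
Proof. by move=> i j; exact: Ck_cst. Qed.

Lemma Ck_mxD d k m n (A B : 'cV[R]_d -> 'M[R]_(m, n)) :
  Ck_mx k A -> Ck_mx k B -> Ck_mx k (fun x => A x + B x).
Proof.
move=> Ac Bc i j; under eq_fun do rewrite mxE.
exact: CkD.
Qed.

Lemma Ck_mxB d k m n (A B : 'cV[R]_d -> 'M[R]_(m, n)) :
  Ck_mx k A -> Ck_mx k B -> Ck_mx k (fun x => A x - B x).
Proof.
move=> Ac Bc i j; under eq_fun do rewrite !mxE.
exact: CkB.
Qed.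

Lemma Ck_mx_id d k : Ck_mx k (fun x : 'cV[R]_d => x).
Proof. by move=> i j; rewrite ord1; exact: Ck_coord. Qed.

Lemma Ck_mx_comp d m n p k (F : 'cV[R]_m -> 'M[R]_(n, p)) (G : 'cV[R]_d -> 'cV[R]_m) :
  Ck_mx k F -> Ck_mx k G -> Ck_mx k (fun x => F (G x)).
Proof. by move=> Fc Gc i j; apply: (Ck_comp (f := fun y => F y i j)). Qed.

Lemma Ck_nabla d m k (F : 'cV[R]_d -> 'cV[R]_m) :
  Ck_mx k.+1 F -> Ck_mx k (nabla F).
Proof.
move=> Fc i j; under eq_fun do rewrite mxE.
by have /CkS[_] := Fc i 0; exact.
Qed.

Lemma Ck_mxS d m k (F : 'cV[R]_d -> 'cV[R]_m) :
  (forall i x, differentiable (fun y => F y i 0) x) -> Ck_mx k (nabla F) ->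
  Ck_mx k.+1 F.
Proof.
move=> dF nF i j; rewrite ord1; split => // l.
by have := nF i l; under eq_fun do rewrite mxE.
Qed.

Lemma nabla_comp d m n (F : 'cV[R]_m -> 'cV[R]_n) (G : 'cV[R]_d -> 'cV[R]_m) x :
  (forall i, differentiable (fun y => F y i 0) (G x)) ->
  (forall i, differentiable (fun y => G y i 0) x) ->
  nabla (fun y => F (G y)) x = nabla F (G x) *m nabla G x.
Proof.
move=> dF dG; apply/matrixP => i j; rewrite !mxE (partial_comp _ (dF i) dG).
by apply: eq_bigr => l _; rewrite !mxE.
Qed.

Lemma is_derive_nabla d m (F : 'cV[R]_d -> 'cV[R]_m) (c : R -> 'cV[R]_d) (t : R) v :
  (forall i, differentiable (fun y => F y i 0) (c t)) ->
  is_derive t (1 : R) c v ->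
  is_derive t (1 : R) (fun s => F (c s)) (nabla F (c t) *m v).
Proof.
move=> dF cd; apply: is_derive_mx => i j; rewrite ord1 nabla_mulE.
exact: (is_derive_comp_curve (f := fun y => F y i 0)).
Qed.

Lemma differentiable_bigsum d (I : Type) (r : seq I) (f : I -> 'cV[R]_d -> R) x :
  (forall i, differentiable (f i) x) ->
  differentiable (fun y => \sum_(i <- r) f i y) x.
Proof.
move=> df; elim: r => [|i r IH].
  have -> : (fun y => \sum_(i <- [::]) f i y) = fun=> 0.
    by apply/funext => y; rewrite big_nil.
  exact: differentiable_cst.
have -> : (fun y => \sum_(i <- i :: r) f i y) = fun y => f i y + \sum_(i <- r) f i y.
  by apply/funext => y; rewrite big_cons.
exact: differentiableD.
Qed.

Lemma partial_sum d (I : Type) (r : seq I) (f : I -> 'cV[R]_d -> R) j x :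
  (forall i, differentiable (f i) x) ->
  partial j (fun y => \sum_(i <- r) f i y) x = \sum_(i <- r) partial j (f i) x.
Proof.
move=> df; elim: r => [|i r IH].
  have -> : (fun y => \sum_(i <- [::]) f i y) = fun=> 0.
    by apply/funext => y; rewrite big_nil.
  by rewrite big_nil; exact: partial_cst.
have -> : (fun y => \sum_(i <- i :: r) f i y) = fun y => f i y + \sum_(i <- r) f i y.
  by apply/funext => y; rewrite big_cons.
by rewrite big_cons partialD// ?IH//; exact: differentiable_bigsum.
Qed.

Lemma mulmx_comp_sum d m n (A : 'M[R]_(n, m)) (F : 'cV[R]_d -> 'cV[R]_m) i :
  (fun y => (A *m F y) i 0) = fun y => \sum_l A i l * F y l 0.
Proof. by apply/funext => y; rewrite mxE. Qed.

Lemma differentiable_scale d (c : R) (f : 'cV[R]_d -> R) x :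
  differentiable f x -> differentiable (fun y => c * f y) x.
Proof. by move=> df; apply: differentiableM => //; exact: differentiable_cst. Qed.

Lemma differentiable_mulmx d m n (A : 'M[R]_(n, m)) (F : 'cV[R]_d -> 'cV[R]_m) x i :
  (forall i, differentiable (fun y => F y i 0) x) ->
  differentiable (fun y => (A *m F y) i 0) x.
Proof.
move=> dF; rewrite mulmx_comp_sum.
apply: (@differentiable_bigsum d _ _ (fun l y => A i l * F y l 0)) => l.
exact: differentiable_scale.
Qed.

Lemma partialZ d (c : R) (f : 'cV[R]_d -> R) j x :
  differentiable f x -> partial j (fun y => c * f y) x = c * partial j f x.
Proof.
move=> df; have dc : differentiable (fun _ : 'cV[R]_d => c) x.
  exact: differentiable_cst.
by rewrite (partialM j dc df) partial_cst mul0r add0r.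
Qed.

Lemma nabla_mulmx d m n (A : 'M[R]_(n, m)) (F : 'cV[R]_d -> 'cV[R]_m) x :
  (forall i, differentiable (fun y => F y i 0) x) ->
  nabla (fun y => A *m F y) x = A *m nabla F x.
Proof.
move=> dF; apply/matrixP => i j; rewrite !mxE mulmx_comp_sum.
rewrite (@partial_sum d _ _ (fun l y => A i l * F y l 0)).
  by apply: eq_bigr => l _; rewrite partialZ// mxE.
by move=> l; exact: differentiable_scale.
Qed.

Lemma nabla_id d (x : 'cV[R]_d) : nabla id x = 1%:M.
Proof. by apply/matrixP => i j; rewrite !mxE partial_coord. Qed.

End CkCalculus.

(** * Global inversion on the torus *)

(** The contraction principle requires column vectors to form a complete
    normed module. *)
HB.instance Definition _ (R : realType) (m n : nat) := Complete.on 'M[R]_(m, n).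

Section Lifting.
Context {R : realType}.

Lemma contraction_fixpoint (m : nat) (U : set 'cV[R]_m) (f : 'cV[R]_m -> 'cV[R]_m) :
  closed U -> U !=set0 -> (forall x, U x -> U (f x)) ->
  (forall x y, U x -> U y -> `|f x - f y| <= 2^-1 * `|x - y|) ->
  exists2 p, U p & p = f p.
Proof.
move=> Uc U0 fU fc; pose g : {fun U >-> U} := mkfun fU.
apply: (@banach_fixed_point R 'cV[R]_m U g) => //.
have h : 0 <= 2^-1 :> R by rewrite invr_ge0.
exists (NngNum h); split => /=; first by rewrite invf_lt1 ?ltr1n.
by move=> [x y] /= [Ux Uy]; exact: fc.
Qed.

Lemma closed_norm_le (m : nat) (r : R) : closed [set z : 'cV[R]_m | `|z| <= r].
Proof.
apply: (@closed_comp 'cV[R]_m R (fun z => `|z|) [set x | x <= r]).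
  by move=> x _; exact: norm_continuous.
exact: closed_le.
Qed.

(** Surjectivity of the Jacobian matrix, uniformly in the base point. It holds
    for a local diffeomorphism of the torus, where the right inverse is the
    inverse, and for a function without critical points, where it is the
    gradient divided by its squared norm. *)
Definition right_invertible n m (F : 'cV[R]_n -> 'cV[R]_m) : Prop :=
  exists (A : 'cV[R]_n -> 'M[R]_(n, m)) (a La : R),
    [/\ 0 < a, 0 <= La, forall x, nabla F x *m A x = 1%:M,
        forall x (z : 'cV[R]_m), `|A x *m z| <= a * `|z| &
        forall x y (z : 'cV[R]_m),
          `|A x *m z - A y *m z| <= La * `|x - y| * `|z|].

(** A simplified Newton scheme: the displacement that lifts [v] is sought in
    the form [A x *m z], where [z] is the fixed point of a contraction on a
    ball whose radius does not depend on [x]. *)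
Lemma small_lifting n m (F : 'cV[R]_n -> 'cV[R]_m) :
  C1_pnabla F -> right_invertible F ->
  exists (delta K : R) (G : 'cV[R]_n -> 'cV[R]_m -> 'cV[R]_n),
    [/\ 0 < delta, 0 < K,
        forall x v, `|v| <= delta -> F (G x v) = F x + v,
        forall x, G x 0 = x &
        forall x y v w, `|v| <= delta -> `|w| <= delta ->
          `|G x v - G y w| <= K * (`|x - y| + `|v - w|)].
Proof.
move=> CF [A [a [La [a0 La0 FA Aa AL]]]].
have e0 : 0 < (2 * a)^-1 by rewrite invr_gt0 mulr_gt0.
have [r r0 Fr] := pnabla_unif_diff CF e0.
have [L L0 FL] := pnabla_lipschitz CF.
pose rho := r / a; have rho0 : 0 < rho by rewrite divr_gt0.
have Ar x (z : 'cV[R]_m) : `|z| <= rho -> `|A x *m z| <= r.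
  by move=> zr; rewrite (le_trans (Aa _ _))// mulrC -ler_pdivlMr.
pose T x (v z : 'cV[R]_m) := z - (F (x + A x *m z) - F x - v).
have Tc x v z z' : `|z| <= rho -> `|z'| <= rho ->
    `|T x v z - T x v z'| <= 2^-1 * `|z - z'|.
  move=> zr z'r; have := Fr x _ _ (Ar x _ zr) (Ar x _ z'r).
  rewrite -mulmxBr mulmxA FA mul1mx => H.
  have -> : T x v z - T x v z' =
      - (F (x + A x *m z) - F (x + A x *m z') - (z - z')).
    by apply/matrixP => i j; rewrite !mxE; ring.
  rewrite normrN (le_trans H)// (le_trans (ler_wpM2l (ltW e0) (Aa x (z - z'))))//.
  by rewrite mulrA invfM divfK// gt_eqF.
have T0 x v : T x v 0 = v.
  by rewrite /T mulmx0 addr0 subrr !sub0r opprK.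
pose delta := rho / 2; have d0 : 0 < delta by rewrite divr_gt0.
have ex x v : exists z, `|v| <= delta -> `|z| <= rho /\ z = T x v z.
  have [vd|_] := leP `|v| delta; last by exists 0.
  have c1 := @closed_norm_le m rho.
  have c2 : [set z : 'cV[R]_m | `|z| <= rho] !=set0.
    by exists 0; rewrite /= normr0 ltW.
  have c3 z : [set z | `|z| <= rho] z -> [set z | `|z| <= rho] (T x v z).
    move=> /= zr; have := Tc x v z 0 zr; rewrite normr0 T0 => /(_ (ltW rho0)) H.
    rewrite -(subrK v (T x v z)) (le_trans (ler_normD _ _))//.
    by rewrite (splitr rho) lerD// (le_trans H)// subr0 mulrC ler_wpM2r.
  have c4 z z' : [set z | `|z| <= rho] z -> [set z | `|z| <= rho] z' ->
      `|T x v z - T x v z'| <= 2^-1 * `|z - z'|.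
    by move=> zr z'r; exact: Tc.
  by have [p pr pT] := contraction_fixpoint c1 c2 c3 c4; exists p => _.
have [Z ZP] := choice (fun p : 'cV[R]_n * 'cV[R]_m => ex p.1 p.2).
have {}ZP x v : `|v| <= delta -> `|Z (x, v)| <= rho /\ Z (x, v) = T x v (Z (x, v)).
  exact: (ZP (x, v)).
pose G x v := x + A x *m Z (x, v).
have Lr0 : 0 <= La * rho by apply: mulr_ge0 => //; exact: ltW.
pose P := L * (2 + La * rho).
have P0 : 0 <= P by apply: mulr_ge0; [exact: ltW | exact: addr_ge0].
pose C1 := 2 * (P + 1); pose K := 1 + La * rho + a * C1.
have C10 : 0 <= C1 by rewrite /C1; lra.
have AZ x y v : `|v| <= delta ->
    `|A x *m Z (x, v) - A y *m Z (x, v)| <= La * rho * `|x - y|.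
  move=> vd; rewrite (le_trans (AL _ _ _))// mulrAC ler_wpM2r//.
  by rewrite ler_wpM2l// (ZP x v vd).1.
have Zl x y v w : `|v| <= delta -> `|w| <= delta ->
    `|Z (x, v) - Z (y, w)| <= C1 * (`|x - y| + `|v - w|).
  move=> vd wd; have [zr zT] := ZP x v vd; have [z'r z'T] := ZP y w wd.
  set z := Z (x, v) in zr zT *; set z' := Z (y, w) in z'r z'T *.
  have H1 := Tc y w z z' zr z'r.
  have H2 : `|T x v z - T y w z| <= P * `|x - y| + `|v - w|.
    have -> : T x v z - T y w z = (F (y + A y *m z) - F (x + A x *m z)) +
        (F x - F y) + (v - w).
      by apply/matrixP => i j; rewrite !mxE; ring.
    rewrite (le_trans (ler_normD _ _))// lerD2r (le_trans (ler_normD _ _))//.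
    have := FL x y; have := FL (y + A y *m z) (x + A x *m z).
    have -> : y + A y *m z - (x + A x *m z) = - ((x - y) + (A x *m z - A y *m z)).
      by apply/matrixP => i j; rewrite !mxE; ring.
    rewrite normrN => H3; have := ler_normD (x - y) (A x *m z - A y *m z).
    have := AZ x y v vd; rewrite -/z => H4 H5 H6.
    have {H5}H5 := le_trans H5 (lerD (lexx _) H4).
    have := le_trans H3 (ler_wpM2l (ltW L0) H5).
    have -> : P * `|x - y| =
        L * (`|x - y| + La * rho * `|x - y|) + L * `|x - y| by rewrite /P; ring.
    by lra.
  have H : `|z - z'| <= `|T x v z - T y w z| + `|T y w z - T y w z'|.
    by rewrite [in leLHS]zT [in leLHS]z'T -(subrKA (T y w z)) ler_normD.
  have := normr_ge0 (x - y); have := normr_ge0 (v - w).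
  have := normr_ge0 (z - z').
  by rewrite /C1; nra.
have aC1 : 0 <= a * C1 by apply: mulr_ge0 => //; exact: ltW.
exists delta, K, G; split => //.
- by rewrite /K; lra.
- move=> x v vd; have [_ zT] := ZP x v vd.
  have : F (G x v) - F x - v = 0.
    apply: oppr_inj; apply: (addrI (Z (x, v))).
    by rewrite oppr0 addr0 [RHS]zT.
  by move/eqP; rewrite subr_eq0 subr_eq addrC => /eqP.
- move=> x; have [|zr zT] := ZP x 0; first by rewrite normr0 ltW.
  have := Tc x 0 (Z (x, 0)) 0 zr; rewrite normr0 => /(_ (ltW rho0)).
  rewrite -zT T0 subr0 => H.
  have : `|Z (x, 0)| = 0 by have := normr_ge0 (Z (x, 0)); lra.
  by move/normr0_eq0 => z0; rewrite /G z0 mulmx0 addr0.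
- move=> x y v w vd wd.
  have -> : G x v - G y w = (x - y) + (A x *m Z (x, v) - A y *m Z (x, v)) +
      A y *m (Z (x, v) - Z (y, w)).
    by rewrite mulmxBr /G; apply/matrixP => i j; rewrite !mxE; ring.
  rewrite (le_trans (ler_normD _ _))//.
  have H1 := le_trans (ler_normD _ _) (lerD (lexx `|x - y|) (AZ x y v vd)).
  have H2 := le_trans (Aa y _) (ler_wpM2l (ltW a0) (Zl x y v w vd wd)).
  apply: (le_trans (lerD H1 H2)); rewrite /K.
  have := normr_ge0 (x - y); have := normr_ge0 (v - w); nra.
Qed.

(** Displacements of any prescribed size are lifted by iterating small ones. *)
Lemma lifting n m (F : 'cV[R]_n -> 'cV[R]_m) :
  C1_pnabla F -> right_invertible F ->
  forall B : R, exists (K : R) (G : 'cV[R]_n -> 'cV[R]_m -> 'cV[R]_n),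
    [/\ 0 < K, forall x v, `|v| <= B -> F (G x v) = F x + v,
        forall x, G x 0 = x &
        forall x y v w, `|v| <= B -> `|w| <= B ->
          `|G x v - G y w| <= K * (`|x - y| + `|v - w|)].
Proof.
move=> CF FR B.
have [delta [K [G [d0 K0 FG G0 GK]]]] := small_lifting CF FR.
pose N := (Num.truncn (B / delta)).+1.
have N0 : 0 < N%:R :> R by rewrite ltr0n.
have small (v : 'cV[R]_m) : `|v| <= B -> `|N%:R^-1 *: v| <= delta.
  move=> vB; rewrite normrZ ger0_norm ?invr_ge0// ler_pdivrMl//.
  rewrite (le_trans vB)// -ler_pdivrMr// ltW//.
  exact: truncnS_gt.
pose It k x v := iter k (fun z => G z (N%:R^-1 *: v)) x.
have ItF k x v : `|v| <= B -> F (It k x v) = F x + (k%:R * N%:R^-1) *: v.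
  move=> vB; elim: k => [|k IH]; first by rewrite mul0r scale0r addr0.
  rewrite /It iterS FG ?small// IH -addrA; congr (_ + _).
  by rewrite -scalerDl -natr1 mulrDl mul1r.
have It0 k x : It k x 0 = x.
  by rewrite /It scaler0; elim: k => //= k ->.
have ItK k : exists2 C : R, 0 < C & forall x y v w, `|v| <= B -> `|w| <= B ->
    `|It k x v - It k y w| <= C * (`|x - y| + `|v - w|).
  elim: k => [|k [C C0 IH]].
    by exists 1 => // x y v w _ _; rewrite mul1r lerDl.
  exists (K * (C + 1)) => [|x y v w vB wB]; first by rewrite mulr_gt0// ltr_wpDl// ltW.
  rewrite /It !iterS (le_trans (GK _ _ _ _ (small _ vB) (small _ wB)))//.
  rewrite -mulrA ler_wpM2l//; first exact: ltW.
  rewrite mulrDl mul1r lerD ?IH//.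
  rewrite -scalerBr normrZ ger0_norm ?invr_ge0//.
  apply: (@le_trans _ _ `|v - w|); last by rewrite lerDr.
  by rewrite ler_piMl// invf_le1// ler1n.
have [C C0 ItC] := ItK N.
exists C, (It N); split => // x v vB.
by rewrite ItF// divff ?scale1r// gt_eqF.
Qed.

Lemma periodic_C1_lipschitz_mx n m p (A : 'cV[R]_n -> 'M[R]_(m, p)) :
  Ck_mx 1 A -> Zperiodic A ->
  exists2 L : R, 0 < L & forall x y, `|A x - A y| <= L * `|x - y|.
Proof.
move=> Ac Ap.
have ex j : exists L : R, 0 < L /\
    forall x y, `|col j (A x) - col j (A y)| <= L * `|x - y|.
  have [|L L0 AL] := @pnabla_lipschitz R n m (fun x => col j (A x)).
    apply: C1_sharp_pnabla; split; last by move=> x k /Ap ->.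
    by move=> i l; under eq_fun do rewrite mxE; exact: Ac.
  by exists L.
have [L LP] := choice ex.
have L0 : 0 <= \sum_j L j by apply: sumr_ge0 => j _; have [/ltW] := LP j.
exists (\sum_j L j + 1) => [|x y]; first by rewrite ltr_wpDl.
apply: norm_le_coord => [|i j]; first by rewrite mulr_ge0// addr_ge0.
have [Lj0 H] := LP j.
have -> : (A x - A y) i j = (col j (A x) - col j (A y)) i 0 by rewrite !mxE.
rewrite (le_trans (norm_coord_le _ _ _))// (le_trans (H _ _))// ler_wpM2r//.
rewrite (bigD1 j)//= -addrA lerDl addr_ge0// sumr_ge0// => k _.
by have [/ltW] := LP k.
Qed.

Lemma right_invertibleP n m (F : 'cV[R]_n -> 'cV[R]_m)
    (A : 'cV[R]_n -> 'M[R]_(n, m)) :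
  Ck_mx 1 A -> Zperiodic A -> (forall x, nabla F x *m A x = 1%:M) ->
  right_invertible F.
Proof.
move=> Ac Ap FA; have [B B0 AB] := periodic_bounded (Ck_mx_cont Ac) Ap.
have [L L0 AL] := periodic_C1_lipschitz_mx Ac Ap.
exists A, (m%:R * B + 1), (m%:R * L); split => //.
- by rewrite ltr_wpDl// mulr_ge0// ltW.
- by rewrite mulr_ge0// ltW.
- move=> x z; rewrite (le_trans (mulmx_norm_le _ _))// ler_wpM2r//.
  by rewrite (@le_trans _ _ (m%:R * B))// ?lerDl// ler_wpM2l.
- move=> x y z; rewrite -mulmxBl (le_trans (mulmx_norm_le _ _))// ler_wpM2r//.
  by rewrite -mulrA ler_wpM2l.
Qed.

Section Hadamard.
Variables (n : nat) (F : 'cV[R]_n -> 'cV[R]_n).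
Hypotheses (F2 : Ck_mx 2 F) (Fp : Zperiodic (nabla F))
  (F0 : forall x, \det (nabla F x) != 0).

Let CF : C1_pnabla F.
Proof. by apply: Ck1_C1_pnabla => // i j; exact: CkW. Qed.

Lemma nabla_unit x : nabla F x \in unitmx.
Proof. by rewrite unitmxE unitfE. Qed.

Lemma Ck_nabla_inv : Ck_mx 1 (fun x => invmx (nabla F x)).
Proof. by apply: Ck_invmx => //; exact: Ck_nabla. Qed.

Lemma nabla_inv_periodic : Zperiodic (fun x => invmx (nabla F x)).
Proof. by move=> x k /Fp ->. Qed.

Lemma diffeo_right_invertible : right_invertible F.
Proof.
apply: (right_invertibleP Ck_nabla_inv nabla_inv_periodic) => x.
by rewrite mulmxV// nabla_unit.
Qed.

(** [F] is close to its differential on balls of uniform radius, and the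
    inverse of the differential is bounded. *)
Lemma local_injectivity :
  exists2 r : R, 0 < r & forall x y, `|x - y| <= r -> F x = F y -> x = y.
Proof.
have [B B0 AB] := periodic_bounded (Ck_mx_cont Ck_nabla_inv) nabla_inv_periodic.
pose a := n%:R * B + 1; have a0 : 0 < a by rewrite ltr_wpDl// mulr_ge0// ltW.
have e0 : 0 < (2 * a)^-1 by rewrite invr_gt0 mulr_gt0.
have [r r0 Fr] := pnabla_unif_diff CF e0.
exists r => // x y xy Fxy.
have := Fr y (x - y) 0 xy; rewrite normr0 => /(_ (ltW r0)).
rewrite addr0 subr0 [y + _]addrC subrK Fxy subrr sub0r normrN => H.
have E : x - y = invmx (nabla F y) *m (nabla F y *m (x - y)).
  by rewrite mulKmx// nabla_unit.
have H1 : `|x - y| <= a * `|nabla F y *m (x - y)|.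
  rewrite [in leLHS]E (le_trans (mulmx_norm_le _ _))// ler_wpM2r// /a.
  by rewrite (@le_trans _ _ (n%:R * B))// ?lerDl// ler_wpM2l.
have H2 := le_trans H1 (ler_wpM2l (ltW a0) H).
move: H2; rewrite mulrA invfM mulrCA divff ?gt_eqF// mulr1 => H2.
apply/eqP; rewrite -subr_eq0 -normr_le0.
by have := normr_ge0 (x - y); lra.
Qed.

(** Lifting the image of the segment from [x0] to [x1] from its start gives a
    path that cannot separate from the segment, by local injectivity, and that
    ends at [x0] because the image of the segment is a loop. The lift is taken
    with fixed base point [x0], so it depends on the end of the path only. *)
Lemma diffeo_injective : injective F.
Proof.
move=> x0 x1 Fx; have [r r0 Fr] := local_injectivity.
have [L L0 FL] := pnabla_lipschitz CF.
have [K [G [K0 FG G0 GK]]] := lifting CF diffeo_right_invertible (L * `|x1 - x0|).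
pose g (t : R) := x0 + t *: (x1 - x0).
pose h t := G x0 (F (g t) - F x0).
have gB t : 0 <= t <= 1 -> `|F (g t) - F x0| <= L * `|x1 - x0|.
  move=> /andP[t0 t1]; rewrite (le_trans (FL _ _))// ler_wpM2l//; first exact: ltW.
  by rewrite /g addrAC subrr add0r normrZ ger0_norm// ler_piMl.
have gl s t : `|g s - g t| <= `|s - t| * `|x1 - x0|.
  by rewrite /g opprD addrACA subrr add0r -scalerBl normrZ.
pose M := (Num.truncn ((K * L + 1) * `|x1 - x0| / r)).+1.
have M0 : 0 < M%:R :> R by rewrite ltr0n.
have MH : (K * L + 1) * `|x1 - x0| <= r * M%:R.
  by rewrite -ler_pdivrMl// [_^-1 * _]mulrC ltW//; exact: truncnS_gt.
have step (i : nat) : (i <= M)%N -> h (i%:R / M%:R) = g (i%:R / M%:R).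
  elim: i => [|i IH] iM.
    by rewrite mul0r /h /g scale0r addr0 subrr G0.
  have {}IH := IH (ltnW iM).
  set t := i%:R / M%:R in IH; set s := _ / _.
  have t01 : 0 <= t <= 1.
    by rewrite divr_ge0//= ler_pdivrMr// mul1r ler_nat ltnW.
  have s01 : 0 <= s <= 1 by rewrite divr_ge0//= ler_pdivrMr// mul1r ler_nat.
  have st : `|s - t| = M%:R^-1.
    by rewrite /s /t -mulrBl -natr1 addrAC subrr add0r mul1r ger0_norm// invr_ge0.
  have gst : `|g s - g t| <= M%:R^-1 * `|x1 - x0| by rewrite -st.
  apply: Fr; last by rewrite FG ?gB// addrC subrK.
  have -> : h s - g s = (h s - h t) - (g s - g t) by rewrite IH opprB addrA subrK.
  rewrite (le_trans (ler_normB _ _))//.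
  have H1 := GK x0 x0 (F (g s) - F x0) (F (g t) - F x0) (gB s s01) (gB t t01).
  rewrite subrr normr0 add0r opprB addrA subrK in H1.
  have H2 := le_trans H1 (ler_wpM2l (ltW K0) (FL _ _)).
  have H3 : K * (L * `|g s - g t|) <= K * (L * (M%:R^-1 * `|x1 - x0|)).
    exact: (ler_wpM2l (ltW K0) (ler_wpM2l (ltW L0) gst)).
  apply: (le_trans (lerD (le_trans H2 H3) gst)).
  rewrite -(ler_pM2r M0) (le_trans _ MH)// le_eqVlt; apply/orP; left; apply/eqP.
  by field; rewrite gt_eqF.
have := step M (leqnn _); rewrite divff ?gt_eqF// /h /g scale1r [x0 + _]addrC subrK.
by rewrite Fx subrr G0.
Qed.

Lemma diffeo_surjective y : exists x, F x = y.
Proof.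
have [K [G [K0 FG G0 GK]]] := lifting CF diffeo_right_invertible `|y - F 0|.
by exists (G 0 (y - F 0)); rewrite FG// addrC subrK.
Qed.

(** Hadamard's global inversion theorem, on the torus: lifting the
    displacement from [F 0] to [y] gives surjectivity. *)
Lemma hadamard : exists Phi : 'cV[R]_n -> 'cV[R]_n, cancel F Phi /\ cancel Phi F.
Proof.
have [Phi PhiP] := choice diffeo_surjective.
by exists Phi; split => // x; apply: diffeo_injective; rewrite PhiP.
Qed.

Lemma inverse_lipschitz (Phi : 'cV[R]_n -> 'cV[R]_n) : cancel F Phi -> cancel Phi F ->
  exists2 K : R, 0 < K & forall y z, `|y - z| <= 1 -> `|Phi y - Phi z| <= K * `|y - z|.
Proof.
move=> FK PhiK.
have [K [G [K0 FG G0 GK]]] := lifting CF diffeo_right_invertible 1.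
exists K => // y z yz.
have -> : Phi y = G (Phi z) (y - z).
  by apply: (can_inj FK); rewrite PhiK FG// PhiK addrC subrK.
rewrite -{2}(G0 (Phi z)) (le_trans (GK _ _ _ _ yz _))// ?normr0//.
by rewrite subrr normr0 add0r subr0.
Qed.

(** Subtracting the linear form with coefficients [a] reduces the claim to a
    function whose differential is zero. *)
Lemma differentiable_of_bound d (f : 'cV[R]_d -> R) (x a : 'cV[R]_d) :
  (forall e : R, 0 < e -> exists2 r : R, 0 < r & forall h, `|h| <= r ->
     `|f (x + h) - f x - \sum_j a j 0 * h j 0| <= e * `|h|) ->
  differentiable f x /\ forall j, partial j f x = a j 0.
Proof.
move=> fa.
pose l (y : 'cV[R]_d) := \sum_j a j 0 * y j 0.
have ldiff y : differentiable l y.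
  by apply: differentiable_bigsum => j; apply: differentiable_scale;
    exact: differentiable_coord.
have lpart j y : partial j l y = a j 0.
  rewrite partial_sum; last first.
    by move=> i; apply: differentiable_scale; exact: differentiable_coord.
  rewrite (bigD1 j)//= big1 ?addr0.
    by rewrite partialZ ?partial_coord ?eqxx ?mulr1//; exact: differentiable_coord.
  move=> i ij; rewrite partialZ ?partial_coord ?(negbTE ij) ?mulr0//.
  exact: differentiable_coord.
pose g y := f y - l y.
have g0 : g \o shift x = cst (g x) + (0 : 'cV[R]_d -> R) +o_ (0 : 'cV[R]_d) id.
  apply/eqaddoP => e e0; have [r r0 fr] := fa e e0.
  suff : \forall h \near (0 : 'cV[R]_d),
    `|(g \o shift x - (cst (g x) + 0)) h| <= e * `|id h| by [].
  apply/nbhs_normP; exists r => // h /=; rewrite sub0r normrN => /ltW hr.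
  have := fr h hr; congr (_ <= _); congr `|_|.
  rewrite !fctE /g /l /= addr0 [h + x]addrC.
  have -> : \sum_j a j 0 * (x + h) j 0 =
      \sum_j a j 0 * x j 0 + \sum_j a j 0 * h j 0.
    by rewrite -big_split; apply: eq_bigr => j _; rewrite mxE mulrDr.
  by ring.
have dg : 'd g x = 0 :> ('cV[R]_d -> R).
  by apply/diff_unique => //; exact: cst_continuous.
have gdiff : differentiable g x.
  by apply/diff_locallyP; rewrite dg; split => //; exact: cst_continuous.
have fE : f = (fun y => g y + l y) by apply/funext => y; rewrite /g subrK.
split=> [|j]; first by rewrite fE; apply: differentiableD.
by rewrite fE partialD// lpart /partial deriveE// dg add0r.
Qed.

Lemma inverse_differentiable (Phi : 'cV[R]_n -> 'cV[R]_n) :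
  cancel F Phi -> cancel Phi F -> forall i y,
  differentiable (fun y => Phi y i 0) y /\
  forall j, partial j (fun y => Phi y i 0) y = invmx (nabla F (Phi y)) i j.
Proof.
move=> FK PhiK i y; have [K K0 PhiL] := inverse_lipschitz FK PhiK.
pose A := invmx (nabla F (Phi y)).
pose a := n%:R * `|A| + 1; have a0 : 0 < a by rewrite ltr_wpDl// mulr_ge0.
have [|df pf] := @differentiable_of_bound n (fun y => Phi y i 0) y (\col_j A i j);
    last by split=> // j; rewrite pf mxE.
  move=> e e0; pose e' := e / (a * K).
  have e'0 : 0 < e' by rewrite divr_gt0// mulr_gt0.
  have [r r0 Fr] := pnabla_unif_diff CF e'0.
  exists (Num.min 1 (r / K)) => [|h]; first by rewrite lt_min ltr01 divr_gt0.
  rewrite le_min => /andP[h1 hr].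
  pose k := Phi (y + h) - Phi y.
  have kK : `|k| <= K * `|h|.
    have -> : `|h| = `|y + h - y| by rewrite addrAC subrr add0r.
    by apply: PhiL; rewrite addrAC subrr add0r.
  have kr : `|k| <= r by rewrite (le_trans kK)// mulrC -ler_pdivlMr.
  have := Fr (Phi y) k 0 kr; rewrite normr0 => /(_ (ltW r0)).
  have -> : Phi y + k = Phi (y + h) by rewrite /k addrC subrK.
  rewrite addr0 subr0 !PhiK [y + h]addrC addrK [h + y]addrC => H.
  have E : k - A *m h = - (A *m (h - nabla F (Phi y) *m k)).
    by rewrite mulmxBr mulmxA mulVmx ?nabla_unit// mul1mx opprB.
  have -> : Phi (y + h) i 0 - Phi y i 0 - \sum_j (\col_j A i j) j 0 * h j 0 =
      (k - A *m h) i 0.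
    rewrite !mxE; congr (_ - _); apply: eq_bigr => j _; rewrite mxE; by [].
  rewrite (le_trans (norm_coord_le _ _ _))// E normrN.
  rewrite (le_trans (mulmx_norm_le _ _))//.
  apply: (@le_trans _ _ (a * (e' * (K * `|h|)))).
    apply: ler_pM => //.
      by rewrite /a lerDl.
    exact: le_trans H (ler_wpM2l (ltW e'0) kK).
  rewrite /e' le_eqVlt; apply/orP; left; apply/eqP; field.
  by rewrite !gt_eqF.
Qed.

(** The Jacobian matrix of [Phi] is that of [F], composed with [Phi] and
    inverted; so each degree of regularity of [Phi] gives the next one. *)
Lemma inverse_C2 (Phi : 'cV[R]_n -> 'cV[R]_n) :
  cancel F Phi -> cancel Phi F -> Ck_mx 2 Phi.
Proof.
move=> FK PhiK; have D := inverse_differentiable FK PhiK.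
have dPhi i x : differentiable (fun y => Phi y i 0) x by have [] := D i x.
have E : nabla Phi = fun y => invmx (nabla F (Phi y)).
  apply/funext => y; apply/matrixP => i j; rewrite mxE.
  by have [_ ->] := D i y.
have Phi0 : Ck_mx 0 Phi by move=> i j; rewrite ord1; exact: differentiable_cont.
have Phi1 : Ck_mx 1 Phi.
  apply: Ck_mxS => //; rewrite E.
  apply: (@Ck_mx_comp _ _ _ _ _ 0 (fun x => invmx (nabla F x))) => // i j.
  exact: CkW (Ck_nabla_inv i j).
apply: Ck_mxS => //; rewrite E.
exact: (@Ck_mx_comp _ _ _ _ _ 1 (fun x => invmx (nabla F x)) _ Ck_nabla_inv).
Qed.

End Hadamard.

End Lifting.

(** * Trajectories that are periodic up to a translation *)

Section Rotation.
Context {R : realType} (d : nat) (b : 'cV[R]_d -> 'cV[R]_d)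
  (X : R -> 'cV[R]_d -> 'cV[R]_d).
Hypotheses (hb : Ck_sharp_mx 1 b) (hX : is_flow b X).

(** The complete periods contribute exact translations by [k], so the error is
    due to one period only. *)
Lemma period_expansion (B T : R) (x k : 'cV[R]_d) :
  (forall x, `|b x| <= B) -> 0 < T ->
  (forall t, 0 <= t -> X (t + T) x = X t x + k) ->
  forall t, 0 <= t -> `|X t x - x - t *: (T^-1 *: k)| <= B * T + `|k|.
Proof.
move=> bB T0 XT t t0; pose n := Num.truncn (t / T).
have /andP[nt tn] : n%:R <= t / T < n.+1%:R.
  by apply: truncn_itv; rewrite divr_ge0// ltW.
pose r := t - n%:R * T.
have r0 : 0 <= r by rewrite subr_ge0 -ler_pdivlMr.
have rT : r <= T.
  by move: tn; rewrite ltr_pdivrMr// -natr1 mulrDl mul1r /r => /ltW; lra.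
have B0 : 0 <= B := le_trans (normr_ge0 _) (bB 0).
have Xn m : X (r + m%:R * T) x = X r x + m%:R *: k.
  elim: m => [|m IH]; first by rewrite mul0r addr0 scale0r addr0.
  rewrite -natr1 mulrDl mul1r addrA XT ?IH ?scalerDl ?scale1r ?addrA//.
  by rewrite addr_ge0// mulr_ge0// ltW.
have tE : t = r + n%:R * T by rewrite subrK.
have -> : X t x - x - t *: (T^-1 *: k) = (X r x - X 0 x) - (r / T) *: k.
  rewrite {1}tE Xn (flow0 hX) [in t *: _]tE scalerA mulrDl mulfK ?gt_eqF//.
  by apply/matrixP => i j; rewrite !mxE; ring.
rewrite (le_trans (ler_normB _ _))// lerD//.
  rewrite (le_trans (flow_speed hX _ _ _ bB))// subr0 ger0_norm//.
  exact: ler_wpM2l.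
rewrite normrZ ger0_norm ?divr_ge0//; last exact: ltW.
by rewrite ler_piMl// ler_pdivrMr// mul1r.
Qed.

(** The hypothesis on the periods, stated for arbitrary constants so that two
    choices of them can be compared. *)
Definition translation_period (A : set 'cV[R]_d) (T_A k_A : R)
    (T : 'cV[R]_d -> R) (k : 'cV[R]_d -> 'cV[R]_d) : Prop :=
  forall x, A x ->
    [/\ 0 < T x <= T_A, k x \is a mxOver Num.int, enorm (k x) <= k_A &
        forall t, 0 <= t -> X (t + T x) x = X t x + k x].

Lemma translation_period_bound (A : set 'cV[R]_d) (T_A k_A : R) T k :
  0 < T_A -> 0 < k_A -> translation_period A T_A k_A T k ->
  exists2 C : R, 0 < C & forall t x, 0 <= t -> A x ->
    `|X t x - x - t *: ((T x)^-1 *: k x)| <= C.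
Proof.
move=> TA0 kA0 per; have [B B0 bB] := field_bounded hb.
exists (B * T_A + k_A) => [|t x t0 /per[/andP[T0 TTA] kint kkA XT]].
  by rewrite addr_gt0// mulr_gt0.
rewrite (le_trans (period_expansion bB T0 XT t0))// lerD//.
  by rewrite ler_wpM2l// ltW.
exact: le_trans (norm_le_enorm _) kkA.
Qed.

(** Two different velocities would separate the two affine approximations of
    the same trajectory without bound. *)
Lemma rotation_unique (x z z' : 'cV[R]_d) (C C' : R) :
  (forall t, 0 <= t -> `|X t x - x - t *: z| <= C) ->
  (forall t, 0 <= t -> `|X t x - x - t *: z'| <= C') -> z = z'.
Proof.
move=> zC zC'; apply/eqP; rewrite -subr_eq0 -normr_le0 leNgt; apply/negP => zz'.
have C0 : 0 <= C := le_trans (normr_ge0 _) (zC 0 (lexx _)).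
have C'0 : 0 <= C' := le_trans (normr_ge0 _) (zC' 0 (lexx _)).
pose t := (C + C' + 1) / `|z - z'|.
have t0 : 0 <= t by rewrite divr_ge0// addr_ge0// addr_ge0.
have : `|t *: (z - z')| <= C + C'.
  have -> : t *: (z - z') = (X t x - x - t *: z') - (X t x - x - t *: z).
    by apply/matrixP => i j; rewrite !mxE; ring.
  by rewrite (le_trans (ler_normB _ _))// addrC lerD// ?zC ?zC'.
by rewrite normrZ ger0_norm// divfK ?gt_eqF// gerDl ler10.
Qed.

(** The constant can be chosen before the periods, because the drift of a point
    does not depend on the period that is used to compute it. *)
Lemma periodic_expansion (A : set 'cV[R]_d) :
  exists2 C_A : R, 0 < C_A &
    forall (T_A k_A : R) T k, 0 < T_A -> 0 < k_A ->
      translation_period A T_A k_A T k ->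
      expansion_bound X A (fun x => (T x)^-1 *: k x) C_A.
Proof.
have [[TA [kA [T [k [TA0 kA0 per]]]]]|none] := pselect (exists TA kA T k,
    [/\ 0 < TA, 0 < kA & translation_period A TA kA T k]); last first.
  exists 1 => // TA kA T k TA0 kA0 per; exfalso.
  by apply: none; exists TA, kA, T, k.
have [C C0 HC] := translation_period_bound TA0 kA0 per.
exists (d%:R * C + 1) => [|TA' kA' T' k' TA'0 kA'0 per' t x t0 Ax].
  by rewrite ltr_wpDl// mulr_ge0// ltW.
have [C' C'0 HC'] := translation_period_bound TA'0 kA'0 per'.
rewrite -(@rotation_unique x _ _ C C' (fun t t0 => HC t x t0 Ax)
  (fun t t0 => HC' t x t0 Ax)).
rewrite (le_trans (enorm_le _))//.
by rewrite (@le_trans _ _ (d%:R * C))// ?lerDl// ler_wpM2l// HC.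
Qed.

End Rotation.

(** * Fields with a constant direction *)

Section StraightFlow.
Context {R : realType}.
Notation mu := (@lebesgue_measure R).

Lemma real_period_nat (H : R -> R) (T : R) (n : nat) s :
  (forall s, H (s + T) = H s) -> H (s + n%:R * T) = H s.
Proof.
move=> HT; elim: n => [|n IH]; first by rewrite mul0r addr0.
by rewrite -natr1 mulrDl mul1r addrA HT.
Qed.

Lemma real_period_repr (H : R -> R) (T s : R) : 0 < T ->
  (forall s, H (s + T) = H s) -> exists2 r, 0 <= r <= T & H s = H r.
Proof.
move=> T0 HT; pose f := Num.floor (s / T).
have /andP[fs sf] := floor_itv (s / T).
exists (s - f%:~R * T).
  rewrite subr_ge0 -ler_pdivlMr// fs /= lerBlDr.
  move: sf; rewrite intrD1 => /ltW; rewrite ler_pdivrMr// mulrDl mul1r.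
  by rewrite addrC.
case: (intP f) => [|n|n]; first by rewrite mul0r subr0.
  rewrite -[in LHS](subrK (n.+1%:R * T) s).
  by rewrite real_period_nat.
by rewrite mulrNz mulNr opprK real_period_nat.
Qed.

(** Subtracting its mean from [g] makes the primitive periodic, so that it is
    bounded by its variation over one period. *)
Lemma primitive_growth (g : R -> R) (T B : R) : continuous g -> 0 < T ->
  (forall s, g (s + T) = g s) -> (forall s, `|g s| <= B) ->
  forall s, `|primitive g s - primitive g 0 -
              T^-1 * \int[mu]_(t in `[0, T]) g t * s| <= 2 * B * T.
Proof.
move=> gc T0 gT gB s; set m := T^-1 * _.
have Gd x : is_derive x (1 : R) (primitive g) (g x) by exact: is_derive_primitive.
have I := FTC gc Gd (ltW T0).
pose H u := primitive g u - m * u.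
have Hd x : is_derive x (1 : R) H (g x - m).
  by apply: is_derive_subf => //; exact: is_derive_mulid.
have HTd u : is_derive u (1 : R) (fun u => H (u + T) - H u) 0.
  rewrite -(subrr (g u - m)) -{1}(gT u); apply: is_derive_subf => //.
  exact: is_derive_translate.
have HT u : H (u + T) = H u.
  apply/eqP; rewrite -subr_eq0 (is_derive_const HTd u) add0r /H mulr0 subr0.
  have -> : m * T = primitive g T - primitive g 0.
    by rewrite -I /m mulrC mulVKf ?gt_eqF.
  by apply/eqP; ring.
have mB : `|m| <= B.
  rewrite /m normrM ger0_norm ?invr_ge0 ?(ltW T0)// ler_pdivrMl// I.
  have [c _ ->] := real_MVT Gd (ltW T0).
  by rewrite subr0 normrM (ger0_norm (ltW T0)) mulrC ler_wpM2l// ltW.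
have [r /andP[r0 rT] Hr] := real_period_repr s T0 HT.
have -> : primitive g s - primitive g 0 - m * s = H r - H 0.
  by rewrite -Hr /H mulr0; ring.
have [c _ ->] := real_MVT Hd r0.
have B0 : 0 <= B := le_trans (normr_ge0 _) mB.
rewrite subr0 normrM (ger0_norm r0) ler_pM// (le_trans (ler_normB _ _))//.
by rewrite mulr_natl mulr2n lerD.
Qed.

Variables (d : nat) (a : 'cV[R]_d -> R) (xi : 'cV[R]_d) (T : R).
Hypotheses (ac : continuous a) (ap : Zperiodic a) (a0 : forall y, 0 < a y).
Hypotheses (T0 : 0 < T) (Txi : T *: xi \is a mxOver Num.int).

(** A trajectory [y] of the field [a xi] moves on a line, at a speed that is
    periodic along the line. The time spent per unit of length is [1 / a], so
    time grows like the mean of [1 / a] over a period. *)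
Lemma straight_expansion : exists2 C : R, 0 < C & forall y : R -> 'cV[R]_d,
  (forall t, is_derive t (1 : R) y (a (y t) *: xi)) ->
  forall t, `|y t - y 0 - t *: zeta_mean a xi T (y 0)| <= C.
Proof.
have a1c : continuous (fun y => (a y)^-1).
  by apply: contV => // y; rewrite gt_eqF.
have a1p : Zperiodic (fun y => (a y)^-1) by move=> y k /ap ->.
have [A A0 aA] := periodic_bounded ac ap.
have [B B0 aB] := periodic_bounded a1c a1p.
exists (A * (2 * B * T) * `|xi| + 1) => [|y yd t].
  by rewrite ltr_wpDl// !mulr_ge0// ltW.
pose line (s : R) := s *: xi + y 0.
have linec : continuous line.
  move=> s; apply: cvg_mx => i j; rewrite /line.
  have -> : (fun t => (t *: xi + y 0) i j) = (fun t => t * xi i j + y 0 i j).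
    by apply/funext => u; rewrite !mxE.
  rewrite !mxE; apply: cvgD; last exact: cvg_cst.
  by apply: cvgM; [exact: cvg_id | exact: cvg_cst].
have yc : continuous y.
  move=> s; apply: differentiable_continuous; apply/derivable1_diffP.
  by have [] := yd s.
have ayc : continuous (fun s => a (y s)).
  exact: cont_comp_curve.
pose theta s := primitive (fun s => a (y s)) s - primitive (fun s => a (y s)) 0.
have thetad s : is_derive s (1 : R) theta (a (y s)).
  have := is_derive_subf (is_derive_primitive s ayc)
    (is_derive_cstf (primitive (fun s => a (y s)) 0) s).
  by rewrite subr0.
have theta0 : theta 0 = 0 by rewrite /theta subrr.
have yE s : y s = line (theta s).
  apply/matrixP => i j; rewrite ord1 /line !mxE.
  have D u : is_derive u (1 : R) (fun u => y u i 0 - xi i 0 * theta u) 0.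
    have := is_derive_subf (is_derive_coord i 0 (yd u))
      (is_derive_scalef (xi i 0) (thetad u)).
    by rewrite !mxE mulrC subrr.
  have := is_derive_const D s; rewrite theta0 mulr0 subr0 => <-.
  by rewrite [theta s * _]mulrC addrC subrK.
pose g s := (a (line s))^-1.
have gc : continuous g.
  exact: (cont_comp_curve a1c linec).
have gT s : g (s + T) = g s.
  by rewrite /g /line scalerDl addrAC ap.
have gB s : `|g s| <= B by exact: aB.
have time s : primitive g (theta s) - primitive g 0 = s.
  have D u : is_derive u (1 : R) (fun u => primitive g (theta u) - u) 0.
    have H := @is_derive1_comp R (primitive g) theta u _ _
      (is_derive_primitive (theta u) gc) (thetad u).
    have := is_derive_subf H (is_derive_id u (1 : R)).
    by rewrite /g -yE mulVf ?subrr// gt_eqF.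
  have := is_derive_const D s; rewrite theta0 subr0 => <-; ring.
pose m := T^-1 * \int[mu]_(s in `[0, T]) g s.
have gr := primitive_growth gc T0 gT gB (theta t).
rewrite -/m time in gr.
have Am : A^-1 <= m.
  rewrite /m ler_pdivlMl//.
  have Gd x : is_derive x (1 : R) (primitive g) (g x) by exact: is_derive_primitive.
  rewrite (FTC gc Gd (ltW T0)); have [c _ ->] := real_MVT Gd (ltW T0).
  rewrite subr0 mulrC ler_wpM2r// ?(ltW T0)// /g lef_pV2 ?posrE//.
  exact: le_trans (ler_norm _) (aA _).
have m0 : 0 < m by rewrite (lt_le_trans _ Am)// invr_gt0.
rewrite [y t]yE /zeta_mean -/(line _).
have -> : line (theta t) - y 0 - t *: (m^-1 *: xi) = (theta t - t / m) *: xi.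
  by rewrite /line addrK scalerA -scalerBl.
rewrite normrZ (@le_trans _ _ (A * (2 * B * T) * `|xi|))// ?lerDl//.
rewrite ler_wpM2r//.
have -> : theta t - t / m = - (m^-1 * (t - m * theta t)).
  by field; rewrite gt_eqF.
rewrite normrN normrM ler_pM// ger0_norm ?invr_ge0 ?(ltW m0)//.
by rewrite -[leRHS]invrK lef_pV2 ?posrE ?invr_gt0.
Qed.

End StraightFlow.

(** * Rectification of a flow *)

Section Rectification.
Context {R : realType}.

Lemma partial_along_line d (f : 'cV[R]_d -> R) (x : 'cV[R]_d) j (s : R) :
  (forall y, differentiable f y) ->
  is_derive s (1 : R) (fun s => f (x + s *: delta_mx j 0))
    (partial j f (x + s *: delta_mx j 0)).
Proof.
move=> df; have := is_derive_comp_curve (df _) (is_derive_line x (delta_mx j 0) s).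
rewrite (bigD1 j)//= big1 ?addr0 => [|i ij]; last first.
  by rewrite !mxE (negbTE ij) mulr0.
by rewrite !mxE !eqxx mulr1.
Qed.

Lemma partial_eq0_max d (f : 'cV[R]_d -> R) x j :
  (forall y, differentiable f y) -> (forall y, f y <= f x) -> partial j f x = 0.
Proof.
move=> df fmax; pose g (s : R) := f (x + s *: delta_mx j 0).
have D s := partial_along_line x j s df.
have [_ g0] : is_derive (0 : R) (1 : R) g 0.
  apply: (@derive1_at_max _ g (-1) 1 0).
  - by rewrite (le_trans (lerN10 _)).
  - by move=> t _; have [] := D t.
  - by rewrite in_itv /= ltrN10 ltr01.
  - by move=> t _; rewrite /g scale0r addr0; exact: fmax.
by have [_] := D 0; rewrite -/g g0 scale0r addr0.
Qed.

(** A maximum exists because the cell is compact. *)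
Lemma periodic_critical_point d (f : 'cV[R]_d -> R) :
  (forall x, differentiable f x) -> Zperiodic f ->
  exists x, forall j, partial j f x = 0.
Proof.
move=> df fp; have fc := differentiable_cont df.
have c0 : @cell R d !=set0 by exists 0 => i; rewrite mxE lexx ler01.
have [x _ xmax] := compact_EVT_max c0 (@cell_compact R d)
  (continuous_subspaceT fc).
exists x => j; apply: partial_eq0_max => // y.
apply: (Zperiodic_cell (P := fun v => v <= f x) fp) => z zc.
by apply: xmax; rewrite inE.
Qed.

(** The coordinates of [F] have constant increments over integer vectors. *)
Lemma quasi_periodic d m (F : 'cV[R]_d -> 'cV[R]_m) x k :
  Ck_mx 1 F -> Zperiodic (nabla F) -> k \is a mxOver Num.int ->
  F (x + k) = F x + mean_mx (nabla F) *m k.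
Proof.
move=> Fc Fp kint; apply/matrixP => i j; rewrite ord1 [RHS]mxE [X in _ = _ + X]mxE.
rewrite (increment_mean (f := fun y => F y i 0) (Fc i 0) _ kint).
  congr (_ + _); apply: eq_bigr => l _; rewrite mxE.
  by congr (mean _ * _); apply/funext => y; rewrite mxE.
move=> l y k' k'int; have := congr1 (fun M : 'M[R]_(m, d) => M i l) (Fp y k' k'int).
by rewrite !mxE.
Qed.

(** A row vector [v] that kills the mean of the Jacobian matrix makes [v U] a
    periodic function; at its maximum, [v] kills the Jacobian matrix itself. *)
Lemma mean_nabla_unit d (U : 'cV[R]_d -> 'cV[R]_d) :
  Ck_mx 1 U -> Zperiodic (nabla U) -> (forall x, \det (nabla U x) != 0) ->
  mean_mx (nabla U) \in unitmx.
Proof.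
move=> Uc Up U0; set L := mean_mx _.
rewrite -row_free_unit -kermx_eq0; apply/negPn/negP => /rowV0Pn[v].
move=> /sub_kermxP vL v0.
have dU i x : differentiable (fun y => U y i 0) x by have [] := Uc i 0.
have dvU x : differentiable (fun y => (v *m U y) 0 0) x by exact: differentiable_mulmx.
have vUp : Zperiodic (fun y => (v *m U y) 0 0).
  by move=> y k kint; rewrite quasi_periodic// mulmxDr mulmxA vL mul0mx addr0.
have [x crit] := periodic_critical_point dvU vUp.
have : v *m nabla U x = 0.
  apply/matrixP => i j; rewrite ord1 -nabla_mulmx// !mxE.
  exact: crit.
move=> /(congr1 (mulmxr (invmx (nabla U x)))) /=.
rewrite mulmxK ?unitmxE ?unitfE// mul0mx => v0'.
by rewrite v0' eqxx in v0.
Qed.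

Variables (d : nat) (b : 'cV[R]_d -> 'cV[R]_d) (X : R -> 'cV[R]_d -> 'cV[R]_d).
Hypotheses (hb : Ck_sharp_mx 1 b) (hX : is_flow b X).
Variables (i1 : 'I_d) (U : 'cV[R]_d -> 'cV[R]_d).
Hypotheses (U2 : Ck_mx 2 U) (Up : Zperiodic (nabla U)).
Hypothesis Upos : forall x, 0 < (nabla U x *m b x) i1 0.
Hypothesis Uzero : forall x i, i != i1 -> (nabla U x *m b x) i 0 = 0.
Hypothesis U0 : forall x, \det (nabla U x) != 0.

Let L := mean_mx (nabla U).
Let M := invmx L.
Let xi : 'cV[R]_d := M *m delta_mx i1 0.
Let Psi x := M *m U x.

Let U1 : Ck_mx 1 U. Proof. by move=> i j; exact: CkW. Qed.

Let Lunit : L \in unitmx. Proof. exact: mean_nabla_unit. Qed.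

Let dU i x : differentiable (fun y => U y i 0) x.
Proof. by have [] := U1 i 0. Qed.

Let dPsi i x : differentiable (fun y => Psi y i 0) x.
Proof. exact: differentiable_mulmx. Qed.

Let nablaPsi x : nabla Psi x = M *m nabla U x.
Proof. exact: nabla_mulmx. Qed.

Let Psi2 : Ck_mx 2 Psi.
Proof. by apply: Ck_mulmx => //; exact: Ck_mx_cst. Qed.

Let PsiD x k : k \is a mxOver Num.int -> Psi (x + k) = Psi x + k.
Proof.
by move=> kint; rewrite /Psi quasi_periodic// mulmxDr mulKmx.
Qed.

Let Psi_sharp x := Psi x - x.

Let Psi_sharp2 : Ck_sharp_mx 2 Psi_sharp.
Proof.
split; last by move=> x k kint; rewrite /Psi_sharp PsiD// opprD addrACA subrr addr0.
by apply: Ck_mxB; [exact: Psi2 | exact: Ck_mx_id].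
Qed.

Let Psi_inv : exists Phi, cancel Psi Phi /\ cancel Phi Psi /\ Ck_mx 2 Phi.
Proof.
have Psip : Zperiodic (nabla Psi) by move=> x k kint; rewrite !nablaPsi Up.
have Psi0 x : \det (nabla Psi x) != 0.
  by rewrite nablaPsi det_mulmx mulf_neq0// -unitfE -unitmxE unitmx_inv.
have [Phi [PsiK PhiK]] := hadamard Psi2 Psip Psi0.
exists Phi; split; first exact: PsiK.
by split; [exact: PhiK | exact: (inverse_C2 Psi2 Psip Psi0)].
Qed.

(** Since [nabla U x *m b x] is a multiple of a fixed basis vector, [Psi]
    turns [b] into a field with the constant direction [xi]. The expansion
    known for such fields is transported back by [Psi], whose distance to the
    identity is bounded. *)
Lemma rectification : L \in unitmx /\ exists Phi : 'cV[R]_d -> 'cV[R]_d,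
  torus_C2_diffeo 1%:M Psi_sharp Psi Phi /\
  let a := fun y => (nabla U (Phi y) *m b (Phi y)) i1 0 in
  let b_hat := fun y => nabla Psi (Phi y) *m b (Phi y) in
  let X_hat := fun t y => Psi (X t (Phi y)) in
  [/\ forall y, 0 < a y, Ck_sharp 1 a, forall y, b_hat y = a y *: xi,
      is_flow b_hat X_hat &
      forall T : R, 0 < T -> T *: xi \is a mxOver Num.int ->
        fine_expansion X setT (fun x => zeta_mean a xi T (Psi x))].
Proof.
split; first exact: Lunit.
have [Phi [PsiK [PhiK Phi2]]] := Psi_inv.
exists Phi; split.
  split; split.
  - by apply/mxOverP => i j; rewrite mxE; exact: natr_int.
  - by left; rewrite det1.
  - exact: Psi_sharp2.
  - by move=> x; rewrite mul1mx /Psi_sharp addrC subrK.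
  - exact: PsiK.
  - exact: PhiK.
  - exact: Psi2.
  - exact: Phi2.
move=> a b_hat X_hat.
have a0 y : 0 < a y by exact: Upos.
have PhiD y k : k \is a mxOver Num.int -> Phi (y + k) = Phi y + k.
  by move=> kint; apply: (can_inj PsiK); rewrite PhiK PsiD// PhiK.
have [b1 bp] := hb.
have a1 : Ck_sharp 1 a.
  split; last by move=> y k kint; rewrite /a PhiD// Up// bp.
  apply: (@Ck_comp R d d 1 (fun x => (nabla U x *m b x) i1 0) Phi).
    by apply: Ck_mulmx => //; exact: Ck_nabla.
  by move=> i j; exact: CkW (Phi2 i j).
have aE x : nabla U x *m b x = (nabla U x *m b x) i1 0 *: delta_mx i1 0.
  apply/matrixP => i j; rewrite ord1 [RHS]mxE [X in _ * X]mxE eqxx andbT.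
  by have [->|ii1] := eqVneq i i1; rewrite ?mulr1// mulr0 Uzero.
have bhatE y : b_hat y = a y *: xi.
  by rewrite /b_hat nablaPsi -mulmxA aE -scalemxAr.
have Xd x t : is_derive t (1 : R) (fun s => Psi (X s x)) (b_hat (Psi (X t x))).
  rewrite /b_hat PsiK; apply: is_derive_nabla => //.
  exact: flow_derive.
have bhatflow : is_flow b_hat X_hat.
  by move=> y; split => [|t]; [rewrite /X_hat (flow0 hX) PhiK | exact: Xd].
split => // T T0 Txi; have [a1c ap] := a1.
have [C C0 HC] := straight_expansion (Ck_cont a1c) ap a0 T0 Txi.
have [Psc Psp] := Psi_sharp2.
have [p p0 Pp] := periodic_bounded (Ck_mx_cont Psc) Psp.
exists (d%:R * (C + 2 * p) + 1) => [|t x t0 _].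
  by rewrite ltr_wpDl// mulr_ge0// addr_ge0 ?(ltW C0)// mulr_ge0// ltW.
rewrite (le_trans (enorm_le _))// (@le_trans _ _ (d%:R * (C + 2 * p)))//; last first.
  by rewrite lerDl.
rewrite ler_wpM2l//.
have yd s : is_derive s (1 : R) (fun s => Psi (X s x)) (a (Psi (X s x)) *: xi).
  by rewrite -bhatE; exact: Xd.
have := HC _ yd t; rewrite (flow0 hX) => H.
set z := zeta_mean _ _ _ _ in H *.
have -> : X t x - x - t *: z =
    (Psi (X t x) - Psi x - t *: z) - (Psi_sharp (X t x) - Psi_sharp x).
  by rewrite /Psi_sharp; apply/matrixP => i j; rewrite !mxE; ring.
rewrite (le_trans (ler_normB _ _))// lerD ?H//.
by rewrite (le_trans (ler_normB _ _))// mulr_natl mulr2n lerD.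
Qed.

End Rectification.

(** * Invariant densities are divergence free *)

Section Clamp.
Context {R : realType}.

Definition clamp (s : R) : R := Num.max 0 (Num.min 1 s).

Lemma clamp_ge0 s : 0 <= clamp s. Proof. by rewrite le_max lexx. Qed.

Lemma clamp_le1 s : clamp s <= 1.
Proof. by rewrite ge_max ler01 ge_min lexx. Qed.

Lemma clamp1 s : 1 <= s -> clamp s = 1.
Proof.
by move=> s1; rewrite /clamp (min_idPl s1); apply/max_idPr; exact: ler01.
Qed.

Lemma clamp0 s : s <= 0 -> clamp s = 0.
Proof.
move=> s0; rewrite /clamp; apply/max_idPl.
by rewrite ge_min s0 orbT.
Qed.

Lemma clamp_id s : 0 <= s -> s <= 1 -> clamp s = s.
Proof. by move=> s0 s1; rewrite /clamp (min_idPr s1); apply/max_idPr. Qed.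

Lemma clamp_lipschitz s t : `|clamp s - clamp t| <= `|s - t|.
Proof.
wlog st : s t / s <= t => [H|].
  by have [/H//|/ltW/H] := leP s t; rewrite distrC [`|t - s|]distrC.
rewrite distrC [`|s - t|]distrC [leRHS]ger0_norm ?subr_ge0//.
have [s0|s0] := leP s 0.
  rewrite (clamp0 s0) subr0 ger0_norm ?clamp_ge0//.
  have [t0|t0] := leP t 0; first by rewrite clamp0// subr_ge0.
  have [t1|t1] := leP 1 t; first by rewrite clamp1//; lra.
  by rewrite (clamp_id (ltW t0) (ltW t1)); lra.
have t0 : 0 < t by exact: lt_le_trans st.
have [s1|s1] := leP 1 s.
  by rewrite !clamp1 ?(le_trans s1)// subrr normr0 subr_ge0.
rewrite (clamp_id (ltW s0) (ltW s1)).
have [t1|t1] := leP 1 t; first by rewrite clamp1// ger0_norm; lra.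
by rewrite (clamp_id (ltW t0) (ltW t1)) ger0_norm ?subr_ge0.
Qed.

Lemma clamp_cont : continuous clamp.
Proof.
by apply: (@lipschitz_cont R R R _ 1) => s t; rewrite mul1r; exact: clamp_lipschitz.
Qed.

Lemma clamp_le s t : s <= t -> clamp s <= clamp t.
Proof.
move=> st; have [s0|s0] := leP s 0; first by rewrite (clamp0 s0) clamp_ge0.
have [t1|t1] := leP 1 t; first by rewrite (clamp1 t1) clamp_le1.
have t0 : 0 < t by exact: lt_le_trans st.
have s1 : s < 1 by exact: le_lt_trans t1.
by rewrite (clamp_id (ltW s0) (ltW s1)) (clamp_id (ltW t0) (ltW t1)).
Qed.

(** Unit slices of the segment [0, y] add up to its length. *)
Lemma sum_clamp (m : nat) (y : R) : 0 <= y <= m%:R ->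
  \sum_(j < m) clamp (y - j%:R) = y.
Proof.
elim: m y => [|m IH] y /andP[y0 ym]; first by rewrite big_ord0; lra.
rewrite big_ord_recl subr0.
have [y1|y1] := leP y 1.
  rewrite (clamp_id y0 y1) big1 ?addr0// => i _; apply: clamp0.
  by rewrite subr_le0 (le_trans y1)// ler1n.
rewrite clamp1 ?(ltW y1)// (eq_bigr (fun i : 'I_m => clamp (y - 1 - i%:R))).
  rewrite IH; first by ring.
  by rewrite lerBlDr natr1 ym subr_ge0 ltW.
by move=> i _; rewrite /= /bump /= add1n -natr1 opprD addrA addrAC.
Qed.

End Clamp.

Section LayerCake.
Context {R : realType} (d : nat) (sigma : 'cV[R]_d -> R).
Hypotheses (sc : continuous sigma) (sp : Zperiodic sigma)
  (s0 : forall x, 0 < sigma x).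

Implicit Types (phi psi xi : 'cV[R]_d -> R) (c e : R) (n m : nat).

Let level (phi : 'cV[R]_d -> R) (c : R) := density_measure sigma [set x | c < phi x].

(* A continuous approximation of [level] from below, with slope [n]. *)
Let soft (phi : 'cV[R]_d -> R) (n : nat) (c : R) :=
  mean (fun x => sigma x * clamp (n%:R * (phi x - c))).

Let soft_cont phi n c : continuous phi ->
  continuous (fun x : 'cV[R]_d => sigma x * clamp (n%:R * (phi x - c))).
Proof.
move=> pc; apply: contM => //; apply: cont_comp_real clamp_cont.
apply: contM; first exact: cont_cst.
by apply: contB => //; exact: cont_cst.
Qed.

Let soft_level phi c : continuous phi ->
  soft phi n.+1 c @[n --> \oo] --> level phi c.
Proof.
move=> pc; have [B B0 sB] := periodic_bounded sc sp.
apply: (@mean_bounded_cvg _ _ _ _ B).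
- by move=> n; exact: soft_cont.
- move=> n x; rewrite normrM (ger0_norm (clamp_ge0 _)).
  by rewrite (le_trans _ (sB x))// ler_piMr// clamp_le1.
- move=> x; apply: cvgM; first exact: cvg_cst.
  rewrite indicE; have [xc|xc] := ltP c (phi x).
    have pos : 0 < phi x - c by rewrite subr_gt0.
    rewrite mem_set//=; apply: cvg_near_cst; near=> n.
    apply: clamp1.
    rewrite -ler_pdivrMr// mul1r.
    rewrite -[leRHS]invrK lef_pV2 ?posrE ?invr_gt0//; apply: ltW.
    by near: n; exact: near_infty_natSinv_lt (PosNum pos).
  rewrite memNset /=; last by apply/negP; rewrite -leNgt.
  apply: cvg_near_cst; apply: nearW => n; apply: clamp0.
  by rewrite mulr_ge0_le0// subr_le0.
Unshelve. all: by end_near. Qed.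

Let soft_le phi n c m e : continuous phi ->
  (forall x, clamp (n%:R * (phi x - c)) <= clamp (m%:R * (phi x - e))) ->
  soft phi n c <= soft phi m e.
Proof.
move=> pc H; apply: (mean_le (mean_specP d)); try exact: soft_cont.
by move=> x _; rewrite ler_wpM2l// ltW.
Qed.

Let level_ge0 phi c : continuous phi -> 0 <= level phi c.
Proof.
move=> pc; have H := @soft_level phi c pc; apply: (cvgr_to_ge H); apply: nearW => n.
rewrite -(mean_cst (mean_specP d) 0); apply: (mean_le (mean_specP d)).
- exact: cont_cst.
- exact: soft_cont.
- by move=> x _; rewrite mulr_ge0 ?clamp_ge0// ltW.
Qed.

Let soft_le_level phi (m : nat) c : continuous phi -> soft phi m c <= level phi c.
Proof.
move=> pc; have H := @soft_level phi c pc; apply: (cvgr_to_ge H).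
near=> n; apply: soft_le => // x.
have [xc|xc] := leP (phi x) c.
  by rewrite (@clamp0 _ (m%:R * _)) ?clamp_ge0// mulr_ge0_le0// subr_le0.
apply/clamp_le/ler_wpM2r; first by rewrite subr_ge0 ltW.
by near: n; exists m => // n /= mn; rewrite ler_nat leqW.
Unshelve. all: by end_near. Qed.

Let level_le_soft phi (m : nat) c : (0 < m)%N -> continuous phi ->
  level phi (c + m%:R^-1) <= soft phi m c.
Proof.
move=> m0 pc; have H := @soft_level phi (c + m%:R^-1) pc; apply: (cvgr_to_le H).
apply: nearW => n; apply: soft_le => // x.
have [xc|xc] := leP (phi x) (c + m%:R^-1).
  by rewrite (@clamp0 _ (_ * (phi x - (c + _)))) ?clamp_ge0// mulr_ge0_le0// subr_le0.
rewrite [leRHS]clamp1 ?clamp_le1//.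
by rewrite -ler_pdivrMl ?ltr0n// mulr1 lerBrDl ltW.
Qed.

Let mean_soft phi (m : nat) : (0 < m)%N -> continuous phi ->
  (forall x, 0 <= phi x <= 1) ->
  mean (fun x => sigma x * phi x) =
  m%:R^-1 * \sum_(j < m) soft phi m (j%:R / m%:R).
Proof.
move=> m0 pc p01; have mN0 : m%:R != 0 :> R by rewrite pnatr_eq0 -lt0n.
rewrite -mean_sum; last by move=> j; exact: soft_cont.
rewrite -meanZ; last by apply: cont_sum => j; exact: soft_cont.
congr mean; apply/funext => x; rewrite -mulr_sumr mulrCA; congr (_ * _).
have /andP[p0 p1] := p01 x.
rewrite (eq_bigr (fun j : 'I_m => clamp (m%:R * phi x - j%:R))).
  by rewrite sum_clamp ?mulKf// mulr_ge0//= ler_piMr.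
by move=> j _; rewrite mulrBr mulrCA divff// mulr1.
Qed.

(** Both integrals lie between the same two Riemann sums over the levels. *)
Lemma equal_levels phi psi : continuous phi -> continuous psi ->
  (forall x, 0 <= phi x <= 1) -> (forall x, 0 <= psi x <= 1) ->
  (forall c, density_measure sigma [set x | c < phi x] =
             density_measure sigma [set x | c < psi x]) ->
  mean (fun x => sigma x * phi x) = mean (fun x => sigma x * psi x).
Proof.
move=> pc qc p01 q01 lev.
pose S (m : nat) := m%:R^-1 * \sum_(j < m) level phi (j%:R / m%:R).
have bound xi (m : nat) : (0 < m)%N -> continuous xi ->
    (forall x, 0 <= xi x <= 1) -> (forall c, level xi c = level phi c) ->
    S m - m%:R^-1 * level phi 0 <= mean (fun x => sigma x * xi x) <= S m.
  move=> m0 xc x01 xl; rewrite (mean_soft m0 xc x01).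
  have m0R : 0 <= m%:R^-1 :> R by rewrite invr_ge0.
  apply/andP; split; last first.
    by apply: ler_wpM2l => //; apply: ler_sum => j _; rewrite -xl; exact: soft_le_level.
  rewrite -mulrBr ler_wpM2l// lerBlDr.
  apply: (@le_trans _ _ (\sum_(j < m) level phi (j.+1%:R / m%:R) + level phi 0)).
    rewrite addrC; case: (m) m0 => // m' _.
    rewrite [leLHS]big_ord_recl mul0r lerD2l [leRHS]big_ord_recr /= ler_wpDr//.
    exact: level_ge0.
  rewrite lerD2r; apply: ler_sum => j _.
  rewrite -natr1 mulrDl mul1r -xl; exact: level_le_soft.
apply/eqP; rewrite -subr_eq0 -normr_le0; apply/ler_addgt0Pr => e e0; rewrite add0r.
have l0 : 0 <= level phi 0 by exact: level_ge0.
have e' : 0 < e / (level phi 0 + 1) by rewrite divr_gt0// ltr_wpDl.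
near \oo => n.
have n1 := bound phi n.+1 isT pc p01 (fun c => erefl).
have n2 := bound psi n.+1 isT qc q01 (fun c => esym (lev c)).
have small : n.+1%:R^-1 * level phi 0 <= e.
  have : n.+1%:R^-1 < e / (level phi 0 + 1).
    by near: n; exact: near_infty_natSinv_lt (PosNum e').
  rewrite ltr_pdivlMr ?ltr_wpDl// mulrDr mulr1 => H.
  rewrite ltW// (le_lt_trans _ H)// lerDl.
  by rewrite invr_ge0.
move: n1 n2 small; move: (mean (fun x => sigma x * phi x)) => A.
move: (mean (fun x => sigma x * psi x)) (_ * level phi 0) (S _) => A' C D.
move=> /andP[? ?] /andP[? ?] ?; rewrite ler_norml.
by apply/andP; split; lra.
Unshelve. all: by end_near. Qed.

End LayerCake.

Section InvariantDensity.
Context {R : realType} (d : nat) (b : 'cV[R]_d -> 'cV[R]_d)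
  (X : R -> 'cV[R]_d -> 'cV[R]_d) (sigma : 'cV[R]_d -> R).
Hypotheses (hb : Ck_sharp_mx 1 b) (hX : is_flow b X).
Hypotheses (sc : continuous sigma) (sp : Zperiodic sigma)
  (s0 : forall x, 0 < sigma x).
Hypothesis inv : invariant_measure X (density_measure sigma).

Lemma superlevel_borel (phi : 'cV[R]_d -> R) (c : R) :
  continuous phi -> Zperiodic phi -> torus_borel [set x | c < phi x].
Proof.
move=> pc pp; split; last by move=> x k kint /=; rewrite pp.
apply: sub_gen_smallest => /=.
have /continuousP/(_ [set s | c < s]) := pc; apply; exact: open_gt.
Qed.

(** Invariance is a property of sets. It passes to functions through their
    superlevel sets, after an affine change that puts the values in [0, 1]. *)
Lemma mean_flow (g : 'cV[R]_d -> R) (t : R) : continuous g -> Zperiodic g ->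
  0 <= t ->
  mean (fun x => sigma x * g (X (- t) x)) = mean (fun x => sigma x * g x).
Proof.
move=> gc gp t0; have [B B0 gB] := periodic_bounded gc gp.
have B2 : 0 < 2 * B by rewrite mulr_gt0.
pose phi (x : 'cV[R]_d) := (2 * B)^-1 * (g x + B).
have pc : continuous phi.
  by apply: contM; [exact: cont_cst | apply: contD => //; exact: cont_cst].
have pp : Zperiodic phi by move=> x k kint; rewrite /phi gp.
have p01 x : 0 <= phi x <= 1.
  have := gB x; rewrite ler_norml => /andP[? ?]; apply/andP; split.
    by rewrite mulr_ge0 ?invr_ge0 ?(ltW B2)//; lra.
  by rewrite /phi ler_pdivrMl// mulr1; lra.
pose psi x := phi (X (- t) x).
have gXc : continuous (fun x => g (X (- t) x)).
  by apply: cont_comp_cV => //; exact: (flow_cont hb hX).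
have qc : continuous psi.
  by apply: cont_comp_cV => //; exact: (flow_cont hb hX).
have lev (c : R) : density_measure sigma [set x | c < psi x] =
    density_measure sigma [set x | c < phi x].
  rewrite -(inv t0 (superlevel_borel c pc pp)); congr density_measure.
  apply/seteqP; split => [x /= xc|x /= [y yc <-]].
    by exists (X (- t) x) => //; exact: (flowNK hb hX).
  by rewrite /psi (flowK hb hX).
have := equal_levels sc sp s0 qc pc (fun x => p01 _) p01 lev.
(* The affine change of values is undone on both sides. *)
have aff (h : 'cV[R]_d -> R) : continuous h ->
    mean (fun x => sigma x * h x) =
    2 * B * mean (fun x => sigma x * ((2 * B)^-1 * (h x + B))) - B * mean sigma.
  move=> hc.
  have c1 : continuous (fun x => sigma x * ((2 * B)^-1 * (h x + B))).
    apply: contM => //; apply: contM; first exact: cont_cst.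
    by apply: contD => //; exact: cont_cst.
  rewrite -meanZ// -meanZ// -meanB; last 2 first.
  - by apply: contM => //; exact: cont_cst.
  - by apply: contM => //; exact: cont_cst.
  congr mean; apply/funext => x; field; exact: lt0r_neq0.
by move=> E; rewrite (aff _ gXc) (aff _ gc) E.
Qed.

Definition lie (g : 'cV[R]_d -> R) (x : 'cV[R]_d) : R :=
  \sum_j partial j g x * b x j 0.

(** The mean of [g] along the flow is constant in time, so its derivative, the
    mean of [lie g], vanishes. The difference quotient is compared with the
    derivative uniformly on the torus. *)
Lemma mean_lie (g : 'cV[R]_d -> R) : Ck 1 g -> Zperiodic g ->
  mean (fun x => sigma x * lie g x) = 0.
Proof.
move=> g1 gp; have gc := Ck_cont g1.
have [gd gpc] := (CkS 0 g).1 g1.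
have bc := field_cont hb; have [B B0 bB] := field_bounded hb.
have bj (j : 'I_d) : continuous (fun x : 'cV[R]_d => b x j 0).
  by have := @continuous_coord R 'cV[R]_d _ _ b j 0 bc.
have Gc : continuous (lie g).
  apply: cont_sum => j; apply: contM; first exact: gpc.
  exact: bj.
have Gp : Zperiodic (lie g).
  move=> x k kint; apply: eq_bigr => j _; have [_ ->//] := hb.
  by rewrite (@partial_quasiperiodic _ _ _ k j 0)// => y; rewrite addr0 gp.
have [S S0 sS] := periodic_bounded sc sp.
have sGc : continuous (fun x => sigma x * lie g x) by exact: contM.
have gX x (t : R) : is_derive t (1 : R) (fun s => g (X s x)) (lie g (X t x)).
  exact: is_derive_comp_curve (gd _) (flow_derive hX x t).
apply/eqP; rewrite -normr_le0; apply/ler_addgt0Pr => e e0; rewrite add0r.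
have [r r0 Gr] := periodic_unif_cont Gc Gp (divr_gt0 e0 S0).
pose h := r / B; have h0 : 0 < h by exact: divr_gt0.
pose q x := h^-1 * (sigma x * g x - sigma x * g (X (- h) x)).
have c1 : continuous (fun x => sigma x * g x) by exact: contM.
have c2 : continuous (fun x => sigma x * g (X (- h) x)).
  by apply: contM => //; apply: cont_comp_cV => //; exact: (flow_cont hb hX).
have c3 : continuous (fun x => sigma x * g x - sigma x * g (X (- h) x)).
  exact: contB.
have qc : continuous q by apply: contM => //; exact: cont_cst.
have q0 : mean q = 0.
  by rewrite /q meanZ// meanB// mean_flow ?(ltW h0)// subrr mulr0.
rewrite -[mean _]subr0 -q0; apply: mean_dist => // [|x _].
  exact: mean_specP.
have hN : - h <= 0 by rewrite oppr_le0 ltW.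
have [c /andP[c1' c2'] E] := real_MVT (gX x) hN.
have -> : q x = sigma x * lie g (X c x).
  rewrite /q -mulrBr mulrCA -[in g x](flow0 hX x) E; field; exact: lt0r_neq0.
rewrite -mulrBr normrM.
apply: (@le_trans _ _ (S * (e / S))); last first.
  by rewrite mulrCA divff ?mulr1// lt0r_neq0.
apply: ler_pM => //; apply: Gr.
rewrite -[X in `|X - _|](flow0 hX x) (le_trans (flow_speed hX c 0 x bB))//.
have -> : r = B * h by rewrite /h mulrCA divff ?mulr1// lt0r_neq0.
by rewrite ler_wpM2l ?(ltW B0)// ler_norml; apply/andP; split; lra.
Qed.

(** The invariance is tested on the divergence [g] itself, which shows that
    the mean of [g ^ 2] vanishes. *)
Lemma divergence_free : Ck_mx 2 (fun x => sigma x *: b x) ->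
  forall x, \sum_j partial j (fun y => sigma y * b y j 0) x = 0.
Proof.
pose w j (y : 'cV[R]_d) : R := sigma y * b y j 0 => w2'.
have w2 j : Ck 2 (w j).
  rewrite (_ : w j = fun x => (sigma x *: b x) j 0); first exact: w2'.
  by apply/funext => x; rewrite mxE.
have w1 j : Ck 1 (w j) by exact: CkW.
have wp j : Zperiodic (w j).
  by move=> x k kint; have [_ bp] := hb; rewrite /w sp// bp.
pose g x := \sum_j partial j (w j) x.
have g1 : Ck 1 g by apply: Ck_sum => j; have [_] := (CkS 1 (w j)).1 (w2 j); exact.
have gp : Zperiodic g.
  move=> x k kint; apply: eq_bigr => j _.
  by rewrite (@partial_quasiperiodic _ _ _ k j 0)// => y; rewrite addr0 wp.
have [gd gd'] := (CkS 0 g).1 g1.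
have gc := Ck_cont g1.
have gg0 : mean (fun x => g x * g x) = 0.
  have m1 := mean_lie g1 gp.
  have gw1 j : Ck 1 (fun x => g x * w j x) by exact: CkM.
  have gwc j : continuous (partial j (fun x => g x * w j x)).
    by have [_] := (CkS 0 _).1 (gw1 j); exact.
  have gwp j : Zperiodic (fun x => g x * w j x).
    by move=> x k kint; rewrite gp// wp.
  have m2 : mean (fun x => \sum_j partial j (fun x => g x * w j x) x) = 0.
    by rewrite mean_sum// big1// => j _; exact: mean_partial0.
  have dw j x : differentiable (w j) x by have [] := (CkS 0 _).1 (w1 j).
  have wc j : continuous (w j) := Ck_cont (w1 j).
  rewrite -[RHS]subr0 -[X in _ = X - _]m2 -[X in _ = _ - X]m1 -meanB.
  - congr mean; apply/funext => x; rewrite /lie mulr_sumr -sumrB mulr_sumr.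
    by apply: eq_bigr => j _; rewrite partialM// /w; ring.
  - exact: cont_sum.
  - rewrite (_ : (fun x => _) = fun x => \sum_j partial j g x * w j x).
      by apply: cont_sum => j; apply: contM => //; exact: gd'.
    apply/funext => x; rewrite /lie mulr_sumr; apply: eq_bigr => j _.
    by rewrite /w; ring.
move=> x; suff : g x * g x = 0 by move/eqP; rewrite mulf_eq0 orbb => /eqP.
apply: (mean_eq0 (contM gc gc)) => //.
- by move=> y k kint; rewrite gp.
- by move=> y; rewrite -expr2 sqr_ge0.
Qed.

End InvariantDensity.

(** * Stream functions in the plane *)

Section Plane.
Context {R : realType}.

Lemma sum2 (V : nmodType) (F : 'I_2 -> V) : \sum_j F j = F 0 + F 1.
Proof.
rewrite !big_ord_recl big_ord0 addr0; congr (_ + F _); exact: val_inj.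
Qed.

Lemma ord2P (P : 'I_2 -> Prop) : P 0 -> P 1 -> forall i, P i.
Proof.
move=> P0 P1 [[|[|//]] i2].
  by rewrite (_ : Ordinal i2 = 0)//; exact: val_inj.
by rewrite (_ : Ordinal i2 = 1)//; exact: val_inj.
Qed.

Definition pt (s t : R) : 'cV[R]_2 := \col_i (if i == 0 then s else t).

Lemma pt0 s t : pt s t 0 0 = s. Proof. by rewrite mxE. Qed.

Lemma pt1 s t : pt s t 1 0 = t. Proof. by rewrite mxE. Qed.

Lemma ptP (x y : 'cV[R]_2) : x 0 0 = y 0 0 -> x 1 0 = y 1 0 -> x = y.
Proof.
move=> e0 e1; apply/matrixP => i j; rewrite ord1.
by move: i; apply: ord2P.
Qed.

Lemma pt_eta (x : 'cV[R]_2) : pt (x 0 0) (x 1 0) = x.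
Proof. by apply: ptP; rewrite ?pt0 ?pt1. Qed.

Lemma pt_norm (x : 'cV[R]_2) (c : R) : 0 <= c -> `|x 0 0| <= c -> `|x 1 0| <= c ->
  `|x| <= c.
Proof. by move=> c0 ? ?; apply: normv_le_coord => //; apply: ord2P. Qed.

Lemma pt_dist (s t s' t' c : R) : `|s - s'| <= c -> `|t - t'| <= c ->
  `|pt s t - pt s' t'| <= c.
Proof.
move=> h0 h1; apply: pt_norm; first exact: le_trans h0.
  by rewrite !mxE.
by rewrite !mxE.
Qed.

Lemma derive_line0 (f : 'cV[R]_2 -> R) (s t : R) : (forall y, differentiable f y) ->
  is_derive s (1 : R) (fun s => f (pt s t)) (partial 0 f (pt s t)).
Proof.
move=> fd; have := partial_along_line (pt 0 t) 0 s fd.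
have E s' : pt 0 t + s' *: delta_mx 0 0 = pt s' t.
  by apply: ptP; rewrite !mxE /=; ring.
by rewrite E; under eq_fun do rewrite E.
Qed.

Lemma derive_line1 (f : 'cV[R]_2 -> R) (s t : R) : (forall y, differentiable f y) ->
  is_derive t (1 : R) (fun t => f (pt s t)) (partial 1 f (pt s t)).
Proof.
move=> fd; have := partial_along_line (pt s 0) 1 t fd.
have E t' : pt s 0 + t' *: delta_mx 1 0 = pt s t'.
  by apply: ptP; rewrite !mxE /=; ring.
by rewrite E; under eq_fun do rewrite E.
Qed.

Lemma mean_value_bound (F dF : R -> R) (C s t : R) :
  (forall c, is_derive c (1 : R) F (dF c)) ->
  (forall c, `|c - s| <= `|t - s| -> `|dF c| <= C) ->
  `|F t - F s| <= C * `|t - s|.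
Proof.
move=> Fd FC; have [st|/ltW ts] := leP s t.
  have [c /andP[c1 c2] ->] := real_MVT Fd st.
  rewrite normrM ler_wpM2r// FC// !ger0_norm ?subr_ge0//; lra.
rewrite distrC [`|t - s|]distrC; have [c /andP[c1 c2] ->] := real_MVT Fd ts.
rewrite normrM ler_wpM2r// FC// [`|c - s|]distrC [`|t - s|]distrC.
by rewrite !ger0_norm ?subr_ge0//; lra.
Qed.

Lemma primitive0 (f : R -> R) : primitive f 0 = 0.
Proof. exact: subrr. Qed.

(** The stream function is obtained by integrating [w] along the first axis
    and then parallel to the second one. Its second partial derivative is
    immediate; the first one differentiates an integral with respect to a
    parameter and uses that the divergence vanishes. Both are read off from
    one estimate of the increment. *)
Lemma stream_function (w : 'cV[R]_2 -> 'cV[R]_2) :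
  Ck_mx 1 w -> Zperiodic w ->
  (forall x, partial 0 (fun y => w y 0 0) x + partial 1 (fun y => w y 1 0) x = 0) ->
  exists u : 'cV[R]_2 -> R, forall x,
    [/\ differentiable u x, partial 0 u x = - w x 1 0 & partial 1 u x = w x 0 0].
Proof.
move=> w1 wp wdiv.
have dw i x : differentiable (fun y => w y i 0) x by have [] := (CkS 0 _).1 (w1 i 0).
have wc i : continuous (fun y => w y i 0) by exact: Ck_cont (w1 i 0).
have wpi i : Zperiodic (fun y => w y i 0) by move=> x k kint; rewrite wp.
have dwc : continuous (partial 0 (fun y => w y 0 0)).
  by have [_] := (CkS 0 _).1 (w1 0 0); exact.
have dwp : Zperiodic (partial 0 (fun y => w y 0 0)).
  move=> x k kint; apply: (@partial_quasiperiodic _ _ _ _ _ 0) => y.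
  by rewrite addr0 wpi.
have ptc0 t : continuous (fun s => pt s t).
  apply: (@lipschitz_cont R R 'cV[R]_2 _ 1) => s s'; rewrite mul1r.
  by apply: pt_dist => //; rewrite subrr normr0.
have ptc1 s : continuous (pt s).
  apply: (@lipschitz_cont R R 'cV[R]_2 _ 1) => t t'; rewrite mul1r.
  by apply: pt_dist => //; rewrite subrr normr0.
pose P (a y : R) := primitive (fun s => w (pt a s) 0 0) y.
pose Q (a : R) := primitive (fun s => w (pt s 0) 1 0) a.
have dP a (y : R) : is_derive y (1 : R) (P a) (w (pt a y) 0 0).
  have := @is_derive_primitive _ (fun s => w (pt a s) 0 0) y; apply.
  exact: (cont_comp_curve (wc 0) (ptc1 a)).
have dQ (a : R) : is_derive a (1 : R) Q (w (pt a 0) 1 0).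
  have := @is_derive_primitive _ (fun s => w (pt s 0) 1 0) a; apply.
  exact: (cont_comp_curve (wc 1) (ptc0 0)).
exists (fun x : 'cV[R]_2 => P (x 0 0) (x 1 0) - Q (x 0 0)) => x.
pose v := pt (- w x 1 0) (w x 0 0).
suff [ud up] : differentiable (fun x : 'cV[R]_2 => P (x 0 0) (x 1 0) - Q (x 0 0)) x /\
    forall j, partial j (fun x : 'cV[R]_2 => P (x 0 0) (x 1 0) - Q (x 0 0)) x = v j 0.
  by split=> //; rewrite up /v ?pt0 ?pt1.
apply: differentiable_of_bound => e e0.
(* The increment is the sum of four errors: the first is at most [e' * (`|y| +
   1)] times the norm of [h], and each of the other three is at most [e']
   times this norm. *)
pose c0 : R := `|x 1 0| + 4; have c00 : 0 < c0 by rewrite ltr_wpDl.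
pose e' := e / c0; have e'0 : 0 < e' by exact: divr_gt0.
have [r0 r00 u0] := periodic_unif_cont (wc 0) (wpi 0) e'0.
have [r1 r10 u1] := periodic_unif_cont (wc 1) (wpi 1) e'0.
have [r2 r20 u2] := periodic_unif_cont dwc dwp e'0.
pose r := Num.min (Num.min r0 r1) (Num.min r2 1).
exists r => [|h hr]; first by rewrite !lt_min r00 r10 r20 ltr01.
move: hr; rewrite !le_min => /andP[/andP[hr0 hr1] /andP[hr2 h1']].
set a := x 0 0; set y := x 1 0; set h0 := h 0 0; set h1 := h 1 0.
have xE : x = pt a y by rewrite pt_eta.
have h0h : `|h0| <= `|h| by exact: norm_coord_le.
have h1h : `|h1| <= `|h| by exact: norm_coord_le.
(* [D] is the effect of moving the vertical segment by [h0], minus its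
   expected first-order part. Its derivative is small because the divergence
   of [w] vanishes. *)
pose D z := P (a + h0) z - P a z + h0 * (w (pt a z) 1 0 - w (pt a 0) 1 0).
have A1 : `|D (y + h1) - D 0| <= e' * `|h| * `|y + h1 - 0|.
  apply: (@mean_value_bound D (fun z => w (pt (a + h0) z) 0 0 - w (pt a z) 0 0 +
      h0 * (partial 1 (fun y => w y 1 0) (pt a z) - 0))) => [z|z _].
    have d1 := is_derive_subf (dP (a + h0) z) (dP a z).
    have d2 := is_derive_subf (derive_line1 a z (dw 1)) (is_derive_cstf (w (pt a 0) 1 0) z).
    exact: is_derive_addf d1 (is_derive_scalef h0 d2).
  pose F s := w (pt s z) 0 0 - partial 0 (fun y => w y 0 0) (pt a z) * s.
  have dF s : is_derive s (1 : R) F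
      (partial 0 (fun y => w y 0 0) (pt s z) - partial 0 (fun y => w y 0 0) (pt a z)).
    exact: is_derive_subf (derive_line0 s z (dw 0)) (is_derive_mulid _ s).
  have FC (c : R) : `|c - a| <= `|a + h0 - a| ->
    `|partial 0 (fun y => w y 0 0) (pt c z) - partial 0 (fun y => w y 0 0) (pt a z)| <= e'.
    move=> ca; apply: u2; apply: pt_dist; last by rewrite subrr normr0 ltW.
    by rewrite (le_trans ca)// addrAC subrr add0r (le_trans h0h).
  have := mean_value_bound dF FC.
  rewrite (addrAC a h0 (- a)) subrr add0r => FB.
  have wd : partial 1 (fun y => w y 1 0) (pt a z) = - partial 0 (fun y => w y 0 0) (pt a z).
    by have := wdiv (pt a z); lra.
  apply: le_trans (ler_wpM2l (ltW e'0) h0h).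
  apply: le_trans FB; rewrite /F wd.
  rewrite le_eqVlt; apply/orP; left; apply/eqP; congr `|_|; ring.
have A2 : `|(P a (y + h1) - w x 0 0 * (y + h1)) - (P a y - w x 0 0 * y)| <= e' * `|y + h1 - y|.
  apply: (@mean_value_bound (fun z => P a z - w x 0 0 * z)
      (fun z => w (pt a z) 0 0 - w x 0 0)) => [z|z zy].
    exact: is_derive_subf (dP a z) (is_derive_mulid _ z).
  apply: u0; rewrite [X in _ - X]xE; apply: pt_dist; first by rewrite subrr normr0 ltW.
  by rewrite (le_trans zy)// addrAC subrr add0r (le_trans h1h).
have A3 : `|(Q (a + h0) - w (pt a 0) 1 0 * (a + h0)) - (Q a - w (pt a 0) 1 0 * a)|
    <= e' * `|a + h0 - a|.
  apply: (@mean_value_bound (fun z => Q z - w (pt a 0) 1 0 * z)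
      (fun z => w (pt z 0) 1 0 - w (pt a 0) 1 0)) => [z|z zy].
    exact: is_derive_subf (dQ z) (is_derive_mulid _ z).
  apply: u1; apply: pt_dist; last by rewrite subrr normr0 ltW.
  by rewrite (le_trans zy)// addrAC subrr add0r (le_trans h0h).
have A4 : `|w (pt a (y + h1)) 1 0 - w x 1 0| <= e'.
  apply: u1; rewrite [X in _ - X]xE; apply: pt_dist; first by rewrite subrr normr0 ltW.
  by rewrite addrAC subrr add0r (le_trans h1h).
have addKl (p q : R) : p + q - p = q by ring.
have D0 : D 0 = 0 by rewrite /D /P !primitive0; ring.
rewrite D0 !subr0 in A1; rewrite addKl in A2; rewrite addKl in A3.
pose a2 := P a (y + h1) - w x 0 0 * (y + h1) - (P a y - w x 0 0 * y).
pose a3 := Q (a + h0) - w (pt a 0) 1 0 * (a + h0) - (Q a - w (pt a 0) 1 0 * a).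
rewrite -/a2 in A2; rewrite -/a3 in A3.
rewrite sum2 /v pt0 pt1 !mxE -/a -/y -/h0 -/h1.
have -> : P (a + h0) (y + h1) - Q (a + h0) - (P a y - Q a) -
    (- w x 1 0 * h0 + w x 0 0 * h1) =
    D (y + h1) + a2 - a3 - h0 * (w (pt a (y + h1)) 1 0 - w x 1 0).
  by rewrite /D /a2 /a3; ring.
have B1 : `|D (y + h1)| <= e' * `|h| * (`|y| + 1).
  apply: (le_trans A1); apply: ler_wpM2l; first exact: mulr_ge0 (ltW e'0) _.
  by apply: (le_trans (ler_normD _ _)); rewrite lerD2l; exact: le_trans h1h _.
have B2 : `|a2| <= e' * `|h| by rewrite (le_trans A2)// ler_wpM2l ?(ltW e'0).
have B3 : `|a3| <= e' * `|h| by rewrite (le_trans A3)// ler_wpM2l ?(ltW e'0).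
have B4 : `|h0 * (w (pt a (y + h1)) 1 0 - w x 1 0)| <= e' * `|h|.
  by rewrite normrM mulrC ler_pM.
have -> : e * `|h| = e' * `|h| * (`|y| + 1) + e' * `|h| + e' * `|h| + e' * `|h|.
  have eE : e' * (`|y| + 4) = e by rewrite divfK ?lt0r_neq0.
  by rewrite -eE; ring.
rewrite (le_trans (ler_normB _ _))// lerD// (le_trans (ler_normB _ _))// lerD//.
by rewrite (le_trans (ler_normD _ _))// lerD.
Qed.

End Plane.

(** * Level sets of the stream function *)

Section PlanarOrbits.
Context {R : realType} (b : 'cV[R]_2 -> 'cV[R]_2) (X : R -> 'cV[R]_2 -> 'cV[R]_2).
Hypotheses (hb : Ck_sharp_mx 1 b) (hX : is_flow b X) (b0 : forall x, b x != 0).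

Lemma dot2 (x y : 'cV[R]_2) : dotv x y = x 0 0 * y 0 0 + x 1 0 * y 1 0.
Proof. exact: sum2. Qed.

Lemma dot2_norm (x y : 'cV[R]_2) : `|dotv x y| <= 2 * `|x| * `|y|.
Proof.
rewrite dot2 (le_trans (ler_normD _ _))// !normrM -mulrA mulr_natl mulr2n.
by apply: lerD; apply: ler_pM => //; exact: norm_coord_le.
Qed.

Lemma dot2_gt0 (x : 'cV[R]_2) : x != 0 -> 0 < dotv x x.
Proof.
move=> x0; rewrite dot2 lt0r addr_ge0 -?expr2 ?sqr_ge0// andbT.
apply: contra_neq x0 => /eqP; rewrite paddr_eq0 ?sqr_ge0// !sqrf_eq0.
by move=> /andP[/eqP e0 /eqP e1]; apply: ptP; rewrite mxE.
Qed.

(** Nearby values of [b] form an acute angle, uniformly: the squared norm has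
    a positive lower bound and [b] is Lipschitz. *)
Lemma field_dot : exists r m : R, [/\ 0 < r, 0 < m &
  forall y z, `|y - z| <= r -> m <= dotv (b y) (b z)].
Proof.
have [B B0 bB] := field_bounded hb; have [L L0 bL] := field_lipschitz hb.
have bc i : continuous (fun x : 'cV[R]_2 => b x i 0).
  by have := @continuous_coord R 'cV[R]_2 _ _ b i 0 (field_cont hb).
have [m m0 bm] : exists2 m : R, 0 < m & forall x, m <= dotv (b x) (b x).
  apply: periodic_pos_lb => [|x k kint|x]; last exact: dot2_gt0.
    by apply: cont_sum => i; exact: contM.
  by have [_ ->] := hb.
have B4 : 0 < 4 * B * L by rewrite !mulr_gt0.
exists (m / (4 * B * L)), (m / 2); split=> [||y z yz]; try by rewrite divr_gt0.
have -> : dotv (b y) (b z) = dotv (b y) (b y) - dotv (b y) (b y - b z).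
  by rewrite !dot2 !mxE; ring.
have : `|dotv (b y) (b y - b z)| <= m / 2.
  rewrite (le_trans (dot2_norm _ _))//.
  apply: (@le_trans _ _ (2 * B * (L * (m / (4 * B * L))))).
    apply: ler_pM => //; first by rewrite ler_wpM2l.
    by rewrite (le_trans (bL _ _))// ler_wpM2l// ltW.
  rewrite le_eqVlt; apply/orP; left; apply/eqP.
  by field; rewrite !lt0r_neq0.
by rewrite ler_norml => /andP[_ ?]; have := bm y; lra.
Qed.

Variables (sigma u : 'cV[R]_2 -> R).
Hypotheses (u2 : Ck 2 u) (s0 : forall x, sigma x != 0)
  (hu0 : forall x, partial 0 u x = - (sigma x * b x 1 0))
  (hu1 : forall x, partial 1 u x = sigma x * b x 0 0)
  (sp : Zperiodic sigma).

Let du x : differentiable u x.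
Proof. by have [] := (CkS 1 u).1 u2. Qed.

Lemma stream_invariant t x : u (X t x) = u x.
Proof.
have H s : is_derive s (1 : R) (fun s => u (X s x)) 0.
  have := is_derive_comp_curve (du _) (flow_derive hX x s).
  by rewrite sum2 hu0 hu1 (_ : _ + _ = 0)//; ring.
by rewrite (is_derive_const H) (flow0 hX).
Qed.

(** The trajectory of [y] is followed up to the point [p] whose projection on
    the line of direction [b y] is that of [z]; then [p] and [z] have the same
    level, and the mean value theorem gives two independent linear equations
    for [p - z]. *)
Lemma flow_box : exists delta K : R, [/\ 0 < delta, 0 < K &
  forall y z, `|y - z| <= delta -> u y = u z ->
  exists2 s, `|s| <= K * `|y - z| & z = X s y].
Proof.
have [B B0 bB] := field_bounded hb; have [r [m [r0 m0 bm]]] := field_dot.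
(* The function [f] below starts from a value at most [2 * B] times the
   distance of [y] and [z], and its slope is at least [m], which bounds the
   time at which it vanishes. *)
pose K := 2 * B / m; have K0 : 0 < K by rewrite divr_gt0// mulr_gt0.
have BK : 0 < B * K + 2 by rewrite addr_gt0// mulr_gt0.
exists (r / (B * K + 2)), K; split=> // [|y z yz uyz]; first exact: divr_gt0.
have {}yz : B * (K * `|y - z|) + 2 * `|y - z| <= r.
  by move: yz; rewrite ler_pdivlMr// mulrC mulrDl mulrA.
pose f s := dotv (b y) (X s y - z).
pose df s := dotv (b y) (b (X s y)).
have fd s : is_derive s (1 : R) f (df s).
  have d0 := is_derive_coord 0 0 (flow_derive hX y s).
  have d1 := is_derive_coord 1 0 (flow_derive hX y s).
  have e0 := is_derive_scalef (b y 0 0) (is_derive_subf d0 (is_derive_cstf (z 0 0) s)).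
  have e1 := is_derive_scalef (b y 1 0) (is_derive_subf d1 (is_derive_cstf (z 1 0) s)).
  have := is_derive_addf e0 e1; rewrite !subr0 /df dot2.
  rewrite (_ : (fun s => _) = f)//.
  by apply/funext => s'; rewrite /f dot2 !mxE.
have yz0 : 0 <= `|y - z| by [].
pose s1 := K * `|y - z|; have s10 : 0 <= s1 by rewrite mulr_ge0// ltW.
have Bs1 : B * s1 + 2 * `|y - z| <= r by [].
have Xy s : `|s| <= s1 -> `|X s y - y| <= B * s1.
  move=> ss; have := flow_speed hX 0 s y bB; rewrite (flow0 hX) subr0.
  by move=> /le_trans; apply; rewrite ler_wpM2l// ltW.
have dfm c : - s1 <= c <= s1 -> m <= df c.
  move=> cs; apply: bm; rewrite distrC (le_trans (Xy _ _)) ?ler_norml//.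
  by lra.
have f0 : `|f 0| <= m * s1.
  rewrite /f (flow0 hX) (le_trans (dot2_norm _ _))//.
  have -> : m * s1 = 2 * B * `|y - z| by rewrite /s1 /K; field; exact: lt0r_neq0.
  by rewrite ler_wpM2r// ler_wpM2l.
have fc : continuous f.
  by move=> s; apply/differentiable_continuous/derivable1_diffP; have [] := fd s.
have [c] : exists2 c, c \in `[- s1, s1] & f c = 0.
  apply: IVT; first by lra.
    exact: continuous_subspaceT.
  move: f0; rewrite ler_norml => /andP[fl fr].
  have [c1 /andP[c10 c11] E1] := real_MVT fd s10.
  have sN : - s1 <= 0 by lra.
  have [c2 /andP[c20 c21] E2] := real_MVT fd sN.
  have M1 : m * s1 <= df c1 * s1 by rewrite ler_wpM2r// dfm//; apply/andP; split; lra.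
  have M2 : m * s1 <= df c2 * s1 by rewrite ler_wpM2r// dfm//; apply/andP; split; lra.
  rewrite !subr0 in E1; rewrite sub0r opprK in E2.
  by rewrite ge_min le_max; apply/andP; split; apply/orP; [left|right]; lra.
rewrite in_itv /= => cs fc0.
have cs1 : `|c| <= s1 by rewrite ler_norml.
exists c => //; set p := X c y.
have [k /andP[k0 k1] E] := segment_MVT z (p - z) du.
have up : u (z + (p - z)) - u z = 0.
  by rewrite [z + _]addrC subrK stream_invariant uyz subrr.
set h := p - z in E up.
have hh : `|h| <= B * s1 + `|y - z|.
  rewrite /h (_ : p - z = (p - y) + (y - z)); last by rewrite addrA subrK.
  by rewrite (le_trans (ler_normD _ _))// lerD2r Xy.
have dpos : 0 < dotv (b y) (b (z + k *: h)).
  apply: lt_le_trans m0 _; apply: bm; rewrite opprD addrA.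
  rewrite (le_trans (ler_normB _ _))// normrZ ger0_norm//.
  have : k * `|h| <= `|h| by rewrite ler_piMl.
  by lra.
move: E; rewrite up sum2 hu0 hu1 => E.
have E1 : - b (z + k *: h) 1 0 * h 0 0 + b (z + k *: h) 0 0 * h 1 0 = 0.
  apply: (mulfI (s0 (z + k *: h))); rewrite mulr0 E; ring.
have E2 : b y 0 0 * h 0 0 + b y 1 0 * h 1 0 = 0 by rewrite -dot2.
rewrite dot2 in dpos; move: E1 E2 dpos.
move: (b (z + k *: h) 0 0) (b (z + k *: h) 1 0) (b y 0 0) (b y 1 0) => p0 p1 y0 y1.
move=> E1 E2 /lt0r_neq0 dpos.
suff : h = 0 by move/eqP; rewrite subr_eq0 => /eqP.
apply: ptP; rewrite [RHS]mxE; apply: (mulfI dpos); rewrite mulr0.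
  have -> : (y0 * p0 + y1 * p1) * h 0 0 = p0 * (y0 * h 0 0 + y1 * h 1 0) -
    y1 * (- p1 * h 0 0 + p0 * h 1 0) by ring.
  by rewrite E1 E2; ring.
have -> : (y0 * p0 + y1 * p1) * h 1 0 = p1 * (y0 * h 0 0 + y1 * h 1 0) +
  y0 * (- p1 * h 0 0 + p0 * h 1 0) by ring.
by rewrite E1 E2; ring.
Qed.

Lemma partial_stream_periodic j : Zperiodic (partial j u).
Proof.
have [_ bp] := hb; move: j; apply: ord2P => x k kint.
  by rewrite !hu0 sp// bp.
by rewrite !hu1 sp// bp.
Qed.

(** Correcting the segment from [x] to [y] gives a path inside their level
    set. It is cut into steps so short that the flow box applies to each of
    them. *)
Lemma level_orbit x y : u x = u y -> exists s, X s x = y.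
Proof.
move=> uxy; have [_ bp] := hb.
pose F (x : 'cV[R]_2) : 'cV[R]_1 := const_mx (u x).
have FE z i : (fun z => F z i 0) = u by apply/funext => z'; rewrite mxE.
have F2 : Ck_mx 2 F.
  by move=> i j; rewrite (_ : (fun x => _) = u)//; apply/funext => z; rewrite mxE.
have nablaF z : nabla F z = \row_j partial j u z.
  apply/matrixP => i j; rewrite !mxE; congr partial.
  by apply/funext => z'; rewrite mxE.
have nFp : Zperiodic (nabla F).
  move=> z k kint; rewrite !nablaF; apply/matrixP => i j; rewrite !mxE.
  exact: partial_stream_periodic.
have F1 : Ck_mx 1 F by move=> i j; apply: CkW; exact: F2 i j.
have CF : C1_pnabla F by exact: Ck1_C1_pnabla.
pose g2 (z : 'cV[R]_2) := partial 0 u z * partial 0 u z + partial 1 u z * partial 1 u z.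
have g20 z : g2 z != 0.
  have -> : g2 z = sigma z * sigma z * dotv (b z) (b z).
    by rewrite /g2 hu0 hu1 dot2; ring.
  by rewrite !mulf_neq0// lt0r_neq0// dot2_gt0.
have d1 j : Ck 1 (partial j u) by have [_] := (CkS 1 u).1 u2; exact.
pose A (z : 'cV[R]_2) : 'M[R]_(2, 1) := \col_j (partial j u z * (g2 z)^-1).
have rF : right_invertible F.
  apply: (@right_invertibleP _ _ _ F A).
  - move=> i j; rewrite (_ : (fun z => _) = fun z => partial i u z * (g2 z)^-1).
      by apply: CkM => //; apply: CkV => //; apply: CkD; exact: CkM.
    by apply/funext => z; rewrite mxE.
  - move=> z k kint; apply/matrixP => i j; rewrite !mxE /g2.
    by rewrite !partial_stream_periodic.
  - move=> z; apply/matrixP => i j; rewrite !ord1 mxE nablaF sum2 !mxE eqxx /=.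
    move: (g20 z); rewrite /g2; move: (partial 0 u z) (partial 1 u z) => g0 g1 gz.
    by field.
have [L L0 FL] := pnabla_lipschitz CF.
have [K [G [K0 GF G0 GL]]] := lifting CF rF (L * `|y - x|).
pose p (s : R) : 'cV[R]_2 := x + s *: (y - x).
have pd s t : `|p s - p t| = `|s - t| * `|y - x|.
  by rewrite /p opprD addrACA subrr add0r -scalerBl normrZ.
have p0 : p 0 = x by rewrite /p scale0r addr0.
have p1 : p 1 = y by rewrite /p scale1r addrC subrK.
pose v s := F x - F (p s).
have vB s : 0 <= s <= 1 -> `|v s| <= L * `|y - x|.
  move=> /andP[s00 s1]; rewrite (le_trans (FL _ _))// ler_wpM2l ?(ltW L0)//.
  by rewrite -[X in X - _]p0 pd sub0r normrN ger0_norm// ler_piMl.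
pose c s := G (p s) (v s).
have uc s : 0 <= s <= 1 -> u (c s) = u x.
  move=> s01; have := GF (p s) (v s) (vB s s01).
  by move=> /matrixP/(_ 0 0); rewrite /v /F !mxE => ->; ring.
have c0 : c 0 = x by rewrite /c /v p0 subrr G0.
have c1 : c 1 = y.
  rewrite /c /v p1 (_ : F x - F y = 0) ?G0//.
  by apply/matrixP => i j; rewrite !mxE uxy subrr.
pose M := K * ((1 + L) * `|y - x|).
have cL s t : 0 <= s <= 1 -> 0 <= t <= 1 -> `|c s - c t| <= M * `|s - t|.
  move=> s01 t01; rewrite (le_trans (GL _ _ _ _ (vB _ s01) (vB _ t01)))//.
  rewrite /M -mulrA ler_wpM2l ?(ltW K0)//.
  have -> : (1 + L) * `|y - x| * `|s - t| = `|p s - p t| + L * `|p t - p s|.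
    by rewrite !pd [`|t - s|]distrC; ring.
  rewrite lerD2l /v (_ : _ - _ = F (p t) - F (p s)) ?FL//.
  by apply/matrixP => i j; rewrite !mxE; ring.
have M0 : 0 <= M by rewrite !mulr_ge0 ?addr_ge0 ?(ltW K0) ?(ltW L0).
have [delta [Kb [delta0 Kb0 box]]] := flow_box.
have e0 : 0 < delta / (M + 1) by rewrite divr_gt0// ltr_wpDl.
near \oo => n.
have small : M * n.+1%:R^-1 <= delta.
  have : n.+1%:R^-1 < delta / (M + 1).
    by near: n; exact: near_infty_natSinv_lt (PosNum e0).
  rewrite ltr_pdivlMr ?ltr_wpDl// mulrDr mulr1 mulrC => H.
  by rewrite ltW// (le_lt_trans _ H)// lerDl invr_ge0.
have t01 (j : nat) : (j <= n.+1)%N -> 0 <= (j%:R / n.+1%:R : R) <= 1.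
  move=> jn; apply/andP; split; first by rewrite divr_ge0.
  by rewrite ler_pdivrMr ?ltr0n// mul1r ler_nat.
have chain (j : nat) : (j <= n.+1)%N -> exists s, X s x = c (j%:R / n.+1%:R).
  elim: j => [_|j IH jn]; first by exists 0; rewrite mul0r c0 (flow0 hX).
  have [s Xs] := IH (ltnW jn).
  have := box (c (j%:R / n.+1%:R)) (c (j.+1%:R / n.+1%:R)).
  rewrite !uc ?t01// ?(ltnW jn)// => H.
  have /H/(_ erefl)[s' _ ->] : `|c (j%:R / n.+1%:R) - c (j.+1%:R / n.+1%:R)| <= delta.
    rewrite (le_trans (cL _ _ (t01 _ (ltnW jn)) (t01 _ jn)))// (le_trans _ small)//.
    rewrite ler_wpM2l// -mulrBl -[j.+1%:R]natr1 opprD addrA subrr add0r mulN1r normrN.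
    by rewrite ger0_norm// invr_ge0.
  by exists (s' + s); rewrite -(flow_add hb hX) Xs.
have [s] := chain n.+1 (leqnn _).
by rewrite divff ?pnatr_eq0// c1 => <-; exists s.
Unshelve. all: by end_near. Qed.

End PlanarOrbits.

(** * Transit times *)

Lemma continuous_eps (R : realType) (V : normedModType R) (f : V -> R) :
  (forall (x : V) (e : R), 0 < e ->
     exists2 r : R, 0 < r & forall y : V, `|x - y| < r -> `|f x - f y| < e) ->
  continuous f.
Proof.
move=> H x; apply/cvgrPdist_lt => e e0; have [r r0 fr] := H x e e0.
by near=> y; apply: fr; near: y; exact: near_dist_lt.
Unshelve. all: by end_near. Qed.

Section TransitTimes.
Context {R : realType} (d : nat) (b : 'cV[R]_d -> 'cV[R]_d)
  (X : R -> 'cV[R]_d -> 'cV[R]_d).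
Hypotheses (hb : Ck_sharp_mx 1 b) (hX : is_flow b X).

Lemma transit_shift (T : R) (x k : 'cV[R]_d) : k \is a mxOver Num.int ->
  X T x = x + k -> forall t, X (t + T) x = X t x + k.
Proof. by move=> kint XT t; rewrite -(flow_add hb hX) XT (flow_int hb hX). Qed.

Lemma transit_opp (T : R) (x k : 'cV[R]_d) : k \is a mxOver Num.int ->
  X T x = x + k -> X (- T) x = x - k.
Proof.
move=> kint XT; have := transit_shift kint XT (- T).
by rewrite addNr (flow0 hX) => {2}->; rewrite addrK.
Qed.

Lemma transit_expansion (B T : R) (x k : 'cV[R]_d) : (forall x, `|b x| <= B) ->
  k \is a mxOver Num.int -> 0 < T -> X T x = x + k ->
  forall t, 0 <= t -> `|X t x - x - t *: (T^-1 *: k)| <= B * T + `|k|.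
Proof.
move=> bB kint T0 XT; apply: (period_expansion hX bB T0) => t _.
exact: transit_shift.
Qed.

Variable q : 'cV[R]_d.
Hypotheses (qint : q \is a mxOver Num.int) (q0 : q != 0).

Lemma transit_neq0 (T : R) x : X T x = x + q -> T != 0.
Proof.
apply: contra_eq_neq => /= ->; rewrite (flow0 hX) -[X in X != _]addr0.
by rewrite (inj_eq (addrI x)) eq_sym.
Qed.

(** Two transit times would differ by a period of the trajectory, which would
    then have a zero mean velocity; but the translation by [q] gives it a
    non-zero one. *)
Lemma transit_unique (T T' : R) x : X T x = x + q -> X T' x = x + q -> T = T'.
Proof.
move=> XT XT'; have [B B0 bB] := field_bounded hb.
have T0 := transit_neq0 XT.
apply/eqP; rewrite -subr_eq0; apply/negPn/negP => p0.
have Xp : X (T - T') x = x + 0.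
  by rewrite -(flow_add hb hX) (transit_opp qint XT') (flow_int hb hX) ?mxOver_intN// XT addrK addr0.
have pos (p : R) (k : 'cV[R]_d) : k \is a mxOver Num.int -> p != 0 -> X p x = x + k ->
    exists p' k', [/\ 0 < p', k' \is a mxOver Num.int, X p' x = x + k' & k' = k \/ k' = - k].
  move=> kint; rewrite neq_lt => /orP[pn|pp] Xpk.
    exists (- p), (- k); rewrite oppr_gt0 mxOver_intN//; split=> //; last by right.
    exact: transit_opp.
  by exists p, k; split => //; left.
have [t [k [t0 kint Xt kq]]] := pos T q qint T0 XT.
have zint : (0 : 'cV[R]_d) \is a mxOver Num.int.
  by apply/mxOverP => i j; rewrite mxE rpred0.
have [t' [k' [t'0 k'int Xt' kq']]] := pos (T - T') 0 zint p0 Xp.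
have k'0 : k' = 0 by case: kq' => ->; rewrite ?oppr0.
have := rotation_unique (transit_expansion bB kint t0 Xt)
  (transit_expansion bB k'int t'0 Xt').
rewrite k'0 scaler0 => /eqP; rewrite scaler_eq0 invr_eq0 (gt_eqF t0)/= => /eqP k0.
move/eqP: q0; apply; case: kq => kq; first by rewrite -kq.
by rewrite -[q]opprK -kq k0 oppr0.
Qed.

Variable T : 'cV[R]_d -> R.
Hypothesis XT : forall x, X (T x) x = x + q.

Let T_periodic : Zperiodic T.
Proof.
move=> x k kint; apply: (@transit_unique _ _ (x + k)) => //.
by rewrite (flow_int hb hX)// XT addrAC.
Qed.

(* The flow box: points close to each other at the same level are
   close in time. *)
Variables (u : 'cV[R]_d -> R) (delta K : R).
Hypotheses (delta0 : 0 < delta) (K0 : 0 < K).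
Hypothesis box : forall y z, `|y - z| <= delta -> u y = u z ->
  exists2 s, `|s| <= K * `|y - z| & z = X s y.
Hypotheses (uX : forall t x, u (X t x) = u x) (uq : forall x, u (x + q) = u x).

Let T_cont : continuous T.
Proof.
apply: (@continuous_eps R 'cV[R]_d) => x e e0.
have [C C0 XC] := flow_lipschitz hb hX `|T x|.
have C1 : 0 < C + 1 by rewrite addr_gt0.
have KC : 0 < K * (C + 1) by rewrite mulr_gt0.
exists (Num.min (delta / (C + 1)) (e / (K * (C + 1)))) => [|y].
  by rewrite lt_min !divr_gt0.
rewrite lt_min !ltr_pdivlMr// => /andP[y1 y2].
have dist : `|X (T x) y - (y + q)| <= (C + 1) * `|x - y|.
  have -> : X (T x) y - (y + q) = (X (T x) y - X (T x) x) + (x - y).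
    by rewrite XT; apply/matrixP => i j; rewrite !mxE; ring.
  rewrite (le_trans (ler_normD _ _))// mulrDl mul1r lerD2r [`|x - y|]distrC.
  exact: XC.
have near : `|X (T x) y - (y + q)| <= delta by rewrite (le_trans dist)// mulrC ltW.
have level : u (X (T x) y) = u (y + q) by rewrite uX uq.
have [s sK E] := box near level.
have -> : T y = s + T x.
  by apply: (@transit_unique _ _ y) => //; rewrite -(flow_add hb hX) -E.
rewrite (_ : T x - (s + T x) = - s); last by ring.
rewrite normrN (le_lt_trans sK)// (le_lt_trans _ y2)//.
by rewrite [leRHS]mulrC -mulrA ler_wpM2l// ltW.
Qed.

(** The transit time from [x] to [x + q] is unique, hence periodic in [x]; it
    is continuous by the flow box and never vanishes. So it is bounded and has
    a constant sign. If it is negative, the transit from [x] to [x - q] takes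
    a positive time. *)
Lemma transit_bounded : exists q' : 'cV[R]_d,
  [/\ q' \is a mxOver Num.int, q' = q \/ q' = - q &
   exists2 Tm : R, 0 < Tm & forall x, exists2 t, 0 < t <= Tm & X t x = x + q'].
Proof.
have Tn0 x : T x != 0 := transit_neq0 (XT x).
have [Tm Tm0 TTm] := periodic_bounded T_cont T_periodic.
have [[x0 Tx0]|/forallNP Tneg] := pselect (exists x, 0 < T x).
  exists q; split=> //; first by left.
  exists Tm => // x; exists (T x) => //.
  rewrite (le_trans (ler_norm _) (TTm x)) andbT lt0r Tn0 /=.
  rewrite leNgt; apply/negP => Tx.
  pose c s := T (x + s *: (x0 - x)).
  have cc : continuous c.
    apply: (cont_comp_curve T_cont) => s.
    apply/differentiable_continuous/derivable1_diffP.
    by have [] := is_derive_line x (x0 - x) s.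
  have [|||s _ /eqP] := @IVT _ c 0 1 0.
  - by [].
  - exact: continuous_subspaceT.
  - rewrite /c scale0r addr0 scale1r addrC subrK ge_min le_max.
    by rewrite (ltW Tx) (ltW Tx0) orbT.
  - by rewrite (negPf (Tn0 _)).
exists (- q); split; [exact: mxOver_intN | by right | exists Tm => // x].
have Tx : T x < 0.
  by rewrite lt_neqAle Tn0 leNgt; apply/negP/Tneg.
exists (- T x); last exact: transit_opp.
by rewrite oppr_gt0 Tx (le_trans _ (TTm x))// -normrN ler_norm.
Qed.

End TransitTimes.

Section Progress.
Context {R : realType} (d : nat) (b : 'cV[R]_d -> 'cV[R]_d)
  (X : R -> 'cV[R]_d -> 'cV[R]_d).
Hypotheses (hb : Ck_sharp_mx 1 b) (hX : is_flow b X).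

Lemma dotv_norm (x y : 'cV[R]_d) : `|dotv x y| <= d%:R * `|x| * `|y|.
Proof.
rewrite (le_trans (ler_norm_sum _ _ _))//.
apply: (@le_trans _ _ (\sum_(i < d) `|x| * `|y|)).
  by apply: ler_sum => i _; rewrite normrM ler_pM// norm_coord_le.
by rewrite sumr_const card_ord -mulrA mulr_natl.
Qed.

(** Up to an error that does not depend on [tau], the displacement at the time
    [tau] is a multiple of [q] by a factor at least [tau / Tm]. *)
Lemma uniform_progress (q : 'cV[R]_d) (Tm : R) : q \is a mxOver Num.int ->
  0 < dotv q q -> 0 < Tm ->
  (forall x, exists2 t, 0 < t <= Tm & X t x = x + q) ->
  exists2 tau : R, 0 < tau & forall x, 1 <= dotv q (X tau x - x).
Proof.
move=> qint qq0 Tm0 HT; have [B B0 bB] := field_bounded hb.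
pose C := d%:R * `|q| * (B * Tm + `|q|).
have C0 : 0 <= C by rewrite !mulr_ge0 ?addr_ge0 ?mulr_ge0 ?(ltW B0) ?(ltW Tm0).
have C1 : 0 < C + 1 by rewrite ltr_wpDl.
pose tau := (C + 1) * Tm / dotv q q.
have tau0 : 0 < tau by rewrite divr_gt0// mulr_gt0.
exists tau => // x.
have [t /andP[t0 tTm] Xt] := HT x.
have H := transit_expansion hb hX bB qint t0 Xt (ltW tau0).
have dist : `|dotv q (X tau x - x - tau *: (t^-1 *: q))| <= C.
  rewrite (le_trans (dotv_norm _ _))// ler_wpM2l ?mulr_ge0//.
  by rewrite (le_trans H)// lerD2r ler_wpM2l// ltW.
have E : dotv q (X tau x - x) = dotv q (X tau x - x - tau *: (t^-1 *: q)) +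
    tau / t * dotv q q.
  rewrite /dotv mulr_sumr -big_split; apply: eq_bigr => i _; rewrite !mxE /=; ring.
have lead : C + 1 <= tau / t * dotv q q.
  rewrite /tau mulrAC divfK ?lt0r_neq0//.
  by rewrite ler_pdivlMr// ler_pM2l.
by move: dist; rewrite ler_norml => /andP[? _]; rewrite E; lra.
Qed.

End Progress.

(** * A coordinate that increases along the flow *)

Section EulerScheme.
Context {R : realType} (d : nat) (b : 'cV[R]_d -> 'cV[R]_d)
  (X : R -> 'cV[R]_d -> 'cV[R]_d).
Hypotheses (hb : Ck_sharp_mx 1 b) (hX : is_flow b X).

Lemma discrete_gronwall (a : nat -> R) (kappa beta : R) : 0 <= kappa -> 0 <= beta ->
  a 0 = 0 -> (forall n, a n.+1 <= (1 + kappa) * a n + beta) ->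
  forall n, a n <= n%:R * beta * expR (n%:R * kappa).
Proof.
move=> k0 b0 a0 step; elim=> [|n IH]; first by rewrite a0 !mul0r.
apply: (le_trans (step n)).
have e1 : 1 + kappa <= expR kappa by exact: expR_ge1Dx.
have -> : expR (n.+1%:R * kappa) = expR kappa * expR (n%:R * kappa).
  by rewrite -expRD -natr1 mulrDl mul1r addrC.
set P := expR (n%:R * kappa) in IH *.
have P1 : 1 <= P by rewrite -expR0 ler_expR mulr_ge0.
have E1 : 1 <= expR kappa by rewrite -expR0 ler_expR.
have H1 : (1 + kappa) * a n <= expR kappa * (n%:R * beta * P).
  apply: (le_trans (ler_wpM2l _ IH)); first by rewrite addr_ge0.
  by apply: ler_wpM2r => //; rewrite !mulr_ge0// (le_trans _ P1).
have H2 : beta <= beta * (expR kappa * P).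
  by rewrite ler_peMr// (le_trans E1)// ler_peMr// (le_trans _ E1).
have -> : n.+1%:R * beta * (expR kappa * P) =
    expR kappa * (n%:R * beta * P) + beta * (expR kappa * P).
  by rewrite -[n.+1%:R]natr1; ring.
exact: lerD.
Qed.

Variable h : R.
Hypothesis h0 : 0 <= h.

Definition euler (x : 'cV[R]_d) : 'cV[R]_d := x + h *: b x.

Lemma euler_int n x k : k \is a mxOver Num.int ->
  iter n euler (x + k) = iter n euler x + k.
Proof.
move=> kint; elim: n => //= n ->; have [_ bp] := hb.
by rewrite /euler bp// addrAC.
Qed.

Lemma Ck_euler m n : Ck_mx m b -> Ck_mx m (iter n euler).
Proof.
move=> bm; have Em : Ck_mx m euler.
  apply: Ck_mxD; first exact: Ck_mx_id.
  move=> i j; rewrite (_ : (fun x => _) = fun x => h * b x i j).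
    by apply: CkZ; exact: bm.
  by apply/funext => x; rewrite mxE.
elim: n => [|n IH]; first exact: Ck_mx_id.
exact: (Ck_mx_comp Em IH).
Qed.

Let db i x : differentiable (fun y => b y i 0) x.
Proof. by have [+ _] := hb => /(_ i 0)/CkS[]. Qed.

Let d_iter n i x : differentiable (fun y => iter n euler y i 0) x.
Proof.
by have [+ _] := hb => /(Ck_euler n)/(_ i 0)/CkS[].
Qed.

Let w n x : 'cV[R]_d := nabla (iter n euler) x *m b x.

Let w0 x : w 0 x = b x.
Proof. by rewrite /w (_ : iter 0 euler = id)// nabla_id mul1mx. Qed.

Let wS n x : w n.+1 x = w n x + h *: (nabla b (iter n euler x) *m w n x).
Proof.
have dE i y : differentiable (fun y => euler y i 0) y := d_iter 1 i y.
rewrite /w (_ : iter n.+1 euler = fun y => euler (iter n euler y))//.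
rewrite nabla_comp//; last first.
have -> : nabla euler (iter n euler x) = 1%:M + h *: nabla b (iter n euler x).
  apply/matrixP => i j; rewrite !mxE.
  rewrite (_ : (fun y => euler y i 0) = fun y : 'cV[R]_d => y i 0 + h * b y i 0).
    rewrite partialD ?partialZ ?partial_coord//.
      exact: differentiable_coord.
    exact: differentiable_scale.
  by apply/funext => y; rewrite !mxE.
by rewrite -mulmxA mulmxDl mul1mx -scalemxAl.
Qed.

(** A flow transports its own field into itself: [nabla (X t) x *m b x] is [b
    (X t x)]. For the scheme, the difference of the two sides obeys a linear
    recursion whose source is small compared with [h]. *)
Lemma euler_transport (B Lam e r : R) : (forall x, `|b x| <= B) ->
  (forall x (v : 'cV[R]_d), `|nabla b x *m v| <= Lam * `|v|) -> 0 <= Lam -> 0 <= e ->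
  (forall x h h', `|h| <= r -> `|h'| <= r ->
    `|b (x + h) - b (x + h') - nabla b x *m (h - h')| <= e * `|h - h'|) ->
  h * B <= r -> forall n x,
  `|w n x - b (iter n euler x)| <= n%:R * (h * B * e) * expR (n%:R * (h * Lam)).
Proof.
move=> bB bL L0 e0 br hBr n x.
have B0 : 0 <= B by exact: le_trans (bB x).
pose a n := `|w n x - b (iter n euler x)|.
apply: (discrete_gronwall (a := a)); rewrite ?mulr_ge0//.
  by rewrite /a w0 /= subrr normr0.
move=> {}n; rewrite /a wS /=; set y := iter n euler x; set v := w n x.
have hb0 : `|h *: b y| <= h * B by rewrite normrZ ger0_norm// ler_wpM2l.
have := br y (h *: b y) 0 (le_trans hb0 hBr).
rewrite normr0 => /(_ (le_trans (mulr_ge0 h0 B0) hBr)).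
rewrite addr0 subr0 -scalemxAr => E1.
have -> : v + h *: (nabla b y *m v) - b (euler y) = (v - b y) +
    h *: (nabla b y *m (v - b y)) -
    (b (y + h *: b y) - b y - h *: (nabla b y *m b y)).
  rewrite mulmxBr /euler; apply/matrixP => i j; rewrite ![in LHS]mxE ![in RHS]mxE.
  by move: (\sum_k _) (\sum_k _) (b (_ + _) _ _) => *; ring.
rewrite (le_trans (ler_normB _ _))// lerD//; last first.
  rewrite (le_trans E1)// mulrC ler_wpM2r//.
rewrite (le_trans (ler_normD _ _))// mulrDl mul1r lerD2l normrZ ger0_norm//.
by rewrite -mulrA ler_wpM2l.
Qed.

(** Each of the [n] steps adds an error [C h ^ 2], amplified by the later
    ones. *)
Lemma euler_error (L C : R) : (forall x y, `|b x - b y| <= L * `|x - y|) ->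
  0 <= L -> 0 <= C -> (forall x, `|X h x - (x + h *: b x)| <= C * h ^+ 2) ->
  forall n x, `|iter n euler x - X (n%:R * h) x| <=
    n%:R * (C * h ^+ 2) * expR (n%:R * (h * L)).
Proof.
move=> bL L0 C0 XC n x.
pose a n := `|iter n euler x - X (n%:R * h) x|.
apply: (discrete_gronwall (a := a)); rewrite ?mulr_ge0 ?sqr_ge0//.
  by rewrite /a /= mul0r (flow0 hX) subrr normr0.
move=> {}n; rewrite /a /=.
have -> : n.+1%:R * h = h + n%:R * h by rewrite -natr1; ring.
rewrite -(flow_add hb hX).
set y := iter n euler x; set z := X _ x.
have -> : euler y - X h z = (y - z) + h *: (b y - b z) - (X h z - (z + h *: b z)).
  by apply/matrixP => i j; rewrite !mxE; ring.
rewrite (le_trans (ler_normB _ _))// lerD//.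
rewrite (le_trans (ler_normD _ _))// mulrDl mul1r lerD2l normrZ ger0_norm//.
by rewrite -mulrA ler_wpM2l.
Qed.

Lemma partial_euler_sum (q : 'cV[R]_d) (N : nat) x :
  \sum_j partial j (fun x => \sum_(n < N) dotv q (iter n euler x)) x * b x j 0 =
  \sum_(n < N) dotv q (w n x).
Proof.
have dq (n : 'I_N) : differentiable (fun x => dotv q (iter n euler x)) x.
  by apply: differentiable_bigsum => i; apply: differentiable_scale.
rewrite (eq_bigr (fun j => \sum_(n < N) \sum_i
    q i 0 * (partial j (fun y => iter n euler y i 0) x * b x j 0))) => [|j _].
  rewrite exchange_big; apply: eq_bigr => n _; rewrite exchange_big.
  by apply: eq_bigr => i _; rewrite -mulr_sumr /w nabla_mulE.
rewrite partial_sum// mulr_suml; apply: eq_bigr => n _.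
rewrite partial_sum => [|i]; last exact: differentiable_scale.
rewrite mulr_suml; apply: eq_bigr => i _.
by rewrite partialZ// mulrA.
Qed.

End EulerScheme.

Section IncreasingCoordinate.
Context {R : realType} (d : nat) (b : 'cV[R]_d -> 'cV[R]_d)
  (X : R -> 'cV[R]_d -> 'cV[R]_d).
Hypotheses (hb : Ck_sharp_mx 1 b) (hX : is_flow b X).

Lemma dotvB (q x y : 'cV[R]_d) : dotv q (x - y) = dotv q x - dotv q y.
Proof. by rewrite /dotv -sumrB; apply: eq_bigr => i _; rewrite !mxE mulrBr. Qed.

Lemma dotvD (q x y : 'cV[R]_d) : dotv q (x + y) = dotv q x + dotv q y.
Proof. by rewrite /dotv -big_split; apply: eq_bigr => i _; rewrite !mxE mulrDr. Qed.

Lemma dotvZ (q x : 'cV[R]_d) (c : R) : dotv q (c *: x) = c * dotv q x.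
Proof. by rewrite /dotv mulr_sumr; apply: eq_bigr => i _; rewrite !mxE mulrCA. Qed.

(** The integral of [dotv q (X t x)] for [t] between [0] and [tau] has, along
    the flow, the derivative [dotv q (X tau x - x)], which is positive.
    Replacing the flow by the iterates of the Euler scheme turns this integral
    into a finite sum, which inherits the regularity of [b] by the chain rule
    alone, and keeps the derivative positive when the step is small. *)
Lemma increasing_coordinate (q : 'cV[R]_d) (tau : R) : Ck_mx 2 b -> 0 < tau ->
  (forall x, 1 <= dotv q (X tau x - x)) ->
  exists (N : nat) (V : 'cV[R]_d -> R),
    [/\ (0 < N)%N, Ck 2 V,
        forall x k, k \is a mxOver Num.int -> V (x + k) = V x + N%:R * dotv q k &
        forall x, 0 < \sum_j partial j V x * b x j 0].
Proof.
move=> b2 tau0 prog; have Cb := C1_sharp_pnabla hb.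
have [B B0 bB] := field_bounded hb; have [L L0 bL] := field_lipschitz hb.
have [C C0 XC] := flow_euler hb hX.
have [_ nbc nbp] := Cb; have [Bn Bn0 nB] := periodic_bounded nbc nbp.
pose Lam := d%:R * Bn; have Lam0 : 0 <= Lam by rewrite mulr_ge0// ltW.
have bLam x (v : 'cV[R]_d) : `|nabla b x *m v| <= Lam * `|v|.
  by rewrite (le_trans (mulmx_norm_le _ _))// ler_wpM2r// ler_wpM2l.
pose Q := d%:R * `|q|; have Q0 : 0 <= Q by rewrite mulr_ge0.
(* [K1 * e] bounds the error due to the transport of the field by the scheme,
   and [K2 * h] the error on the end of the trajectory; both are made at most
   1/4. *)
pose K1 := Q * tau * (tau * B) * expR (tau * Lam).
pose K2 := Q * tau * C * expR (tau * L).
have K10 : 0 <= K1.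
  by rewrite /K1 !mulr_ge0// ?expR_ge0 ?(ltW tau0) ?(ltW B0).
have K20 : 0 <= K2.
  by rewrite /K2 !mulr_ge0// ?expR_ge0 ?(ltW tau0) ?(ltW C0).
pose e := (4 * (K1 + 1))^-1.
have e0 : 0 < e by rewrite invr_gt0 mulr_gt0// ltr_wpDl.
have K1e : K1 * e <= 4^-1.
  by rewrite /e ler_pdivrMr ?mulr_gt0 ?ltr_wpDl//; lra.
have [r r0 br] := pnabla_unif_diff Cb e0.
have s1 : 0 < r / (tau * B) by rewrite divr_gt0// mulr_gt0.
have d2 : 0 < 4 * (K2 * tau + 1).
  by rewrite mulr_gt0// ltr_wpDl// mulr_ge0// ltW.
have s2 : 0 < (4 * (K2 * tau + 1))^-1 by rewrite invr_gt0.
near \oo => m.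
have m1 : m.+1%:R^-1 < r / (tau * B) by near: m; exact: near_infty_natSinv_lt (PosNum s1).
have m2 : m.+1%:R^-1 < (4 * (K2 * tau + 1))^-1.
  by near: m; exact: near_infty_natSinv_lt (PosNum s2).
pose N := m.+1; pose h := tau / N%:R.
have N0 : 0 < N%:R :> R by rewrite ltr0n.
have h0 : 0 < h by exact: divr_gt0.
have Nh : N%:R * h = tau by rewrite mulrC divfK// lt0r_neq0.
have hB : h * B <= r.
  by move: m1; rewrite ltr_pdivlMr ?mulr_gt0// => /ltW; rewrite mulrA [_ * tau]mulrC.
have K2h : K2 * h <= 4^-1.
  move: m2; rewrite ltf_pV2 ?posrE// => H.
  rewrite /h mulrA ler_pdivrMr//; move: H; rewrite -/N.
  by move: (K2 * tau) N%:R => A S; lra.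
pose E := euler b h.
pose V (x : 'cV[R]_d) : R := \sum_(n < N) dotv q (iter n E x).
exists N, V; split=> // [|x k kint|x].
- apply: Ck_sum => n; apply: Ck_sum => i; apply: CkZ.
  exact: (Ck_euler h n b2 i 0).
- rewrite /V (eq_bigr (fun n : 'I_N => dotv q (iter n E x) + dotv q k)).
    by rewrite big_split /= sumr_const card_ord mulr_natl.
  by move=> n _; rewrite (euler_int hb)// dotvD.
rewrite (partial_euler_sum hb).
rewrite -(pmulr_rgt0 _ h0) mulr_sumr.
pose w (n : nat) : 'cV[R]_d := nabla (iter n E) x *m b x.
(* The second part of each term is small, and the first parts add up to the
   displacement of the scheme in the time [tau]. *)
have split_n (n : 'I_N) : h * dotv q (w n) =
    (dotv q (iter n.+1 E x) - dotv q (iter n E x)) + h * dotv q (w n - b (iter n E x)).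
  by rewrite /= /E /euler dotvD dotvZ dotvB; ring.
rewrite (eq_bigr _ (fun n _ => split_n n)) big_split /=.
rewrite -(big_mkord xpredT (fun n => dotv q (iter n.+1 E x) - dotv q (iter n E x))).
rewrite telescope_sumr//=.
have T1 : `|\sum_(n < N) h * dotv q (w n - b (iter n E x))| <= K1 * e.
  rewrite (le_trans (ler_norm_sum _ _ _))//.
  apply: (@le_trans _ _ (\sum_(n < N) h * (Q * (tau * B * e * expR (tau * Lam))))).
    apply: ler_sum => n _; rewrite normrM (ger0_norm (ltW h0)) ler_wpM2l ?(ltW h0)//.
    rewrite (le_trans (dotv_norm _ _))// ler_wpM2l//.
    have nN : n%:R <= N%:R :> R by rewrite ler_nat ltnW.
    have := euler_transport hb (ltW h0) bB bLam Lam0 (ltW e0) br hB n x.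
    move=> /le_trans; apply.
    have hBe : 0 <= h * B * e by rewrite !mulr_ge0// ltW.
    apply: ler_pM; [exact: mulr_ge0 | exact: expR_ge0 | |].
      have -> : tau * B * e = N%:R * (h * B * e) by rewrite -Nh; ring.
      exact: ler_wpM2r.
    have -> : tau * Lam = N%:R * (h * Lam) by rewrite -Nh; ring.
    by rewrite ler_expR; apply: ler_wpM2r => //; rewrite mulr_ge0// ltW.
  rewrite sumr_const card_ord -mulr_natl mulrA Nh /K1.
  by rewrite le_eqVlt; apply/orP; left; apply/eqP; ring.
have T2 : `|dotv q (iter N E x - X tau x)| <= K2 * h.
  rewrite (le_trans (dotv_norm _ _))// -/Q.
  have := euler_error hb hX (ltW h0) bL (ltW L0) (ltW C0)
    (fun x => XC h x (ltW h0)) N x.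
  rewrite Nh => /(ler_wpM2l Q0) /le_trans; apply.
  have -> : N%:R * (h * L) = tau * L by rewrite -Nh; ring.
  rewrite /K2; move: (expR _) => P; rewrite -Nh.
  by rewrite le_eqVlt; apply/orP; left; apply/eqP; ring.
have -> : dotv q (E (iter m E x)) - dotv q x =
    dotv q (iter N E x - X tau x) + dotv q (X tau x - x).
  by rewrite !dotvB /N /=; ring.
move: T1 T2 (prog x); rewrite !ler_norml => /andP[? _] /andP[? _] ?.
move: K1e K2h; lra.
Unshelve. all: by end_near. Qed.

End IncreasingCoordinate.

(** * The planar case *)

Section PlanarExpansion.
Context {R : realType} (b : 'cV[R]_2 -> 'cV[R]_2) (X : R -> 'cV[R]_2 -> 'cV[R]_2).
Hypotheses (hb : Ck_sharp_mx 1 b) (hX : is_flow b X).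
Hypotheses (hb2 : Ck_sharp_mx 2 b) (b0 : forall x, b x != 0).
Variable sigma : 'cV[R]_2 -> R.
Hypotheses (s5 : Ck_sharp 5 sigma) (s0 : forall x, 0 < sigma x)
  (inv : invariant_measure X (density_measure sigma))
  (com : commensurable (mean_mx (fun x => sigma x *: b x))).

Let w x := sigma x *: b x.

Let s2 : Ck 2 sigma.
Proof. by have [+ _] := s5; apply: Ck_leq. Qed.

Let sp : Zperiodic sigma. Proof. by have [] := s5. Qed.

Let w2 : Ck_mx 2 w.
Proof.
move=> i j; rewrite (_ : (fun x => _) = fun x => sigma x * b x i j).
  apply: CkM; first exact: s2.
  by have [b2 _] := hb2; exact: b2.
by apply/funext => x; rewrite mxE.
Qed.

Let wE i x : w x i 0 = sigma x * b x i 0. Proof. exact: mxE. Qed.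

Let wp : Zperiodic w.
Proof. by move=> x k kint; have [_ bp] := hb; rewrite /w sp// bp. Qed.

(** The increment of the stream function over an integer vector is given by
    the mean of [sigma b] rotated by a quarter turn, so it vanishes on the
    relation [k] rotated in the same way. *)
Lemma commensurable_stream : exists (u : 'cV[R]_2 -> R) (q : 'cV[R]_2),
  [/\ Ck 2 u, forall x, partial 0 u x = - (sigma x * b x 1 0),
      forall x, partial 1 u x = sigma x * b x 0 0 &
      [/\ q \is a mxOver Num.int, q != 0 & forall x, u (x + q) = u x]].
Proof.
have sc := Ck_cont s2.
have w1 : Ck_mx 1 w by move=> i j; apply: CkW; exact: w2.
have wdiv x : partial 0 (fun y => w y 0 0) x + partial 1 (fun y => w y 1 0) x = 0.
  have := divergence_free hb hX sc sp s0 inv w2 x; rewrite sum2.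
  by under eq_fun do rewrite -wE; under [X in partial 1 X]eq_fun do rewrite -wE.
have [u hu] := stream_function w1 wp wdiv.
have hu0 x : partial 0 u x = - (sigma x * b x 1 0).
  by have [_ -> _] := hu x; rewrite wE.
have hu1 x : partial 1 u x = sigma x * b x 0 0.
  by have [_ _ ->] := hu x; rewrite wE.
have pu0 : partial 0 u = fun x => -1 * w x 1 0.
  by apply/funext => x; rewrite hu0 wE mulN1r.
have pu1 : partial 1 u = fun x => w x 0 0 by apply/funext => x; rewrite hu1 wE.
have u2 : Ck 2 u.
  apply/CkS; split; first by move=> x; have [] := hu x.
  apply: ord2P; first by rewrite pu0; apply: CkZ; exact: w1.
  by rewrite pu1; exact: w1.
have up j : Zperiodic (partial j u).
  by move: j; apply: ord2P; rewrite ?pu0 ?pu1 => x k kint; rewrite wp.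
have [k [kint k0 kv]] := com.
pose q := pt (- k 1 0) (k 0 0).
have /mxOverP ki := kint.
exists u, q; split=> //; split.
- apply/mxOverP => i j; rewrite ord1; move: i; apply: ord2P.
    by rewrite pt0 rpredN.
  by rewrite pt1.
- apply: contra_neq k0 => q0; apply: ptP; rewrite mxE.
    by rewrite -[LHS](pt1 (- k 1 0)) -/q q0 mxE.
  by apply: oppr_inj; rewrite oppr0 -[LHS](pt0 _ (k 0 0)) -/q q0 mxE.
- move=> x; rewrite increment_mean//.
  - rewrite sum2 pu0 pu1 meanZ; last exact: Ck_cont (w1 1 0).
    rewrite pt0 pt1 mulN1r mulrNN -[RHS]addr0; congr (_ + _); rewrite -kv dot2 !mxE.
    by rewrite addrC.
  - exact: CkW.
  - apply/mxOverP => i j; rewrite ord1; move: i; apply: ord2P.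
      by rewrite pt0 rpredN.
    by rewrite pt1.
Qed.

(** The first coordinate increases along the trajectories and the second one,
    the stream function, is constant along them. The Jacobian determinant is
    [sigma] times the derivative of the first coordinate along [b]. *)
Lemma planar_coordinates : exists (U : 'cV[R]_2 -> 'cV[R]_2) (q : 'cV[R]_2) (c : R),
  [/\ Ck_mx 2 U, Zperiodic (nabla U) &
  [/\ forall x, 0 < (nabla U x *m b x) 0 0,
      forall x (i : 'I_2), i != 0 -> (nabla U x *m b x) i 0 = 0,
      forall x, \det (nabla U x) != 0 &
      [/\ q \is a mxOver Num.int, q != 0, 0 < c &
          forall x, U (x + q) = U x + c *: delta_mx 0 0]]].
Proof.
have [u [q0 [u2 hu0 hu1 [q0int q00 uq0]]]] := commensurable_stream.
have sN x : sigma x != 0 by rewrite lt0r_neq0.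
have uX := stream_invariant hX u2 hu0 hu1.
have uq0' x : u x = u (x + q0) by rewrite uq0.
have /choice[T XT] x : exists t, X t x = x + q0 :=
  level_orbit hb hX b0 u2 sN hu0 hu1 sp (uq0' x).
have [delta [K [delta0 K0 box]]] := flow_box hb hX b0 u2 sN hu0 hu1.
have [q [qint qq [Tm Tm0 HT]]] :=
  transit_bounded hb hX q0int q00 XT delta0 K0 box uX uq0.
have uq x : u (x + q) = u x.
  by case: qq => ->; rewrite ?uq0// -[in RHS](subrK q0 x) uq0.
have qn0 : q != 0 by case: qq => ->; rewrite ?oppr_eq0.
have Q0 := dot2_gt0 qn0.
have [tau tau0 prog] := uniform_progress hb hX qint Q0 Tm0 HT.
have [b2 _] := hb2.
have [N [V [N0 V2 VZ Vb]]] := increasing_coordinate hb hX b2 tau0 prog.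
pose U (x : 'cV[R]_2) := pt (V x) (u x).
have U0 : (fun x => U x 0 0) = V by apply/funext => x; rewrite /U pt0.
have U1 : (fun x => U x 1 0) = u by apply/funext => x; rewrite /U pt1.
have up := partial_stream_periodic hb hu0 hu1 sp.
have Vp j : Zperiodic (partial j V).
  move=> x k kint; apply: (@partial_quasiperiodic _ _ _ _ _ (N%:R * dotv q k)).
  by move=> y; exact: VZ.
exists U, q, (N%:R * dotv q q); split.
- move=> i j; rewrite ord1; move: i; apply: ord2P; first by rewrite U0.
  by rewrite U1.
- move=> x k kint; apply/matrixP => i j; rewrite !mxE; move: i; apply: ord2P.
    by rewrite U0 Vp.
  by rewrite U1 up.
split.
- by move=> x; rewrite nabla_mulE U0.
- move=> x; apply: ord2P => // _; rewrite nabla_mulE U1 sum2 hu0 hu1; ring.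
- move=> x; have -> : \det (nabla U x) =
      sigma x * \sum_j partial j V x * b x j 0.
    rewrite (expand_det_row _ 0) sum2 /cofactor !det_mx11 !mxE /=.
    have -> : lift 0 0 = 1 :> 'I_2 by exact: val_inj.
    have -> : lift 1 0 = 0 :> 'I_2 by exact: val_inj.
    by rewrite U0 U1 sum2 hu0 hu1 !expr0 !expr1; ring.
  by rewrite mulf_neq0// lt0r_neq0.
- split=> // [|x]; first by rewrite mulr_gt0// ltr0n.
  by rewrite /U VZ// uq; apply: ptP; rewrite !mxE /=; ring.
Qed.

(** The coordinates of the previous lemma are rectified. As [U] increases by a
    multiple of the first basis vector over [q], the direction [xi] of the
    rectified field is proportional to [q]. *)
Lemma planar_expansion :
  exists (M : 'M[R]_2) (Psi_sharp Psi Phi : 'cV[R]_2 -> 'cV[R]_2)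
         (a : 'cV[R]_2 -> R) (xi : 'cV[R]_2) (T : R),
    torus_C2_diffeo M Psi_sharp Psi Phi /\
    (Ck_sharp 1 a /\ forall y, a y != 0) /\
    [/\ xi != 0, 0 < T & T *: xi \is a mxOver Num.int] /\
    let b_hat := fun y => nabla Psi (Phi y) *m b (Phi y) in
    let X_hat := fun t y => Psi (X t (Phi y)) in
    [/\ forall y, b_hat y = a y *: xi,
        is_flow b_hat X_hat &
        fine_expansion X setT (fun x => zeta_mean a xi T (Psi x))].
Proof.
have [U [q [c [U2 Up [Upos Uzero U0 [qint qn0 c0 Uq]]]]]] := planar_coordinates.
have [Lunit [Phi [diffeo [a0 a1 bE flow_hat expansion]]]] :=
  rectification hb hX U2 Up Upos Uzero U0.
set L := mean_mx (nabla U) in Lunit diffeo bE flow_hat expansion *.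
have U1 : Ck_mx 1 U by move=> i j; apply: CkW; exact: U2.
have Lq : L *m q = c *: delta_mx 0 0.
  apply: (addrI (U 0)); rewrite -Uq; apply: esym; exact: quasi_periodic.
have xiE : invmx L *m delta_mx 0 0 = c^-1 *: q.
  apply: (canRL (scalerK (lt0r_neq0 c0))).
  by rewrite scalemxAr -Lq mulKmx.
do 7 eexists; split; first exact: diffeo.
split; first by split; [exact: a1 | move=> y; rewrite lt0r_neq0].
have cxi : c *: (invmx L *m delta_mx 0 0) = q.
  by rewrite xiE scalerA divff ?scale1r// lt0r_neq0.
split; last by split; [exact: bE | exact: flow_hat | apply: (expansion c) => //; rewrite cxi].
split=> //; last by rewrite cxi.
by rewrite xiE scaler_eq0 invr_eq0 (gt_eqF c0).
Qed.

End PlanarExpansion.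

Theorem theorem4p1 (R : realType) (d : nat) (b : 'cV[R]_d -> 'cV[R]_d)
    (X : R -> 'cV[R]_d -> 'cV[R]_d)
    (hb : Ck_sharp_mx 1 b) (hX : is_flow b X) :
  (* (i) *)
  (forall A : set 'cV[R]_d, A !=set0 ->
    exists2 C_A : R, 0 < C_A &
      forall (T_A k_A : R) (T : 'cV[R]_d -> R) (k : 'cV[R]_d -> 'cV[R]_d),
        0 < T_A -> 0 < k_A ->
        (forall x, A x ->
          [/\ 0 < T x <= T_A, k x \is a mxOver Num.int, enorm (k x) <= k_A &
              forall t, 0 <= t -> X (t + T x) x = X t x + k x]) ->
        expansion_bound X A (fun x => (T x)^-1 *: k x) C_A)
  /\
  (* (ii) *)
  (d = 2%N ->
    Ck_sharp_mx 2 b -> (forall x, b x != 0) ->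
    forall sigma : 'cV[R]_d -> R,
      Ck_sharp 5 sigma -> (forall x, 0 < sigma x) -> mean sigma = 1 ->
      invariant_measure X (density_measure sigma) ->
      commensurable (mean_mx (fun x => sigma x *: b x)) ->
      exists (M : 'M[R]_d) (Psi_sharp Psi Phi : 'cV[R]_d -> 'cV[R]_d)
             (a : 'cV[R]_d -> R) (xi : 'cV[R]_d) (T : R),
        torus_C2_diffeo M Psi_sharp Psi Phi /\
        (Ck_sharp 1 a /\ forall y, a y != 0) /\
        [/\ xi != 0, 0 < T & T *: xi \is a mxOver Num.int] /\
        let b_hat := fun y => nabla Psi (Phi y) *m b (Phi y) in
        let X_hat := fun t y => Psi (X t (Phi y)) in
        [/\ forall y, b_hat y = a y *: xi,
            is_flow b_hat X_hat &
            fine_expansion X setT (fun x => zeta_mean a xi T (Psi x))])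
  /\
  (* (iii), where i1 is the first index *)
  ((2 < d)%N ->
    forall (i1 : 'I_d), i1 = 0%N :> nat ->
    forall U : 'cV[R]_d -> 'cV[R]_d,
      Ck_mx 2 U -> Ck_sharp_mx 1 (nabla U) ->
      (forall x, 0 < (nabla U x *m b x) i1 0) ->
      (forall x (i : 'I_d), i != i1 -> (nabla U x *m b x) i 0 = 0) ->
      (forall x, \det (nabla U x) != 0) ->
      let M := invmx (mean_mx (nabla U)) in
      let xi := M *m delta_mx i1 0 in
      let Psi := fun x => M *m U x in
      mean_mx (nabla U) \in unitmx /\
      exists Phi : 'cV[R]_d -> 'cV[R]_d,
        (exists N Psi_sharp, torus_C2_diffeo N Psi_sharp Psi Phi) /\
        let a := fun y => (nabla U (Phi y) *m b (Phi y)) i1 0 in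
        let b_hat := fun y => nabla Psi (Phi y) *m b (Phi y) in
        let X_hat := fun t y => Psi (X t (Phi y)) in
        [/\ forall y, 0 < a y,
            forall y, b_hat y = a y *: xi,
            is_flow b_hat X_hat &
            forall T : R, 0 < T -> T *: xi \is a mxOver Num.int ->
              fine_expansion X setT (fun x => zeta_mean a xi T (Psi x))]).
Proof.
split.
  move=> A _; have [C C0 HC] := periodic_expansion hb hX A.
  by exists C => // T_A k_A T k TA0 kA0 H; exact: HC TA0 kA0 H.
split.
  move=> d2 hb2 b0 sigma s5 s0 _ inv com; subst d.
  exact: (planar_expansion hb hX hb2 b0 s5 s0 inv com).
move=> _ i1 _ U U2 [U1 Up] Upos Uzero U0 M xi Psi.
have [Lunit [Phi [diffeo [a0 _ bE flow_hat expansion]]]] :=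
  rectification hb hX U2 Up Upos Uzero U0.
split=> //; exists Phi; split; first by do 2 eexists; exact: diffeo.
by split.
Qed.
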